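(* For every $n\ge1$ and $0\le k\le n-1$, the induced map $$\overline\rho_{n,k}:\mathcal{NZ}_{n,k}\longrightarrow\mathcal R_{n,k}$$ is an isomorphism. More precisely, for every $$b=\frac{M_1\cdots M_{j+1}}{p_{I_1}\cdots p_{I_j}}\in\mathcal B_{n,k},\qquad B_i=I_i\setminus I_{i-1},$$ the element $$\widetilde b=[\beta_{B_1}(M_1)|\cdots|\beta_{B_{j+1}}(M_{j+1})]$$ belongs to $\mathcal{NZ}_{n,k}$, and the elements $\widetilde b$, $b\in\mathcal B_{n,k}$, form a basis of $\mathcal{NZ}_{n,k}$.
   Context: Let $\Bbbk$ be a field of characteristic zero, $[n]=\{1,\dots,n\}$, $p_1,\dots,p_n$ independent variables, and $p_I=\sum_{i\in I}p_i$ for $\varnothing\ne I\subseteq[n]$. **Algebras.** A Novikov-Zinbiel algebra is a $\Bbbk$-vector space with two bilinear operations $\prec,\succ$ satisfying: the Zinbiel identity $x\succ(y\succ z)=(x\succ y)\succ z+(y\succ x)\succ z$; the Novikov identities $(x\prec y)\prec z=(x\prec z)\prec y$ and $(x\prec y)\prec z-x\prec(y\prec z)=(y\prec x)\prec z-y\prec(x\prec z)$; and the compatibility identities $(x\succ y)\prec z=x\succ(y\prec z)$, $x\prec(y\succ z)=(x\prec y)\succ z+(y\prec x)\succ z+(y\succ x)\prec z$, and $(x\prec y)\succ z+(y\prec x)\succ z=(x\prec z)\succ y+(z\prec x)\succ y$. $\mathcal{NZ}(n)$ is the multilinear component (in $x_1,\dots,x_n$) of the free Novikov-Zinbiel algebra,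 and $\mathcal{NZ}_{n,k}$ is the span in it of the multilinear monomials with exactly $k$ occurrences of $\prec$; $\mathcal{NZ}(n)=\bigoplus_{k=0}^{n-1}\mathcal{NZ}_{n,k}$. Likewise, $\mathcal{NZ}(B)$ denotes the multilinear component on variables $x_a$, $a\in B$, for a finite set $B$. **Coefficients.** For a multilinear $\prec,\succ$-monomial $T$ in variables $x_a$, define the rational function $c_T$ in the $p_a$ by $c_{x_a}=1$, $c_{U\prec V}=p_Vc_Uc_V$, $c_{U\succ V}=c_Uc_V/p_U$, where $p_U$ is the sum of the $p_a$ over variables $x_a$ occurring in $U$; extend linearly. All the defining identities are respected, so $T\mapsto c_T$ is well defined on $\mathcal{NZ}(B)$. $\mathcal R_{n,k}$ is the span of the $c_T$ with $T$ a multilinear monomial in $x_1,\dots,x_n$ with exactly $k$ occurrences of $\prec$, and $\overline\rho_{n,k}:\mathcal{NZ}_{n,k}\to\mathcal R_{n,k}$ is the surjective linear map $T\mapsto c_T$. **The set $\mathcal B_{n,k}$.** It consists of all functions $\frac{M_1\cdots M_{j+1}}{p_{I_1}\cdots p_{I_j}}$ arising from: $j\ge0$; a strict chain $\varnothing=I_0\subsetneq I_1\subsetneq\cdots\subsetneq I_j\subsetneq I_{j+1}=[n]$ with blocks $B_s=I_s\setminus I_{s-1}$; integers $d_s$ with $0\le d_s\le|B_s|-1$, $d_s\equiv|B_s|-1\pmod2$, $\sum_{s=1}^{j+1}d_s=2k+j-n+1$; for $1\le s\le j$, a monomial $M_s$ (coefficient $1$) of degree $d_s$ in $\{p_a\mid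 a\in B_s\setminus\{\max B_s\}\}$; and a monomial $M_{j+1}$ (coefficient $1$) of degree $d_{j+1}$ in $\{p_a\mid a\in B_{j+1}\}$. (Distinct data give distinct functions, so $b$ determines its data.) **Blocks and chains.** In a Novikov-Zinbiel algebra put $\mu(x,y,z)=(x\prec y+y\prec x)\succ z$. Set $\Pi(a)=a$ and $\Pi(a_1,\dots,a_{2h+1})=\mu(\Pi(a_1,\dots,a_{2h-1}),a_{2h},a_{2h+1})$. For a finite nonempty set $B$ with $|B|=r$ and a monomial $M$ of degree $d$ in $p_a$, $a\in B$, with $0\le d\le r-1$, $d\equiv r-1\pmod 2$, put $h=(r-1-d)/2$, choose $C\subseteq B$ with $|C|=d+1$ containing all indices of variables occurring in $M$, write $B\setminus C=\{a_1,\dots,a_{2h}\}$, and let $P_C(M)$ be the unique element of the multilinear component of the free Novikov algebra (operation $\prec$) on $x_a$, $a\in C$, whose coefficient is $M$ (the coefficient map identifies this component with homogeneous polynomials of degree $|C|-1$ in $p_a$, $a\in C$). Then $\beta_B(M)=\Pi(P_C(M),x_{a_1},\dots,x_{a_{2h}})\in\mathcal{NZ}(B)$; it does not depend on the choices made. Finally, $[P_1|\cdots|P_s]=(((P_1\succ P_2)\succ P_3)\cdots)\succ P_s$. *)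

(* Defs.v *)
From HB Require Import structures.
From mathcomp Require Import all_boot all_order all_algebra ring.
From mathcomp Require Import mpoly.
From mathcomp Require Import boolp classical_sets functions.

Set Implicit Arguments.
Unset Strict Implicit.
Unset Printing Implicit Defensive.
Import GRing.Theory.
Local Open Scope ring_scope.
Local Open Scope quotient_scope.

Section LinearSpans.
Variables (F : fieldType) (V : lmodType F).

Definition lspan (A : set V) : set V := fun x =>
  exists s : seq (F * V),
    (forall av, av \in s -> A av.2) /\ x = \sum_(av <- s) av.1 *: av.2.

Definition is_basis (I : choiceType) (D : set I) (v : I -> V) (W : set V) :=
  [/\ forall i, D i -> W (v i),
      forall (s : seq I) (a : I -> F), uniq s -> (forall i, i \in s -> D i) ->
        \sum_(i <- s) a i *: v i = 0 -> forall i, i \in s -> a i = 0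
    & forall x, W x -> lspan (fun y => exists2 i, D i & y = v i) x].

End LinearSpans.

(* Algebras over F with a family of bilinear operations indexed by O. *)

Definition bilinear_op (F : fieldType) (A : lmodType F) (f : A -> A -> A) :=
  (forall x, linear (f x)) /\ (forall y, linear (f ^~ y)).

Definition identities (F : fieldType) (O : Type) :=
  forall A : lmodType F, (O -> A -> A -> A) -> Prop.

Definition is_algebra (F : fieldType) (O : Type) (Th : identities F O)
    (A : lmodType F) (op : O -> A -> A -> A) :=
  (forall o, bilinear_op (op o)) /\ Th A op.


Section Identities.
Variables (F : fieldType) (A : lmodType F) (prec succ : A -> A -> A).
Local Notation "x ≺ y" := (prec x y) (at level 40, no associativity).
Local Notation "x ≻ y" := (succ x y) (at level 40, no associativity).

Definition novikov_ids := forall x y z : A,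
  (x ≺ y) ≺ z = (x ≺ z) ≺ y /\
  (x ≺ y) ≺ z - x ≺ (y ≺ z) = (y ≺ x) ≺ z - y ≺ (x ≺ z).

Definition zinbiel_ids := forall x y z : A,
  x ≻ (y ≻ z) = (x ≻ y) ≻ z + (y ≻ x) ≻ z.

Definition compatibility_ids := forall x y z : A,
  [/\ (x ≻ y) ≺ z = x ≻ (y ≺ z),
      x ≺ (y ≻ z) = (x ≺ y) ≻ z + (y ≺ x) ≻ z + (y ≻ x) ≺ z
    & (x ≺ y) ≻ z + (y ≺ x) ≻ z = (x ≺ z) ≻ y + (z ≺ x) ≻ y].

End Identities.

Inductive nzop := Prec | Succ.

Definition NovTheory (F : fieldType) : identities F unit :=
  fun A op => novikov_ids (op tt).

Definition NZTheory (F : fieldType) : identities F nzop := fun A op =>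
  [/\ zinbiel_ids (op Succ), novikov_ids (op Prec)
    & compatibility_ids (op Prec) (op Succ)].

(* The free algebra on X: formal expressions modulo the equalities that hold
   in every algebra of the variety under every assignment of the variables. *)

Inductive term (F : fieldType) (O X : Type) :=
| TVar of X
| TZero
| TAdd of term F O X & term F O X
| TScale of F & term F O X
| TOp of O & term F O X & term F O X.
Arguments TVar {F O X}.
Arguments TZero {F O X}.

HB.instance Definition _ (F : fieldType) (O X : Type) :=
  gen_eqMixin (term F O X).
HB.instance Definition _ (F : fieldType) (O X : Type) :=
  gen_choiceMixin (term F O X).

Fixpoint teval (F : fieldType) (O X : Type) (A : lmodType F)
    (op : O -> A -> A -> A) (v : X -> A) (t : term F O X) : A :=
  match t with
  | TVar x => v x
  | TZero => 0
  | TAdd s t => teval op v s + teval op v t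
  | TScale a t => a *: teval op v t
  | TOp o s t => op o (teval op v s) (teval op v t)
  end.

Section FreeAlgebra.
Variables (F : fieldType) (O X : Type) (Th : identities F O).
Local Notation term := (term F O X).

Definition teqP (s t : term) : Prop :=
  forall (A : lmodType F) (op : O -> A -> A -> A) (v : X -> A),
    is_algebra Th op -> teval op v s = teval op v t.
Definition teq : rel term := fun s t => `[< teqP s t >].

Lemma teq_refl : reflexive teq.
Proof. by move=> s; apply/asboolP. Qed.
Lemma teq_sym : ssrbool.symmetric teq.
Proof.
by move=> s t; apply/asboolP/asboolP => h A op v /h ->.
Qed.
Lemma teq_trans : transitive teq.
Proof.
move=> t s u /asboolP st /asboolP tu; apply/asboolP => A op v hA.
by rewrite (st _ _ _ hA) tu.
Qed.
Canonical teq_equiv := EquivRel teq teq_refl teq_sym teq_trans.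

Definition freealg := {eq_quot teq}.
HB.instance Definition _ := Choice.on freealg.
HB.instance Definition _ : EqQuotient _ teq freealg := EqQuotient.on freealg.

Lemma free_eq (s t : term) : (\pi_freealg s = \pi_freealg t) <-> teqP s t.
Proof.
split=> [/eqmodP /asboolP //|h]; apply/eqmodP; exact/asboolP.
Qed.

Lemma free_repr (t : term) : teqP (repr (\pi_freealg t)) t.
Proof. by apply/free_eq; rewrite reprK. Qed.

Definition fvar (x : X) : freealg := \pi_freealg (TVar x).
Definition fzero : freealg := \pi_freealg TZero.
Definition fadd (a b : freealg) : freealg := \pi_freealg (TAdd (repr a) (repr b)).
Definition fscale (c : F) (a : freealg) : freealg :=
  \pi_freealg (TScale c (repr a)).
Definition fopp := fscale (-1).
Definition fop (o : O) (a b : freealg) : freealg :=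
  \pi_freealg (TOp o (repr a) (repr b)).


Lemma fadd_pi s t : fadd (\pi_freealg s) (\pi_freealg t) = \pi_freealg (TAdd s t).
Proof. by apply/free_eq => A op v hA /=; rewrite !(free_repr _ v hA). Qed.
Lemma fscale_pi c s : fscale c (\pi_freealg s) = \pi_freealg (TScale c s).
Proof. by apply/free_eq => A op v hA /=; rewrite !(free_repr _ v hA). Qed.
Lemma fop_pi o s t : fop o (\pi_freealg s) (\pi_freealg t) = \pi_freealg (TOp o s t).
Proof. by apply/free_eq => A op v hA /=; rewrite !(free_repr _ v hA). Qed.

Local Tactic Notation "free_tac" ident(A) ident(op) ident(v) ident(hA) :=
  apply/free_eq => A op v hA; do ?[rewrite /= (free_repr _ v hA)]; rewrite /=.

Lemma faddA : associative fadd.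
Proof. by move=> a b c; free_tac A op v hA; rewrite addrA. Qed.
Lemma faddC : commutative fadd.
Proof. by move=> a b; free_tac A op v hA; rewrite addrC. Qed.
Lemma fadd0 : left_id fzero fadd.
Proof. by move=> a; rewrite -[RHS]reprK; free_tac A op v hA; rewrite add0r. Qed.
Lemma faddN : left_inverse fzero fopp fadd.
Proof. by move=> a; free_tac A op v hA; rewrite scaleN1r addNr. Qed.
HB.instance Definition _ := GRing.isZmodule.Build freealg faddA faddC fadd0 faddN.

Lemma fscaleA a b x : fscale a (fscale b x) = fscale (a * b) x.
Proof. by free_tac A op v hA; rewrite scalerA. Qed.
Lemma fscale1 : left_id 1 fscale.
Proof. by move=> a; rewrite -[RHS]reprK; free_tac A op v hA; rewrite scale1r. Qed.
Lemma fscaleDr : right_distributive fscale +%R.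
Proof. by move=> a x y; free_tac A op v hA; rewrite scalerDr. Qed.
Lemma fscaleDl x : {morph fscale^~ x : a b / a + b}.
Proof. by move=> a b; free_tac A op v hA; rewrite scalerDl. Qed.
HB.instance Definition _ :=
  GRing.Zmodule_isLmodule.Build F freealg fscaleA fscale1 fscaleDr fscaleDl.

Lemma fpiD s t : \pi_freealg s + \pi_freealg t = \pi_freealg (TAdd s t).
Proof. exact: fadd_pi. Qed.
Lemma fpiZ c s : c *: \pi_freealg s = \pi_freealg (TScale c s).
Proof. exact: fscale_pi. Qed.

Lemma fop_bilinear o : bilinear_op (fop o).
Proof.
by split=> x a y z; free_tac A op v hA; [exact: (hA.1 o).1 | exact: (hA.1 o).2].
Qed.

Definition feval (A : lmodType F) (op : O -> A -> A -> A) (v : X -> A)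
  (x : freealg) : A := teval op v (repr x).

Section UniversalProperty.
Variables (A : lmodType F) (op : O -> A -> A -> A) (v : X -> A).
Hypothesis hA : is_algebra Th op.

Lemma feval_pi t : feval op v (\pi_freealg t) = teval op v t.
Proof. exact: free_repr. Qed.
Lemma feval_linear : linear (feval op v).
Proof.
move=> a; elim/quotW=> s.
elim/quotW=> t.
by rewrite fpiZ fpiD !feval_pi.
Qed.
Lemma fevalD : {morph feval op v : x y / x + y}.
Proof. by move=> x y; rewrite -[x]scale1r feval_linear !scale1r. Qed.
Lemma fevalB : {morph feval op v : x y / x - y}.
Proof. by move=> x y; rewrite addrC -scaleN1r feval_linear scaleN1r addrC. Qed.
Lemma feval_op o x y : feval op v (fop o x y) = op o (feval op v x) (feval op v y).
Proof.
by elim/quotW: x => s; elim/quotW: y => t; rewrite fop_pi !feval_pi.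
Qed.
Lemma feval_var x : feval op v (fvar x) = v x.
Proof. exact: feval_pi. Qed.
Lemma feval_unique (f : freealg -> A) : linear f ->
  (forall o x y, f (fop o x y) = op o (f x) (f y)) ->
  (forall x, f (fvar x) = v x) -> f =1 feval op v.
Proof.
move=> lf fo fv; elim/quotW=> t.
rewrite feval_pi.
have f0 : f 0 = 0.
  by have /eqP := lf 1 0 0; rewrite !scale1r addr0 -subr_eq0 opprD addNKr oppr_eq0 => /eqP.
elim: t => [x||s IHs t IHt|a t IHt|o s IHs t IHt] /=.
- exact: fv.
- exact: f0.
- by rewrite -fpiD -[X in X + _]scale1r lf scale1r IHs IHt.
- by rewrite -fpiZ -[_ *: _]addr0 lf f0 addr0 IHt.
- by rewrite -fop_pi fo IHs IHt.
Qed.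
End UniversalProperty.

Lemma free_ext (x y : freealg) :
  (forall (A : lmodType F) (op : O -> A -> A -> A) (v : X -> A),
     is_algebra Th op -> feval op v x = feval op v y) -> x = y.
Proof. by move=> h; rewrite -[x]reprK -[y]reprK; apply/free_eq. Qed.

End FreeAlgebra.

Section FreeNovikovZinbiel.
Variables (F : fieldType) (X : Type).

Definition freeNov := freealg X (@NovTheory F).
Definition freeNZ := freealg X (@NZTheory F).
HB.instance Definition _ := GRing.Lmodule.on freeNov.
HB.instance Definition _ := GRing.Lmodule.on freeNZ.

Definition nov : unit -> freeNov -> freeNov -> freeNov := @fop _ _ _ _.
Definition nz : nzop -> freeNZ -> freeNZ -> freeNZ := @fop _ _ _ _.

Lemma freeNov_is_algebra : is_algebra (@NovTheory F) nov.
Proof.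
split=> [o|x y z]; first exact: fop_bilinear.
by split; apply: free_ext => A op v hA; rewrite ?(fevalB, feval_op) //;
  case: (hA.2 (feval op v x) (feval op v y) (feval op v z)).
Qed.

Lemma freeNZ_is_algebra : is_algebra (@NZTheory F) nz.
Proof.
split=> [o|]; first exact: fop_bilinear.
by split=> x y z; try split; apply: free_ext => A op v hA;
  rewrite ?(fevalB, fevalD, feval_op) //; case: hA.2 => h1 h2 h3;
  
  move: (h1 (feval op v x) (feval op v y) (feval op v z));
  case: (h2 (feval op v x) (feval op v y) (feval op v z));
  case: (h3 (feval op v x) (feval op v y) (feval op v z)).
Qed.

Lemma nz_prec_novikov : is_algebra (@NovTheory F) (fun _ : unit => nz Prec).
Proof.
by case: freeNZ_is_algebra => hb [_ h _]; split=> [_|]; [exact: hb|exact: h].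
Qed.

Definition nov_to_nz : freeNov -> freeNZ :=
  feval (fun _ : unit => nz Prec) (@fvar _ _ _ _).


Lemma nov_to_nz_linear : linear nov_to_nz.
Proof. exact: feval_linear nz_prec_novikov. Qed.
Lemma nov_to_nz_op x y :
  nov_to_nz (nov tt x y) = nz Prec (nov_to_nz x) (nov_to_nz y).
Proof. exact: feval_op nz_prec_novikov _ _ _. Qed.
Lemma nov_to_nz_var x : nov_to_nz (fvar _ x) = fvar _ x.
Proof. exact: feval_var nz_prec_novikov _. Qed.

End FreeNovikovZinbiel.


Inductive monomial (O X : Type) :=
| MVar of X
| MOp of O & monomial O X & monomial O X.

Fixpoint leaves (O X : Type) (T : monomial O X) : seq X :=
  match T with MVar a => [:: a] | MOp _ U V => leaves U ++ leaves V end.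

Fixpoint meval (O X A : Type) (op : O -> A -> A -> A) (v : X -> A)
    (T : monomial O X) : A :=
  match T with
  | MVar a => v a
  | MOp o U V => op o (meval op v U) (meval op v V)
  end.

Fixpoint nprec (X : Type) (T : monomial nzop X) : nat :=
  match T with
  | MVar _ => 0
  | MOp Prec U V => (nprec U + nprec V).+1
  | MOp Succ U V => nprec U + nprec V
  end.

Definition multilinear_on (O : Type) n (B : {set 'I_n})
  (T : monomial O 'I_n) := perm_eq (leaves T) (enum B).

(* The field of rational functions in p_1, ..., p_n, as a vector space over
   the field of constants. *)

Definition ratfun (F : fieldType) (n : nat) := {fraction {mpoly F[n]}}.
HB.instance Definition _ F n := GRing.Field.on (ratfun F n).

Section RationalFunctions.
Variables (F : fieldType) (n : nat).
Local Notation K := (ratfun F n).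

Definition frac (f : {mpoly F[n]}) : K := FracField.tofrac f.
HB.instance Definition _ := GRing.RMorphism.copy frac (@FracField.tofrac {mpoly F[n]}).

Definition rscale (c : F) (x : K) : K := frac c%:MP * x.
Lemma rscaleA a b x : rscale a (rscale b x) = rscale (a * b) x.
Proof. by rewrite /rscale mulrA -rmorphM -mpolyCM. Qed.
Lemma rscale1 : left_id 1 rscale.
Proof. by move=> x; rewrite /rscale mpolyC1 rmorph1 mul1r. Qed.
Lemma rscaleDr : right_distributive rscale +%R.
Proof. by move=> a x y; rewrite /rscale mulrDr. Qed.
Lemma rscaleDl x : {morph rscale^~ x : a b / a + b}.
Proof. by move=> a b; rewrite /rscale mpolyCD rmorphD mulrDl. Qed.
HB.instance Definition _ :=
  GRing.Zmodule_isLmodule.Build F K rscaleA rscale1 rscaleDr rscaleDl.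

Definition psum (I : {set 'I_n}) : K := frac (\sum_(i in I) 'X_i).

Fixpoint coef (T : monomial nzop 'I_n) : K :=
  match T with
  | MVar _ => 1
  | MOp Prec U V => psum [set a in leaves V] * coef U * coef V
  | MOp Succ U V => coef U * coef V / psum [set a in leaves U]
  end.

End RationalFunctions.

(* coefmap B is a linear map on the free algebra with T |-> coef T for every
   multilinear monomial T on B, so it is determined on NZ(B); off NZ(B) its
   values are irrelevant.  In characteristic zero such a map exists, see
   coefmapE. *)

Section CoefficientMap.
Variables (F : fieldType) (n : nat).
Local Notation K := (ratfun F n).

Definition monNZ (T : monomial nzop 'I_n) : freeNZ F 'I_n :=
  meval (@nz F 'I_n) (@fvar _ _ _ _) T.
Definition monNov (T : monomial unit 'I_n) : freeNov F 'I_n :=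
  meval (@nov F 'I_n) (@fvar _ _ _ _) T.

Definition coefmap_spec (B : {set 'I_n}) (f : {linear freeNZ F 'I_n -> K}) :=
  forall T, multilinear_on B T -> f (monNZ T) = coef F T.

Definition coefmap (B : {set 'I_n}) : {linear freeNZ F 'I_n -> K} :=
  if pselect (exists f, coefmap_spec B f) is left e then projT1 (cid e)
  else \0.

End CoefficientMap.

Section DifferentialModel.
Variables (F : fieldType) (A : comAlgType F) (P D J : A -> A).
Hypothesis linP : linear P.
Hypothesis linD : linear D.
Hypothesis linJ : linear J.
Hypothesis D_mul : forall f g, D (f * g) = D f * g + f * D g.
Hypothesis DP : forall f, D (P f) = D f.
Hypothesis DJ : forall f, D (J f) = P f.
Hypothesis JD : forall f, J (D f) = P f.
Hypothesis P_mulP : forall f g, P (P f * g) = P f * g.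
Hypothesis P_mulJ : forall f g, P (J f * g) = J f * g.

Definition diffop (o : nzop) : A -> A -> A :=
  match o with
  | Prec => fun f g => P f * D g
  | Succ => fun f g => J f * P g
  end.

Lemma diffop_is_algebra : is_algebra (@NZTheory F) diffop.
Proof.
split=> [[]|].
- by split=> f a g h; rewrite /diffop ?(linP, linD) ?mulrDr ?mulrDl -?scalerAl -?scalerAr.
- by split=> f a g h; rewrite /diffop ?(linP, linJ) ?mulrDr ?mulrDl -?scalerAl -?scalerAr.
have JDd x y : J (x + y) = J x + J y by rewrite -[x]scale1r linJ !scale1r.
have e1 x y : J (J x * P y) + J (J y * P x) = J x * J y.
  by rewrite -JDd -[RHS]P_mulJ -[RHS]JD D_mul !DJ addrC [J y * _]mulrC.
have e2 x y : J (P x * D y) + J (P y * D x) = P x * P y.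
  by rewrite -JDd -[RHS]P_mulP -[RHS]JD D_mul !DP addrC [P y * _]mulrC.
split=> x y z; rewrite /diffop.
- by rewrite -mulrDl e1 P_mulJ mulrA.
- rewrite !P_mulP !D_mul !DP; split; first by rewrite mulrAC.
  rewrite !mulrDr !opprD !mulrA !addrA !subrr !add0r.
  by rewrite [P y * P x]mulrC.
- rewrite !P_mulP !P_mulJ -!mulrDl !e2 D_mul DJ DP; split.
  + by rewrite mulrA.
  + by rewrite mulrDr !mulrA [J y * _]mulrC.
  + by rewrite mulrAC.
Qed.

End DifferentialModel.

(* Existence of the coefficient map: x_a |-> X_a extends to K[X_1, ..., X_n]
   with x ≺ y = x * D y and x ≻ y = (J x) * y, up to constant terms, where
   D X^m = p_m X^m and J X^m = X^m / p_m. *)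

Section Model.
Variables (F : fieldType) (n : nat).
Hypothesis charF0 : [pchar F] =i pred0.
Local Notation K := (ratfun F n).

Definition model := {mpoly K[n]}.
HB.instance Definition _ := GRing.ComNzRing.on model.

Definition mscale (c : F) (f : model) : model := (frac c%:MP : K)%:MP * f.
Lemma mscaleA a b x : mscale a (mscale b x) = mscale (a * b) x.
Proof. by rewrite /mscale mulrA -!rmorphM. Qed.
Lemma mscale1 : left_id 1 mscale.
Proof. by move=> x; rewrite /mscale !rmorph1 mul1r. Qed.
Lemma mscaleDr : right_distributive mscale +%R.
Proof. by move=> a x y; rewrite /mscale mulrDr. Qed.
Lemma mscaleDl x : {morph mscale^~ x : a b / a + b}.
Proof. by move=> a b; rewrite /mscale !rmorphD mulrDl. Qed.
HB.instance Definition _ :=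
  GRing.Zmodule_isLmodule.Build F model mscaleA mscale1 mscaleDr mscaleDl.
Lemma mscaleAl (c : F) (f g : model) : c *: (f * g) = (c *: f) * g.
Proof. exact: mulrA. Qed.
HB.instance Definition _ := GRing.Lmodule_isLalgebra.Build F model mscaleAl.
HB.instance Definition _ := GRing.Lalgebra_isComAlgebra.Build F model.

Lemma mcoefZ (c : F) (f : model) m : (c *: f : model)@_m = c *: (f@_m : K).
Proof. exact: mcoeffCM. Qed.

Definition mdiag (w : 'X_{1..n} -> K) (f : model) : model :=
  \sum_(m <- msupp f) (w m * f@_m)%:MP * 'X_[m].

Lemma mdiagE w (f : model) m : (mdiag w f)@_m = w m * f@_m.
Proof.
rewrite /mdiag raddf_sum /=.
under eq_bigr do rewrite mcoeffCM mcoeffX.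
have [mf|mf] := boolP (m \in msupp f).
  rewrite (big_rem m) //= eqxx mulr1 big1_seq ?addr0 // => i /andP[_].
  by rewrite mem_rem_uniq ?msupp_uniq // inE => /andP[/negPf ->]; rewrite mulr0.
rewrite big1_seq => [|i /andP[_ fi]].
  by move: mf; rewrite mcoeff_msupp negbK => /eqP ->; rewrite mulr0.
by case: eqP fi mf => [-> ->|_]; rewrite ?mulr0.
Qed.

Lemma mdiag_linear w : linear (mdiag w).
Proof.
move=> c f g; apply/mpolyP => m.
by rewrite mcoeffD !mdiagE mcoeffD !mcoefZ !mdiagE mulrDr; congr (_ + _);
  rewrite /GRing.scale /= /rscale mulrCA.
Qed.

Lemma mdiagD w : {morph mdiag w : f g / f + g}.
Proof. by move=> f g; rewrite -[f]scale1r mdiag_linear !scale1r. Qed.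

Lemma mdiag_comp w w' f : mdiag w (mdiag w' f) = mdiag (fun m => w m * w' m) f.
Proof. by apply/mpolyP => m; rewrite !mdiagE mulrA. Qed.

Lemma mdiagX w m : mdiag w 'X_[m] = (w m)%:MP * 'X_[m].
Proof.
by apply/mpolyP => k; rewrite mdiagE mcoeffCM mcoeffX; case: eqP => [->|]; rewrite ?mulr0.
Qed.

Definition pdeg (m : 'X_{1..n}) : K := frac (\sum_i (m i)%:R *: 'X_i).

Lemma pdegD m k : pdeg (m + k) = pdeg m + pdeg k.
Proof.
rewrite /pdeg -rmorphD -big_split /=; congr frac; apply: eq_bigr => i _.
by rewrite mnmDE natrD scalerDl.
Qed.

Lemma pdeg_eq0 m : (pdeg m == 0) = (m == 0%MM).
Proof.
rewrite /pdeg /frac tofrac_eq0; apply/eqP/eqP => [h|->]; last first.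
  by rewrite big1 // => i _; rewrite mnmE scale0r.
apply/mnmP => i; rewrite mnmE; have := congr1 (mcoeff U_(i)) h.
rewrite mcoeff0 raddf_sum /= (bigD1 i) //= big1 => [|j ji].
  rewrite mcoeffZ mcoeffXU eqxx mulr1 addr0 => /eqP.
  by rewrite (pcharf0P F).1 // => /eqP.
by rewrite mcoeffZ mcoeffXU (negPf ji) mulr0.
Qed.

Definition mD := mdiag pdeg.
Definition mJ := mdiag (fun m => (pdeg m)^-1).
Definition mP := mdiag (fun m => (m != 0%MM)%:R).

Lemma mD_mul (f g : model) : mD (f * g) = mD f * g + f * mD g.
Proof.
apply/mpolyP => m; rewrite mcoeffD mdiagE !mcoeffM mulr_sumr -big_split /=.
apply: eq_bigr => k /eqP mk; rewrite !mdiagE.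
have -> : pdeg m = pdeg k.1 + pdeg k.2 by rewrite -pdegD; congr pdeg.
by ring.
Qed.

Lemma mDP f : mD (mP f) = mD f.
Proof.
by apply/mpolyP => m; rewrite !mdiagE mulrA -pdeg_eq0;
  case: eqP => [->|]; rewrite ?mulr0 ?mul0r ?mulr1.
Qed.
Lemma mPD f : mP (mD f) = mD f.
Proof.
by apply/mpolyP => m; rewrite !mdiagE mulrA -pdeg_eq0;
  case: eqP => [->|]; rewrite ?mulr0 ?mul0r ?mul1r.
Qed.
Lemma mJP f : mJ (mP f) = mJ f.
Proof.
by apply/mpolyP => m; rewrite !mdiagE mulrA -pdeg_eq0;
  case: eqP => [->|]; rewrite ?invr0 ?mulr0 ?mul0r ?mulr1.
Qed.
Lemma mDJ f : mD (mJ f) = mP f.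
Proof.
by apply/mpolyP => m; rewrite !mdiagE mulrA -pdeg_eq0;
  case: eqP => [->|/eqP h]; rewrite ?invr0 ?mulr0 ?mul0r ?mulfV.
Qed.
Lemma mJD f : mJ (mD f) = mP f.
Proof.
by apply/mpolyP => m; rewrite !mdiagE mulrA -pdeg_eq0;
  case: eqP => [->|/eqP h]; rewrite ?invr0 ?mulr0 ?mul0r ?mulVf.
Qed.
Lemma mP_id f : f@_0%MM = 0 -> mP f = f.
Proof.
move=> f0; apply/mpolyP => m; rewrite mdiagE.
by case: eqP => [->|_]; rewrite ?f0 ?mulr0 ?mul1r.
Qed.
Lemma mP0 f : (mP f)@_0%MM = 0. Proof. by rewrite mdiagE eqxx mul0r. Qed.
Lemma mJ0 f : (mJ f)@_0%MM = 0. Proof. by rewrite -mJP mdiagE mP0 mulr0. Qed.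
Lemma mP_mul f g : f@_0%MM = 0 -> mP (f * g) = f * g.
Proof. by move=> f0; apply: mP_id; rewrite rmorphM /= f0 mul0r. Qed.

Definition modop := diffop mP mD mJ.

Lemma modop_is_algebra : is_algebra (@NZTheory F) modop.
Proof.
apply: diffop_is_algebra; try exact: mdiag_linear.
- exact: mD_mul.
- exact: mDP.
- exact: mDJ.
- exact: mJD.
- by move=> f g; rewrite mP_mul ?mP0.
- by move=> f g; rewrite mP_mul ?mJ0.
Qed.

Definition modvar (a : 'I_n) : model := 'X_a.

Lemma mdiagCX w c m :
  mdiag w (c%:MP * 'X_[m]) = (w m * c)%:MP * 'X_[m] :> {mpoly K[n]}.
Proof.
apply/mpolyP => k; rewrite mdiagE !mcoeffCM mcoeffX.
by case: eqP => [->|_]; rewrite ?mulr0 ?mulr1.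
Qed.

Lemma mset_count (s : seq 'I_n) i :
  (\sum_(a <- s) U_(a))%MM i = count_mem i s.
Proof.
rewrite mnm_sumE; elim: s => [|a s IHs]; rewrite ?big_nil // big_cons IHs /=.
by rewrite mnm1E.
Qed.

Lemma pdeg_uniq (s : seq 'I_n) : uniq s ->
  pdeg (\sum_(a <- s) U_(a))%MM = psum F [set a in s].
Proof.
move=> us; rewrite /pdeg /psum [in RHS]big_mkcond /=; congr frac.
apply: eq_bigr => i _; rewrite mset_count count_uniq_mem // inE.
by case: (i \in s); rewrite ?scale1r ?scale0r.
Qed.

Lemma mset_leaves_neq0 (T : monomial nzop 'I_n) :
  ((\sum_(a <- leaves T) U_(a))%MM == 0%MM) = false.
Proof.
have [a aT] : exists a, a \in leaves T.
  elim: T => [a|o U [a aU] V _] /=; first by exists a; rewrite inE.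
  by exists a; rewrite mem_cat aU.
apply/eqP => /(congr1 (fun m : 'X_{1..n} => m a)).
rewrite mset_count mnm0E => /eqP; rewrite -leqn0 leqNgt.
by rewrite -has_count has_pred1 aT.
Qed.

Lemma model_monomial (T : monomial nzop 'I_n) : uniq (leaves T) ->
  meval modop modvar T =
    (coef F T)%:MP * 'X_[\sum_(a <- leaves T) U_(a)] :> {mpoly K[n]}.
Proof.
elim: T => [a _|o U IHU V IHV]; first by rewrite /= big_seq1 mpolyC1 mul1r.
rewrite [leaves _]/= cat_uniq => /and3P[uU _ uV]; rewrite big_cat /= mpolyXD.
rewrite {}IHU // {}IHV //; case: o; rewrite /modop /diffop.
  rewrite /mP /mD !mdiagCX mset_leaves_neq0 mul1r pdeg_uniq //.
  by rewrite mulrACA -mpolyCM [coef F U * (_ * _)]mulrCA [psum _ _ * (_ * _)]mulrA.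
rewrite /mP /mJ !mdiagCX mset_leaves_neq0 mul1r pdeg_uniq //.
by rewrite mulrACA -mpolyCM -[_^-1 * _ * _]mulrA [_^-1 * _]mulrC.
Qed.

Lemma feval_monNZ (A : lmodType F) op (v : 'I_n -> A) T :
  is_algebra (@NZTheory F) op -> feval op v (monNZ F T) = meval op v T.
Proof.
move=> hA; elim: T => [a|o U IHU V IHV] /=; first exact: feval_var.
by rewrite -IHU -IHV; exact: feval_op.
Qed.

Lemma coefmap_exists (B : {set 'I_n}) :
  exists f : {linear freeNZ F 'I_n -> K}, coefmap_spec B f.
Proof.
pose f (x : freeNZ F 'I_n) : K :=
  (feval modop modvar x)@_(\sum_(a <- enum B) U_(a))%MM.
have lf : linear f.
  move=> c x y; rewrite /f (feval_linear _ modop_is_algebra).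
  by rewrite mcoeffD mcoefZ.
pose L : {linear freeNZ F 'I_n -> K} :=
  HB.pack f (GRing.isLinear.Build F (freeNZ F 'I_n) K *:%R f lf).
exists L => T BT; rewrite /L /= /f (feval_monNZ _ _ modop_is_algebra).
rewrite model_monomial ?(perm_uniq BT) ?enum_uniq //.
by rewrite mcoeffCM mcoeffX (perm_big _ BT) eqxx mulr1.
Qed.

Lemma coefmapE (B : {set 'I_n}) (T : monomial nzop 'I_n) :
  multilinear_on B T -> coefmap F B (monNZ F T) = coef F T.
Proof.
rewrite /coefmap; case: pselect => [e|/(_ (coefmap_exists B)) //].
exact: projT2 (cid e) T.
Qed.

End Model.

Section Components.
Variables (F : fieldType) (n k : nat).
Implicit Types (B C : {set 'I_n}) (m : 'X_{1..n}).

Definition NZcomp : set (freeNZ F 'I_n) :=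
  lspan (fun x => exists T, [/\ multilinear_on [set: 'I_n] T, nprec T = k
                              & x = monNZ F T]).

Definition Rcomp : set (ratfun F n) :=
  lspan (fun r => exists T, [/\ multilinear_on [set: 'I_n] T, nprec T = k
                              & r = coef F T]).

Definition NovMultilinear C : set (freeNov F 'I_n) :=
  lspan (fun x => exists2 T, multilinear_on C T & x = monNov F T).

End Components.
Arguments NZcomp F n k : clear implicits.
Arguments Rcomp F n k : clear implicits.

Section Blocks.
Variables (F : fieldType) (n : nat).
Implicit Types (B C I : {set 'I_n}) (m : 'X_{1..n}).

Definition mon_in B m := forall a, m a != 0%N -> a \in B.

(* M = X^m is a monomial in the p_a, a in B, whose degree d satisfies
   d <= |B| - 1 and d = |B| - 1 mod 2. *)
Definition block_mon B m :=
  [/\ mon_in B m, (mdeg m <= #|B| - 1)%N & odd (mdeg m) = odd (#|B| - 1)].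

(* A choice, for every block and monomial, of the set C and of an enumeration
   of its complement in the block. *)
Definition block_choice := {set 'I_n} -> 'X_{1..n} -> {set 'I_n} * seq 'I_n.

Definition admissible (ch : block_choice) := forall B m,
  B != finset.set0 -> block_mon B m ->
  [/\ (ch B m).1 \subset B, #|(ch B m).1| = (mdeg m).+1, mon_in (ch B m).1 m
    & perm_eq (ch B m).2 (enum (B :\: (ch B m).1))].

Lemma subset_between (S B : {set 'I_n}) d :
  S \subset B -> (#|S| <= d <= #|B|)%N ->
  exists C : {set 'I_n}, [/\ S \subset C, C \subset B & #|C| = d].
Proof.
move=> SB; elim: d => [|d IHd] /andP[Sd dB].
  by exists S; split=> //; apply/eqP; rewrite -leqn0.
move: Sd; rewrite leq_eqVlt => /orP[/eqP Sd|Sd]; first by exists S.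
have [|C [SC CB Cd]] := IHd; first by rewrite -ltnS Sd ltnW.
have /set0Pn[a] : B :\: C != finset.set0.
  by rewrite -card_gt0 cardsDS // subn_gt0 Cd.
rewrite inE => /andP[aC aB]; exists (a |: C); split.
- exact: fintype.subset_trans SC (finset.subsetUr _ _).
- by rewrite finset.subUset finset.sub1set aB.
- by rewrite cardsU1 aC Cd.
Qed.

Lemma admissible_exists : exists ch : block_choice, admissible ch.
Proof.
pose P B m (Cs : {set 'I_n} * seq 'I_n) :=
  [/\ Cs.1 \subset B, #|Cs.1| = (mdeg m).+1, mon_in Cs.1 m
    & perm_eq Cs.2 (enum (B :\: Cs.1))].
suff h B m : exists Cs, B != finset.set0 -> block_mon B m -> P B m Cs.
  by exists (fun B m => projT1 (cid (h B m))) => B m; exact: (projT2 (cid (h B m))).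
have [B0|B0] := eqVneq B finset.set0; first by exists (B, [::]).
have [[mB dB _]|nb] := pselect (block_mon B m); last by exists (B, [::]).
pose S := [set a | m a != 0%N].
have SB : S \subset B by apply/fintype.subsetP => a; rewrite inE; exact: mB.
have cS : (#|S| <= mdeg m)%N.
  rewrite mdegE -sum1_card big_mkcond /=; apply: leq_sum => a _.
  by rewrite inE; case: (m a).
have dB1 : (mdeg m < #|B|)%N.
  by move: B0 dB; rewrite -card_gt0 subn1; case: #|B|.
have [|C [SC CB Cd]] := subset_between (d := (mdeg m).+1) SB.
  by rewrite dB1 leqW.
exists (C, enum (B :\: C)) => _ _; split=> //= a ma.
by apply: (fintype.subsetP SC); rewrite inE.
Qed.

(* P_C(M), the unique element of the multilinear component on C of the free
   Novikov algebra with coefficient M = X^m, viewed in the free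
   Novikov-Zinbiel algebra.  The coefficient rules for Novikov monomials are
   those for the corresponding monomials in ≺. *)
Definition PC C m : freeNZ F 'I_n :=
  nov_to_nz (xget 0 (fun P : freeNov F 'I_n =>
    NovMultilinear C P /\ coefmap F C (nov_to_nz P) = frac 'X_[m])).

Definition mu (x y z : freeNZ F 'I_n) : freeNZ F 'I_n :=
  nz Succ (nz Prec x y + nz Prec y x) z.

(* Pi x [:: y_1; ...; y_2h] is Π(x, y_1, ..., y_2h). *)
Fixpoint Pi (x : freeNZ F 'I_n) (s : seq (freeNZ F 'I_n)) :=
  match s with
  | y :: z :: s' => Pi (mu x y z) s'
  | _ => x
  end.

Definition beta (ch : block_choice) B m : freeNZ F 'I_n :=
  Pi (PC (ch B m).1 m) [seq fvar _ a | a <- (ch B m).2].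

Definition bracket (s : seq (freeNZ F 'I_n)) : freeNZ F 'I_n :=
  if s is x :: s' then foldl (nz Succ) x s' else 0.

(* Data of an element of B_(n,k): the sets I_1, ..., I_j and the exponents of
   M_1, ..., M_(j+1). *)
Definition chain_data := (seq {set 'I_n} * seq 'X_{1..n})%type.

Definition blocks (I : seq {set 'I_n}) : seq {set 'I_n} :=
  pairmap (fun A A' => A' :\: A) finset.set0 (rcons I [set: 'I_n]).

(* B without its largest element. *)
Definition drop_max B := [set a in B | [exists b in B, (a < b)%N]].

(* The equation for the degrees reads sum_s d_s = 2k + j - n + 1. *)
Definition is_chain_data (k : nat) (d : chain_data) :=
  let: (Is, Ms) := d in
  [/\ path (fun A A' : {set 'I_n} => A \proper A') finset.set0
        (rcons Is [set: 'I_n]),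
      size Ms = (size Is).+1,
      forall s, (s <= size Is)%N ->
        let B := nth finset.set0 (blocks Is) s in
        let m := nth 0%MM Ms s in
        block_mon B m /\ ((s < size Is)%N -> mon_in (drop_max B) m)
    & (\sum_(m <- Ms) mdeg m + n = 2 * k + size Is + 1)%N].

Definition chain_fun (d : chain_data) : ratfun F n :=
  (\prod_(m <- d.2) frac 'X_[m]) / \prod_(I <- d.1) psum F I.

Definition Bset (k : nat) : set (ratfun F n) :=
  fun b => exists2 d, is_chain_data k d & b = chain_fun d.

Definition chain_elt (ch : block_choice) (d : chain_data) : freeNZ F 'I_n :=
  bracket [seq beta ch Bm.1 Bm.2 | Bm <- zip (blocks d.1) d.2].

(* b determines its data, so the choice of d is immaterial. *)
Definition tilde (ch : block_choice) (k : nat) (b : ratfun F n) :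
    freeNZ F 'I_n :=
  chain_elt ch (xget ([::], [::]) (fun d => is_chain_data k d /\ b = chain_fun d)).

End Blocks.
Arguments Bset F n k : clear implicits.

(* Main.v *)
Require Import Defs.
From HB Require Import structures.
From mathcomp Require Import all_boot all_order all_algebra.
From mathcomp Require Import mpoly.
From mathcomp Require Import zify.
From mathcomp Require Import boolp classical_sets functions.

Set Implicit Arguments.
Unset Strict Implicit.
Unset Printing Implicit Defensive.
Import GRing.Theory.
Local Open Scope ring_scope.

(** Realize a Novikov-Zinbiel algebra in a commutative algebra with an
    invertible derivation D, with J inverse to D: x ≺ y is x D y and x ≻ y is
    (J x) y. The triple product (x ≺ y + y ≺ x) ≻ z is then x y z, so that the
    blocks beta_B(M) are the differential monomials, that is the products of
    derivatives of distinct variables, of weight (number of derivatives minus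
    number of letters) odd and negative. Chains of blocks are iterated
    integrals of such monomials, and the theorem says that these form a basis
    once, by integration by parts, every block but the last avoids its largest
    variable.

    The proof exhibits a spanning family of chains whose coefficients are
    independent. This makes the coefficient map injective, and then the
    elements attached to chain data are that family, having the same
    coefficients.

    For the span, the difficulty is that in the free algebra one must
    construct the product of letters with prescribed derivatives, and show
    that it is independent of the way in which it is built. A letter e is
    adjoined. The product is written with all its undifferentiated letters
    equal to e, where no choice is left: it is built from the elements e^s
    z^(s), defined by the recursion D(e^s z^(s)) = e^s z^(s+1) + s e^(s-1) e'
    z^(s), which makes sense as an identity between multiplication operators
    (mulop, dmul, homog_dmul). Then the factors e are replaced by the
    undifferentiated letters through the derivations e |-> x_c of the free
    algebra, and the result is divided by the factorial of their number, which
    requires characteristic zero. These products (diff_mon) obey the Leibniz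
    rule for the multiplication by one more letter (diff_mon_precl), and
    letters generate them (diff_mon_ind). Multiplications by general elements
    are compositions of multiplications by letters, so that the span of the
    differential monomials is closed under ≺ and under triple products
    (diff_span_prec, diff_span_mu). The defining identities then reduce all
    products of chains to chains, (c ≻ D w) ≻ b = c ≻ (w b) - (w c) ≻ b
    removing the largest variable from all blocks but the last (snoc_chain).

    For the independence (cleared_indep), the first set I of the chains in a
    relation is taken as small as possible: then only the chains that begin
    with I have a pole along the hyperplane where the variables of I sum to
    zero. The residue is the product of the first monomial, which survives
    since it avoids the largest variable of I, and of the function of the rest
    of the chain on the complement of I, to which induction applies. *)

(** * Novikov-Zinbiel algebras as differential algebras *)

Section Bilinear.
Variables (F : fieldType) (A : lmodType F) (f : A -> A -> A).
Hypothesis hf : bilinear_op f.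

Lemma bilDl x y z : f (x + y) z = f x z + f y z.
Proof. by have := hf.2 z 1 x y; rewrite !scale1r. Qed.
Lemma bilDr x y z : f z (x + y) = f z x + f z y.
Proof. by have := hf.1 z 1 x y; rewrite !scale1r. Qed.
Lemma bil0l z : f 0 z = 0.
Proof. by apply: (addIr (f 0 z)); rewrite -bilDl !add0r. Qed.
Lemma bil0r z : f z 0 = 0.
Proof. by apply: (addIr (f z 0)); rewrite -bilDr !add0r. Qed.
Lemma bilZl a x z : f (a *: x) z = a *: f x z.
Proof. by have := hf.2 z a x 0; rewrite bil0l !addr0. Qed.
Lemma bilZr a x z : f z (a *: x) = a *: f z x.
Proof. by have := hf.1 z a x 0; rewrite bil0r !addr0. Qed.
Lemma bilNl x z : f (- x) z = - f x z.
Proof. by rewrite -scaleN1r bilZl scaleN1r. Qed.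
Lemma bilNr x z : f z (- x) = - f z x.
Proof. by rewrite -scaleN1r bilZr scaleN1r. Qed.
End Bilinear.

Section Multipliers.
Variables (F : fieldType) (A : lmodType F) (op : nzop -> A -> A -> A).
Hypothesis hA : is_algebra (@NZTheory F) op.
Local Notation "x ≺ y" := (op Prec x y) (at level 40, no associativity).
Local Notation "x ≻ y" := (op Succ x y) (at level 40, no associativity).

Let hP := hA.1 Prec.
Let hS := hA.1 Succ.

Lemma nz_succCA x y z : x ≻ (y ≻ z) = y ≻ (x ≻ z).
Proof. by case: hA.2 => hz _ _; rewrite !hz addrC. Qed.
Lemma nz_precAC x y z : (x ≺ y) ≺ z = (x ≺ z) ≺ y.
Proof. by case: hA.2 => _ hn _; case: (hn x y z). Qed.
Lemma nz_left_sym x y z :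
  x ≺ (y ≺ z) - (x ≺ y) ≺ z = y ≺ (x ≺ z) - (y ≺ x) ≺ z.
Proof.
case: hA.2 => _ hn _; case: (hn x y z) => _ e.
by apply: oppr_inj; rewrite !opprB.
Qed.
Lemma nz_succ_prec x y z : (x ≻ y) ≺ z = x ≻ (y ≺ z).
Proof. by case: hA.2 => _ _ hc; case: (hc x y z). Qed.

(** In a differential algebra, where x ≺ y is x D y and x ≻ y is (J x) y with
    D J = 1, this is the product x y z, whence the symmetries below. *)
Definition tri x y z := (x ≺ y + y ≺ x) ≻ z.

Lemma triC x y z : tri x y z = tri y x z.
Proof. by rewrite /tri addrC. Qed.
Lemma triAC x y z : tri x y z = tri x z y.
Proof.
by case: hA.2 => _ _ hc; case: (hc x y z) => _ _; rewrite -!(bilDl hS).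
Qed.
Lemma triCA x y z : tri x y z = tri z y x.
Proof. by rewrite triC triAC triC. Qed.
Lemma nz_prec_succ x y z : x ≺ (y ≻ z) = tri x y z + y ≻ (x ≺ z).
Proof.
case: hA.2 => _ _ hc; case: (hc x y z) => _ -> _.
by rewrite nz_succ_prec /tri (bilDl hS).
Qed.
Lemma tri_prec x y z w : tri x y z ≺ w = tri x y (z ≺ w).
Proof. exact: nz_succ_prec. Qed.
Lemma tri_succ x y z w : tri x y (w ≻ z) = w ≻ tri x y z.
Proof. exact: nz_succCA. Qed.
Lemma triDl x x' y z : tri (x + x') y z = tri x y z + tri x' y z.
Proof.
rewrite /tri (bilDl hP) (bilDr hP) addrACA; exact: bilDl hS _ _ _.
Qed.
Lemma triDm x y y' z : tri x (y + y') z = tri x y z + tri x y' z.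
Proof. by rewrite triC triDl !(triC x). Qed.
Lemma triZr a x y z : tri x y (a *: z) = a *: tri x y z.
Proof. exact: bilZr hS _ _ _. Qed.
Lemma triZl a x y z : tri (a *: x) y z = a *: tri x y z.
Proof. by rewrite triCA triZr triCA. Qed.
Lemma triZm a x y z : tri x (a *: y) z = a *: tri x y z.
Proof. by rewrite triC triZl triC. Qed.
Lemma tri0r x y : tri x y 0 = 0. Proof. exact: bil0r hS _. Qed.
(** Both sides are the product of the five elements. *)
Lemma tri_assoc a b c d e : tri a (tri b c d) e = tri b c (tri a d e).
Proof. by rewrite triAC tri_succ triAC. Qed.
(** Leibniz rule for v D(a b u). *)
Lemma prec_tri v a b u :
  v ≺ tri a b u = tri a b (v ≺ u) + tri a u v ≺ b + tri b u v ≺ a.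
Proof.
rewrite {1}/tri nz_prec_succ -[_ ≻ (v ≺ u)]/(tri a b (v ≺ u)) addrC -addrA.
congr (_ + _); rewrite triDm [tri v (a ≺ b) u]triAC [tri v (b ≺ a) u]triAC.
by rewrite -!tri_prec -![tri v u _](triCA _ u).
Qed.

(** Operators that multiply by a fixed function when A is realized in a
    differential algebra: x ≺ z multiplies x by the derivative of z, and z ≻ x
    multiplies x by the integral of z. They stand for functions, such as
    derivatives, that are not elements of A. *)
Inductive mulop : (A -> A) -> Prop :=
| mulop_id : mulop id
| mulop_R z : mulop (fun x => x ≺ z)
| mulop_I z : mulop (op Succ z)
| mulop_comp f g : mulop f -> mulop g -> mulop (f \o g)
| mulop_lin a f g : mulop f -> mulop g -> mulop (fun x => a *: f x + g x).

Lemma mulop_linear f : mulop f -> linear f.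
Proof.
elim=> [//|z|z|{}f g _ lf _ lg|c {}f g _ lf _ lg] a x y.
- exact: hP.2.
- exact: hS.1.
- by rewrite /= lg lf.
- rewrite lf lg !scalerDr !scalerA (mulrC c) -!addrA; congr (_ + _).
  by rewrite addrCA.
Qed.

Lemma mulopD f x y : mulop f -> f (x + y) = f x + f y.
Proof. by move=> /mulop_linear lf; rewrite -[x]scale1r lf !scale1r. Qed.
Lemma mulop0 f : mulop f -> f 0 = 0.
Proof. by move=> mf; apply: (addIr (f 0)); rewrite -(mulopD _ _ mf) !add0r. Qed.
Lemma mulopZ f a x : mulop f -> f (a *: x) = a *: f x.
Proof.
by move=> mf; have := mulop_linear mf a x 0; rewrite (mulop0 mf) !addr0.
Qed.
Lemma mulopB f x y : mulop f -> f (x - y) = f x - f y.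
Proof. by move=> mf; rewrite mulopD // -scaleN1r mulopZ // scaleN1r. Qed.

Lemma mulop_R_comm f x z : mulop f -> f (x ≺ z) = f x ≺ z.
Proof.
move=> mf; elim: mf x => [//|y|y|{}f g _ lf _ lg|c {}f g _ lf _ lg] x.
- exact: nz_precAC.
- by rewrite nz_succ_prec.
- by rewrite /= lg lf.
- by rewrite lf lg (bilDl hP) (bilZl hP).
Qed.

Lemma mulop_I_comm f x z : mulop f -> f (z ≻ x) = z ≻ f x.
Proof.
move=> mf; elim: mf x => [//|y|y|{}f g _ lf _ lg|c {}f g _ lf _ lg] x.
- exact: nz_succ_prec.
- exact: nz_succCA.
- by rewrite /= lg lf.
- by rewrite lf lg (bilDr hS) (bilZr hS).
Qed.

Lemma mulop_comm f g x : mulop f -> mulop g -> f (g x) = g (f x).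
Proof.
move=> mf mg; elim: mg x => [//|y|y|{}g h _ lf _ lg|c {}g h _ lf _ lg] x.
- exact: mulop_R_comm.
- exact: mulop_I_comm.
- by rewrite /= lf lg.
- by rewrite (mulopD _ _ mf) (mulopZ _ _ mf) lf lg.
Qed.

Lemma mulop_ext f g : mulop f -> f =1 g -> mulop g.
Proof. by move=> mf /funext <-. Qed.

Lemma mulop_sub f g : mulop f -> mulop g -> mulop (fun x => f x - g x).
Proof.
move=> mf mg; apply: mulop_ext (mulop_lin (-1) mg mf) _ => x /=.
by rewrite scaleN1r addrC.
Qed.

Lemma mulop_add f g : mulop f -> mulop g -> mulop (fun x => f x + g x).
Proof.
by move=> mf mg; apply: mulop_ext (mulop_lin 1 mf mg) _ => x /=; rewrite scale1r.
Qed.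

Lemma mulop_scale a f : mulop f -> mulop (fun x => a *: f x).
Proof.
move=> mf; apply: mulop_ext (mulop_lin a mf (mulop_sub mf mf)) _ => x /=.
by rewrite subrr addr0.
Qed.

(** Since x ≺ _ is the derivation x D, its commutator with the
    multiplication by f is the multiplication by x f'. *)
Lemma mulop_delta f x : mulop f -> mulop (fun w => x ≺ f w - f (x ≺ w)).
Proof.
elim=> [|z|z|{}f g mf df mg dg|c {}f g mf df mg dg].
- by apply: mulop_ext (mulop_sub mulop_id mulop_id) _ => w /=; rewrite !subrr.
- apply: mulop_ext (mulop_sub (mulop_R (x ≺ z))
    (mulop_comp (mulop_R z) (mulop_R x))) _ => w /=.
  by rewrite nz_left_sym.
- apply: mulop_ext (mulop_I (x ≺ z + z ≺ x)) _ => w /=.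
  by rewrite nz_prec_succ addrK.
- apply: mulop_ext (mulop_add (mulop_comp df mg) (mulop_comp mf dg)) _ => w /=.
  by rewrite (mulopB _ _ mf) addrA subrK.
- apply: mulop_ext (mulop_lin c df dg) _ => w /=.
  by rewrite (bilDr hP) (bilZr hP) scalerBr opprD addrACA.
Qed.

(** Both sides are x f' y. *)
Lemma mulop_delta_sym f x y :
  mulop f -> x ≺ f y - f (x ≺ y) = y ≺ f x - f (y ≺ x).
Proof.
move=> mf.
elim: mf x y => [x y|z x y|z x y|{}f g mf df mg dg x y|c {}f g mf df mg dg x y].
- by rewrite !subrr.
- exact: nz_left_sym.
- by rewrite !nz_prec_succ !addrK triCA triC triCA triC; rewrite triCA triC triAC.
- have e : x ≺ f (g y) - f (x ≺ g y) = y ≺ f (g x) - f (y ≺ g x).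
    rewrite df -(mulop_R_comm _ _ mg) (mulop_R_comm _ _ mg).
    have := mulop_comm x mg (mulop_delta y mf).
    rewrite (mulopB _ _ mg) (mulop_R_comm _ _ mg) => <-.
    rewrite -(mulop_R_comm _ _ mg) -(mulop_R_comm _ _ mg).
    by rewrite (mulop_comm _ mg mf).
  have := dg x y; have /= := e.
  move=> e1 e2; rewrite /= -[LHS](subrKA (f (x ≺ g y))) -[RHS](subrKA (f (y ≺ g x))).
  by rewrite e1 -!(mulopB _ _ mf) e2.
- rewrite !(bilDr hP) !(bilZr hP) !opprD ![_ + (- _ - _)]addrACA -!scalerBr.
  by rewrite df dg.
Qed.

Lemma mulop_tri x y : mulop (tri x y).
Proof. exact: mulop_I. Qed.

(** The commutator of d with a multiplication by f is the multiplication by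
    d f. *)
Lemma mulop_der (d : A -> A) f :
  linear d -> (forall o x y, d (op o x y) = op o (d x) y + op o x (d y)) ->
  mulop f -> mulop (fun w => d (f w) - f (d w)).
Proof.
move=> ld dop; have dD x y : d (x + y) = d x + d y.
  by rewrite -[x]scale1r ld !scale1r.
have d0 : d 0 = 0 by apply: (addIr (d 0)); rewrite -dD !add0r.
have dZ a x : d (a *: x) = a *: d x by have := ld a x 0; rewrite d0 !addr0.
elim=> [|z|z|{}f g mf df mg dg|c {}f g mf df mg dg].
- by apply: mulop_ext (mulop_sub mulop_id mulop_id) _ => w /=; rewrite !subrr.
- by apply: mulop_ext (mulop_R (d z)) _ => w /=; rewrite dop [RHS]addrC addKr.
- by apply: mulop_ext (mulop_I (d z)) _ => w /=; rewrite dop addrK.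
- apply: mulop_ext (mulop_add (mulop_comp df mg) (mulop_comp mf dg)) _ => w /=.
  by rewrite (mulopB _ _ mf) addrA subrK.
- apply: mulop_ext (mulop_lin c df dg) _ => w /=.
  by rewrite dD dZ scalerBr opprD addrACA.
Qed.

End Multipliers.

(** * Derivations of the free Novikov-Zinbiel algebra *)

Section DualNumbers.
Variables (F : fieldType) (A : lmodType F) (op : nzop -> A -> A -> A).
Hypothesis hA : is_algebra (@NZTheory F) op.
Local Notation "x ≺ y" := (op Prec x y) (at level 40, no associativity).
Local Notation "x ≻ y" := (op Succ x y) (at level 40, no associativity).

(** The operations of A extended to the dual numbers, a pair (x, x') being
    x + eps x'. *)
Definition dual_op (o : nzop) (u v : A * A) : A * A :=
  (op o u.1 v.1, op o u.1 v.2 + op o u.2 v.1).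

(** The identities are multilinear, so they survive any extension of scalars;
    the second components are their linearizations. *)
Lemma dual_is_algebra : is_algebra (@NZTheory F) dual_op.
Proof.
case: (hA) => hb [hz hn hc].
have hP := hb Prec; have hS := hb Succ.
have eD := (bilDl hP, bilDr hP, bilDl hS, bilDr hS).
split=> [o|].
  split=> [[x x']|[y y']] a [u u'] [v v']; congr pair => /=;
    rewrite ?(bilDl (hb o)) ?(bilDr (hb o)) ?(bilZl (hb o)) ?(bilZr (hb o)) //.
  - by rewrite scalerDr addrACA.
  - by rewrite scalerDr addrACA.
split=> [[x x'] [y y'] [z z']|[x x'] [y y'] [z z']|[x x'] [y y'] [z z']].
- congr pair => /=; first exact: hz.
  by rewrite !eD !hz; rewrite [LHS](AC ((2*2)*2) ((1*(3*5))*(2*(6*4)))).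
- split; congr pair => /=; try by case: (hn x y z).
  + rewrite !eD (nz_precAC hA x y z') (nz_precAC hA x y' z) (nz_precAC hA x' y z).
    by rewrite addrCA.
  + have := (hn x y z').2; have := (hn x y' z).2; have := (hn x' y z).2.
    rewrite !eD !opprD => e1 e2 e3.
    transitivity (((x ≺ y) ≺ z' - x ≺ (y ≺ z')) +
      (((x ≺ y') ≺ z - x ≺ (y' ≺ z)) + ((x' ≺ y) ≺ z - x' ≺ (y ≺ z)))).
      by rewrite [LHS](AC ((1*2)*(2*1)) ((1*4)*((2*5)*(3*6)))).
    by rewrite e1 e2 e3 [RHS](AC ((1*2)*(2*1)) ((1*4)*((3*6)*(2*5)))).
- split; congr pair => /=; try by case: (hc x y z).
  + by rewrite !eD !(nz_succ_prec hA) addrA.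
  + have := hc x y z'; have := hc x y' z; have := hc x' y z.
    move=> [_ e1 _] [_ e2 _] [_ e3 _].
    by rewrite !eD e1 e2 e3
      [LHS](AC (3*3*3) ((1*(4*7))*(2*(8*5))*(3*(9*6)))).
  + have := hc x y z'; have := hc x y' z; have := hc x' y z.
    move=> [_ _ e1] [_ _ e2] [_ _ e3].
    rewrite !eD.
    transitivity (((x ≺ y) ≻ z' + (y ≺ x) ≻ z') +
      (((x ≺ y') ≻ z + (y' ≺ x) ≻ z) + ((x' ≺ y) ≻ z + (y ≺ x') ≻ z))).
      by rewrite [LHS](AC ((1*2)*(1*2)) ((1*4)*((2*6)*(3*5)))).
    by rewrite e1 e2 e3 [LHS](AC (2*(2*2)) ((3*(1*5))*(4*(6*2)))).
Qed.

End DualNumbers.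

Section FreeDerivations.
Variables (F : fieldType) (X : Type).
Local Notation free := (freeNZ F X).
Local Notation op := (@nz F X).
Let hA := freeNZ_is_algebra F X.

(** The infinitesimal part of the substitution x |-> x + eps v(x): the
    derivation with prescribed values on the variables. *)
Definition free_der (v : X -> free) (x : free) : free :=
  (feval (dual_op op) (fun a => (fvar _ a, v a) : (free * free)%type) x).2.

Lemma free_der_linear v : linear (free_der v).
Proof. by move=> a x y; rewrite /free_der (feval_linear _ (dual_is_algebra hA)). Qed.

Lemma free_der_var v a : free_der v (fvar _ a) = v a.
Proof. by rewrite /free_der (feval_var _ (dual_is_algebra hA)). Qed.

Lemma free_der_base v x :
  (feval (dual_op op) (fun a => (fvar _ a, v a) : (free * free)%type) x).1 = x.
Proof.
have h := dual_is_algebra hA.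
set g := feval _ _.
transitivity (feval op (@fvar F nzop X _) x).
  apply: (feval_unique hA (f := fun x => (g x).1)) => [a y z|o y z|a].
  - by rewrite /g (feval_linear _ h).
  - by rewrite /g (feval_op _ h).
  - by rewrite /g (feval_var _ h).
by symmetry; apply: (feval_unique hA (f := id)).
Qed.

Lemma free_der_op v o x y :
  free_der v (op o x y) = op o (free_der v x) y + op o x (free_der v y).
Proof.
rewrite /free_der (feval_op _ (dual_is_algebra hA)) /= !free_der_base.
by rewrite addrC.
Qed.

Lemma free_ind (P : free -> Prop) :
  (forall a, P (fvar _ a)) -> P 0 -> (forall x y, P x -> P y -> P (x + y)) ->
  (forall a x, P x -> P (a *: x)) -> (forall o x y, P x -> P y -> P (op o x y)) ->
  forall x, P x.
Proof.
move=> Pv P0 PD PZ Po; elim/quotW=> t.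
elim: t => [a||s IHs t IHt|a t IHt|o s IHs t IHt].
- exact: Pv.
- exact: P0.
- by rewrite -fpiD; exact: PD.
- by rewrite -fpiZ; exact: PZ.
- by rewrite -fop_pi; exact: Po.
Qed.

Lemma free_derD v x y : free_der v (x + y) = free_der v x + free_der v y.
Proof. by rewrite -[x]scale1r free_der_linear !scale1r. Qed.
Lemma free_der0 v : free_der v 0 = 0.
Proof. by apply: (addIr (free_der v 0)); rewrite -free_derD !add0r. Qed.
Lemma free_derZ v a x : free_der v (a *: x) = a *: free_der v x.
Proof. by have := free_der_linear v a x 0; rewrite free_der0 !addr0. Qed.
Lemma free_derB v x y : free_der v (x - y) = free_der v x - free_der v y.
Proof. by rewrite free_derD -scaleN1r free_derZ scaleN1r. Qed.

(** The commutator of two derivations is a derivation, so it vanishes as soon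
    as it kills the variables. *)
Lemma free_der_comm v w x :
  (forall a, free_der v (w a) = free_der w (v a)) ->
  free_der v (free_der w x) = free_der w (free_der v x).
Proof.
move=> h; elim/free_ind: x => [a||x y IHx IHy|a x IHx|o x y IHx IHy].
- by rewrite !free_der_var.
- by rewrite !free_der0.
- by rewrite !free_derD IHx IHy.
- by rewrite !free_derZ IHx.
- rewrite !free_der_op !free_derD !free_der_op IHx IHy.
  by rewrite [LHS](AC (2*2) ((1*3)*(2*4))).
Qed.

End FreeDerivations.

(** * Polarized differential monomials *)

Section Polarization.
Variables (F : fieldType) (n : nat).
Hypothesis charF0 : [pchar F] =i pred0.
Local Notation AA := (freeNZ F (option 'I_n)).
Local Notation op := (@nz F (option 'I_n)).
Local Notation "x ≺ y" := (op Prec x y) (at level 40, no associativity).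
Local Notation "x ≻ y" := (op Succ x y) (at level 40, no associativity).
Implicit Types (m : 'X_{1..n}) (Y : seq 'I_n).

Let hA := freeNZ_is_algebra F (option 'I_n).
Let hP := hA.1 Prec.
Let hS := hA.1 Succ.

Let e : AA := fvar _ None.
Let X (c : 'I_n) : AA := fvar _ (Some c).

(** The derivation that replaces one occurrence of e by the variable c. *)
Definition polar (c : 'I_n) : AA -> AA :=
  free_der (fun a : option 'I_n => if a is None then X c else 0).

Lemma polar_e c : polar c e = X c. Proof. exact: free_der_var. Qed.
Lemma polar_X c a : polar c (X a) = 0. Proof. exact: free_der_var. Qed.
Lemma polar_comm c a x : polar c (polar a x) = polar a (polar c x).
Proof. by apply: free_der_comm => -[b|]; rewrite ?free_der0 // !free_der_var. Qed.
Lemma polar_op c o x y : polar c (op o x y) = op o (polar c x) y + op o x (polar c y).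
Proof. exact: free_der_op. Qed.
Lemma polarD c x y : polar c (x + y) = polar c x + polar c y.
Proof. exact: free_derD. Qed.
Lemma polarZ c a x : polar c (a *: x) = a *: polar c x.
Proof. exact: free_derZ. Qed.
Lemma polarB c x y : polar c (x - y) = polar c x - polar c y.
Proof. exact: free_derB. Qed.
Lemma polar_mulop c f : mulop op f -> mulop op (fun w => polar c (f w) - f (polar c w)).
Proof. by apply: mulop_der => //; [exact: free_der_linear | exact: free_der_op]. Qed.
Lemma polar_tri c x y z : polar c (tri op x y z) =
  tri op (polar c x) y z + tri op x (polar c y) z + tri op x y (polar c z).
Proof.
rewrite /tri polar_op polarD !polar_op !(bilDl hS); congr (_ + _).
by rewrite [LHS](AC (2*2) ((1*4)*(2*3))).
Qed.

(** f multiplies by a function of degree j in e. By the second condition the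
    j + 1 factors e of f e are interchangeable: replacing any of them by c gives
    f applied to X_c. In the third condition, f' multiplies by the part of e D f
    where D does not fall on a factor e; the remaining part is j times f e'. *)
Definition homog_mul (j : nat) (f f' : AA -> AA) :=
  [/\ mulop op f, forall c, polar c (f e) = j.+1%:R *: f (X c)
    & forall w, e ≺ f w - f (e ≺ w) = f' w + j%:R *: (f w ≺ e)].

Lemma homog_mul_comp i j f f' g g' : homog_mul i f f' -> homog_mul j g g' ->
  homog_mul (i + j) (f \o g) (fun w => f' (g w) + f (g' w)).
Proof.
move=> [mf df ef] [mg dg eg]; split=> [|c|w] /=; first exact: mulop_comp.
- have := mulop_comm hA e (polar_mulop c mf) mg.
  rewrite df polar_e -{2}[f (X c)]scale1r -scalerBl.
  rewrite -[i.+1]addn1 natrD addrK => h.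
  rewrite -[LHS](subrK (f (polar c (g e)))) h dg (mulopZ hA _ _ mf).
  rewrite (mulopZ hA _ _ mg) (mulop_comm hA _ mg mf) -scalerDl.
  by rewrite -natrD addnS.
- rewrite -[LHS](subrKA (f (e ≺ g w))) ef -(mulopB hA _ _ mf) eg.
  rewrite (mulopD hA _ _ mf) (mulopZ hA _ _ mf) (mulop_R_comm hA _ _ mf).
  by rewrite natrD scalerDl addrACA.
Qed.

Lemma homog_mul_id : homog_mul 0 id (fun _ => 0).
Proof.
split=> [|c|w]; first exact: mulop_id; first by rewrite polar_e scale1r.
by rewrite subrr scale0r addr0.
Qed.

(** The first operator multiplies by the square of e. *)
Lemma homog_mul_sq : homog_mul 2 (tri op e e) (fun _ => 0).
Proof.
split=> [|c|w]; first exact: mulop_tri.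
- rewrite polar_tri polar_e [tri op e (X c) e](triAC hA) [tri op _ e e](triCA hA).
  by rewrite -mulr2n -mulrSr -scaler_nat.
- rewrite (prec_tri hA) [tri op e w e](triAC hA) addrAC [X in X + _]addrAC subrr.
  by rewrite !add0r scaler_nat mulr2n.
Qed.

(** Multiplication by e^(s-1) z^(s) for s > 0, where z^(s) is the s-th
    derivative of z: D(e^s z^(s)) is e^s z^(s+1) plus s e^(s-1) e' z^(s), and
    e^s z^(s), the value at e of the previous operator, is an element of the
    algebra, so that its derivative can be multiplied by. *)
Fixpoint dmul (z : 'I_n) (s : nat) : AA -> AA :=
  if s is s'.+1 then fun w =>
    w ≺ (if s' is 0 then X z else dmul z s' e) - s'%:R *: (dmul z s' w ≺ e)
  else id.

Lemma dmul1 z w : dmul z 1 w = w ≺ X z.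
Proof. by rewrite /= scale0r subr0. Qed.

Lemma dmulSS z s w : dmul z s.+2 w =
  w ≺ dmul z s.+1 e - s.+1%:R *: (dmul z s.+1 w ≺ e).
Proof. by []. Qed.

(** The last two conditions come from the symmetry of x f' y in x and y. *)
Lemma homog_dmul z s :
  homog_mul s.-1 (dmul z s) (if s is 0 then fun _ => 0 else dmul z s.+1).
Proof.
case: s => [|s]; first exact: homog_mul_id.
elim: s => [|s [mf df ef]].
  split=> [|c|w].
  - by apply: mulop_ext (mulop_R op (X z)) _ => w; rewrite dmul1.
  - by rewrite !dmul1 polar_op polar_e polar_X (bil0r hP) addr0 scale1r.
  - rewrite [dmul z 1 w]dmul1 [dmul z 1 (e ≺ w)]dmul1 [dmul z 2 w]/=.
    rewrite !scale0r !subr0 scale1r addr0.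
    by rewrite (nz_left_sym hA) (nz_precAC hA).
set f := dmul z s.+1 in mf df ef.
have e2 w : dmul z s.+2 w = w ≺ f e - s.+1%:R *: (f w ≺ e) by [].
have mf2 : mulop op (dmul z s.+2).
  apply: mulop_ext (mulop_sub (mulop_R op (f e))
    (mulop_scale (s.+1)%:R (mulop_comp (mulop_R op e) mf))) _ => w //.
clearbody f; split=> // [c|w].
- have h := mulop_delta_sym hA e (X c) mf.
  rewrite !e2 polarB polarZ !polar_op df polar_e.
  rewrite (bilZl hP) (bilZr hP) -[f e ≺ X c](mulop_R_comm hA _ _ mf).
  move: h; rewrite (mulop_R_comm hA (X c) e mf).
  set a := X c ≺ f e; set b := f (X c) ≺ e; set p := e ≺ f (X c).
  set q := f (e ≺ X c) => h.
  have -> : p = a - b + q by rewrite -h subrK.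
  rewrite -[s.+2]addn1 natrD; set t := s.+1%:R.
  clearbody a b p q t.
  rewrite [t *: (a - b + q)]scalerDr [t *: (t *: b + q)]scalerDr.
  rewrite [t *: _ + t *: q in X in _ - X]addrC opprD !addrA addrK.
  rewrite scalerDl scale1r !scalerBr addrA.
  by rewrite [LHS](AC 4 ((2*4)*(1*3))).
- rewrite (mulop_delta_sym hA _ _ mf2) (mulop_R_comm hA _ _ mf2).
  rewrite [dmul z s.+3 w]dmulSS -addrA; congr (_ + _).
  rewrite -[s.+2.-1]/s.+1 -[s.+2]addn1.
  by rewrite natrD scalerDl scale1r opprD addrAC addNr add0r.
Qed.

(** Multiplication by the square of e to the power h and by the factors
    e^(m_z - 1) z^(m_z) for the variables z of l with m_z > 0. *)
Fixpoint monmul (l : seq 'I_n) (h : nat) (m : 'X_{1..n}) : AA -> AA :=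
  if l is z :: l' then dmul z (m z) \o monmul l' h m
  else iter h (fun g => tri op e e \o g) id.

Lemma monmul_notin l h m z : z \notin l -> monmul l h (m + U_(z))%MM = monmul l h m.
Proof.
elim: l => [//|y l IHl] /=; rewrite inE negb_or => /andP[zy zl].
by rewrite IHl // mnmDE mnm1E (negPf zy) addn0.
Qed.

Lemma monmul_new l h m z w : uniq l -> z \in l -> m z = 0%N ->
  monmul l h (m + U_(z))%MM w = monmul l h m w ≺ X z.
Proof.
elim: l => [//|y l IHl] /= /andP[yl ul]; rewrite inE mnmDE mnm1E.
have [ezy|zy] := eqVneq z y => /= [_|zl] mz.
  by rewrite ezy in mz *; rewrite monmul_notin // mz dmul1.
have [mf _ _] := homog_dmul y (m y).
by rewrite addn0 IHl // (mulop_R_comm hA _ _ mf).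
Qed.

Lemma homog_mul_ext j f f' g' : homog_mul j f f' -> f' =1 g' -> homog_mul j f g'.
Proof. by move=> + /funext <-. Qed.

(** The degree counts one factor e less than there are derivatives for every z
    that occurs, whence the truncated predecessors. *)
Lemma homog_monmul l h m : uniq l ->
  homog_mul (h.*2 + \sum_(z <- l) (m z).-1) (monmul l h m)
    (fun w => \sum_(z <- l | (0 < m z)%N) monmul l h (m + U_(z))%MM w).
Proof.
elim: l => [_|z l IHl] /=.
  rewrite big_nil addn0; elim: h => [|h IHh].
    by apply: homog_mul_ext homog_mul_id _ => w; rewrite big_nil.
  rewrite doubleS -addn2 addnC; apply: homog_mul_ext (homog_mul_comp homog_mul_sq IHh)
      _ => w.
  by rewrite !big_nil (tri0r hA) addr0.
move=> /andP[zl ul]; have h1 := homog_dmul z (m z).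
rewrite big_cons addnCA; apply: homog_mul_ext (homog_mul_comp h1 (IHl ul)) _ => w.
case: h1 => mf _ _; rewrite big_cons.
have -> : dmul z (m z) (\sum_(y <- l | (0 < m y)%N) monmul l h (m + U_(y))%MM w) =
    \sum_(y <- l | (0 < m y)%N) monmul (z :: l) h (m + U_(y))%MM w.
  rewrite (big_morph (dmul z (m z)) (fun x y => mulopD hA x y mf) (mulop0 hA mf)).
  rewrite big_seq_cond [RHS]big_seq_cond; apply: eq_bigr => y /andP[yl _] /=.
  rewrite mnmDE mnm1E (_ : y == z = false) ?addn0 //.
  by apply: contraNF zl => /eqP <-.
case ez: (m z) => [|s] /=; first by rewrite add0r.
by rewrite mnmDE mnm1E eqxx addn1 monmul_notin // ez.
Qed.

Definition polars (Y : seq 'I_n) (x : AA) : AA := foldr polar x Y.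

Lemma polarsC Y c x : polars Y (polar c x) = polar c (polars Y x).
Proof. by elim: Y => //= y Y ->; rewrite polar_comm. Qed.

Lemma polars_perm Y Y' x : perm_eq Y Y' -> polars Y x = polars Y' x.
Proof.
elim: Y Y' => [|y Y IHY] Y'.
  by rewrite perm_sym => /perm_nilP ->.
move=> h; have yY : y \in Y' by rewrite -(perm_mem h) mem_head.
have [s1 [s2 eY]] : exists s1 s2, Y' = s1 ++ y :: s2.
  by case/splitPr: yY => s1 s2; exists s1, s2.
have -> : polars Y' x = polar y (polars (s1 ++ s2) x).
  rewrite eY /polars !foldr_cat -[foldr polar x (y :: s2)]/(polar y (polars s2 x)).
  exact: polarsC.
rewrite /= (IHY (s1 ++ s2)) //; move: h; rewrite eY.
by rewrite perm_sym -cat1s perm_catCA /= perm_cons perm_sym.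
Qed.

Lemma polars_linear Y : linear (polars Y).
Proof.
by move=> a x y; elim: Y => //= z Y ->; rewrite polarD polarZ.
Qed.
Lemma polarsD Y x y : polars Y (x + y) = polars Y x + polars Y y.
Proof. by rewrite -[x]scale1r polars_linear !scale1r. Qed.
Lemma polars0 Y : polars Y 0 = 0.
Proof. by apply: (addIr (polars Y 0)); rewrite -polarsD !add0r. Qed.
Lemma polarsZ Y a x : polars Y (a *: x) = a *: polars Y x.
Proof. by have := polars_linear Y a x 0; rewrite polars0 !addr0. Qed.

Lemma polars_precr Y x z : polars Y (x ≺ X z) = polars Y x ≺ X z.
Proof. by elim: Y => //= y Y ->; rewrite polar_op polar_X (bil0r hP) addr0. Qed.
Lemma polars_precl Y x z : polars Y (X z ≺ x) = X z ≺ polars Y x.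
Proof. by elim: Y => //= y Y ->; rewrite polar_op polar_X (bil0l hP) add0r. Qed.
Lemma polars_tri Y a b x : polars Y (tri op (X a) (X b) x) = tri op (X a) (X b) (polars
    Y x).
Proof.
elim: Y => //= y Y ->; rewrite polar_tri !polar_X.
by rewrite (triCA hA 0) (triC op _ 0) (triCA hA 0) !(tri0r hA) !add0r.
Qed.

(** Leibniz rule: the last factor e is hit by no polarization, or by one. *)
Lemma polars_prec_e Y w : uniq Y -> polars Y (w ≺ e) =
  polars Y w ≺ e + \sum_(y <- Y) polars (rem y Y) w ≺ X y.
Proof.
elim: Y => [|y Y IHY] /=; first by rewrite big_nil addr0.
move=> /andP[yY uY]; rewrite IHY // polarD polar_op polar_e big_cons eqxx -addrA.
congr (_ + (_ + _)).
rewrite (big_morph (polar y) (polarD y) (free_der0 _)); apply: eq_big_seq => z zY.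
rewrite polar_op polar_X (bil0r hP) addr0 ifN //.
by apply: contraNneq yY => ->.
Qed.
Local Notation A := (freeNZ F 'I_n).
Local Notation "x ≺' y" := (@nz F 'I_n Prec x y) (at level 40, no associativity).
Let hB := freeNZ_is_algebra F 'I_n.
Let hBP := hB.1 Prec.

Definition drop_e : AA -> A :=
  feval (@nz F 'I_n) (fun a => if a is Some c then fvar _ c else 0).

Lemma drop_e_op o x y : drop_e (op o x y) = nz o (drop_e x) (drop_e y).
Proof. exact: feval_op. Qed.
Lemma drop_e_X c : drop_e (X c) = fvar _ c. Proof. exact: feval_var. Qed.
Lemma drop_e_e : drop_e e = 0. Proof. exact: feval_var. Qed.
Lemma drop_eD x y : drop_e (x + y) = drop_e x + drop_e y.
Proof. exact: fevalD. Qed.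
Lemma drop_e0 : drop_e 0 = 0.
Proof. by apply: (addIr (drop_e 0)); rewrite -drop_eD !add0r. Qed.
Lemma drop_eZ a x : drop_e (a *: x) = a *: drop_e x.
Proof.
by have := feval_linear (fun a => if a is Some c then fvar _ c else 0) hB a x 0;
  rewrite -/(drop_e _) !addr0 -/(drop_e _) -/(drop_e _) drop_e0 addr0.
Qed.
Lemma drop_e_tri x y z : drop_e (tri op x y z) = mu (drop_e x) (drop_e y) (drop_e z).
Proof. by rewrite /tri drop_e_op drop_eD !drop_e_op. Qed.

(** The multiplier monmul applied to one more e, with all factors e replaced by
    the variables of Y. There are e_degree h m + 1 of them, which is meant to be
    the size of Y; each of the (size Y)! ways to replace them gives the same
    product. The substitution e = 0 leads back to the algebra without e. *)
Definition polar_mon (Y : seq 'I_n) h m : A :=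
  ((size Y)`!%:R)^-1 *: drop_e (polars Y (monmul (enum 'I_n) h m e)).

Lemma polar_mon_perm Y Y' h m : perm_eq Y Y' -> polar_mon Y h m = polar_mon Y' h m.
Proof.
by move=> hY; rewrite /polar_mon (perm_size hY) (polars_perm _ hY).
Qed.

Definition e_degree h m := (h.*2 + \sum_z (m z).-1)%N.

Lemma homog_monmulT h m : homog_mul (e_degree h m) (monmul (enum 'I_n) h m)
  (fun w => \sum_(z | (0 < m z)%N) monmul (enum 'I_n) h (m + U_(z))%MM w).
Proof.
have := homog_monmul h m (enum_uniq 'I_n); rewrite [\sum_(z <- _) _]big_enum /=.
by move=> ho; apply: homog_mul_ext ho _ => w; rewrite big_enum_cond.
Qed.

Lemma polar_mon_precr Y h m a : m a = 0%N ->
  polar_mon Y h m ≺' fvar _ a = polar_mon Y h (m + U_(a))%MM.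
Proof.
move=> ma; rewrite /polar_mon (bilZl hBP) -drop_e_X -drop_e_op -polars_precr.
by rewrite monmul_new ?enum_uniq ?mem_enum.
Qed.

Lemma natrS_neq0 k : (k.+1%:R : F) != 0.
Proof. by rewrite (pcharf0P F).1. Qed.

(** One of the size Y + 1 equal factors e, the last one, can be chosen to
    become c. *)
Lemma polar_mon_cons Y h m c : size Y = e_degree h m ->
  polar_mon (c :: Y) h m =
    ((size Y)`!%:R)^-1 *: drop_e (polars Y (monmul (enum 'I_n) h m (X c))).
Proof.
move=> sY; rewrite /polar_mon [polars (c :: Y) _]/= -polarsC.
have [_ -> _] : homog_mul _ _ _ := homog_monmulT h m.
rewrite polarsZ drop_eZ scalerA /= sY factS natrM invfM mulrAC mulVf ?mul1r //.
exact: natrS_neq0.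
Qed.

Lemma monmul_sq l h m w : monmul l h.+1 m w = tri op e e (monmul l h m w).
Proof.
elim: l => //= z l ->; have [mf _ _] := homog_dmul z (m z).
by rewrite (mulop_I_comm hA _ _ mf).
Qed.

Lemma polar_mon_tri Y h m a b : size Y = (e_degree h m).+1 ->
  mu (fvar _ a) (fvar _ b) (polar_mon Y h m) = polar_mon (a :: b :: Y) h.+1 m.
Proof.
move=> sY; rewrite polar_mon_cons; last by rewrite /= sY /e_degree doubleS.
rewrite /= -polarsC; set g := monmul (enum 'I_n) h m.
have [mg dg _] : homog_mul _ g _ := homog_monmulT h m.
have gtri x y z : g (tri op x y z) = tri op x y (g z).
  exact: (mulop_I_comm hA _ _ mg).
have -> : polar b (monmul (enum 'I_n) h.+1 m (X a)) =
    (size Y).+1%:R *: tri op (X a) (X b) (g e).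
  rewrite monmul_sq -/g -gtri (triAC hA) gtri polar_tri polar_e polar_X dg.
  have -> : tri op e 0 (g e) = 0 by rewrite (triAC hA) (tri0r hA).
  rewrite addr0 (triZr hA) -sY (triC op (X b)).
  have -> : tri op e (X a) (g (X b)) = tri op (X a) (X b) (g e).
    by rewrite -!gtri triC (triAC hA).
  by rewrite -{1}[tri _ _ _ _]scale1r -scalerDl nat1r.
rewrite polarsZ drop_eZ polars_tri drop_e_tri !drop_e_X scalerA factS natrM invfM.
rewrite mulrAC mulVf ?natrS_neq0 // mul1r /polar_mon.
by rewrite /mu (bilZr (hB.1 Succ)).
Qed.

(** Leibniz rule for X_c D applied to a differential monomial: the derivative
    falls on a differentiated variable z, or on a variable y of Y, which then
    leaves Y. *)
Lemma polar_mon_precl Y h m c : uniq Y -> (forall y, y \in Y -> m y = 0%N) ->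
  size Y = (e_degree h m).+1 ->
  fvar _ c ≺' polar_mon Y h m =
    \sum_(z | (0 < m z)%N) polar_mon (c :: Y) h (m + U_(z))%MM +
    \sum_(y <- Y) polar_mon (c :: rem y Y) h (m + U_(y))%MM.
Proof.
move=> uY mY sY; set g := monmul (enum 'I_n) h m.
have [mg dg eg] : homog_mul _ g _ := homog_monmulT h m.
rewrite {1}/polar_mon (bilZr hBP) -drop_e_X -drop_e_op -polars_precl -/g.
have -> : X c ≺ g e = \sum_(z | (0 < m z)%N) monmul (enum 'I_n) h (m + U_(z))%MM (X c)
    + (size Y)%:R *: (g (X c) ≺ e).
  rewrite -[LHS](subrK (g (X c ≺ e))) (mulop_delta_sym hA _ _ mg) eg.
  rewrite (mulop_R_comm hA _ _ mg) sY -[_.+1%:R]natr1 scalerDl scale1r.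
  by rewrite addrA.
rewrite polarsD drop_eD scalerDr; congr (_ + _).
  rewrite (big_morph (polars Y) (polarsD Y) (polars0 Y)).
  rewrite (big_morph drop_e drop_eD drop_e0) scaler_sumr; apply: eq_bigr => z mz.
  rewrite polar_mon_cons // sY /e_degree (bigD1 z) //= [in RHS](bigD1 z) //=.
  rewrite mnmDE mnm1E eqxx addn1 -addnS -addSn prednK //=.
  congr (_ + (_ + _))%N; apply: eq_bigr => y yz.
  by rewrite mnmDE mnm1E eq_sym (negPf yz) addn0.
(* The term where e is not polarized vanishes at e = 0. *)
rewrite polarsZ polars_prec_e // drop_eZ drop_eD drop_e_op drop_e_e (bil0r hBP) add0r.
rewrite (big_morph drop_e drop_eD drop_e0) scalerA scaler_sumr.
apply: eq_big_seq => y yY; rewrite polar_mon_cons; last first.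
  rewrite size_rem // sY /e_degree /=; congr (_ + _)%N; apply: eq_bigr => z _.
  rewrite mnmDE mnm1E; case: eqP => [<-|]; last by rewrite addn0.
  by rewrite mY.
rewrite monmul_new ?enum_uniq ?mem_enum ?mY // -/g polars_precr size_rem // sY.
rewrite factS natrM invfM mulrAC mulVf ?natrS_neq0 // mul1r.
by rewrite drop_e_op.
Qed.
End Polarization.

(** * Differential monomials on a block *)

Section DifferentialMonomials.
Variables (F : fieldType) (n : nat).
Hypothesis charF0 : [pchar F] =i pred0.
Implicit Types (B C : {set 'I_n}) (m : 'X_{1..n}) (h k : nat).
Local Notation A := (freeNZ F 'I_n).
Local Notation "x ≺ y" := (@nz F 'I_n Prec x y) (at level 40, no associativity).
Local Notation "x ≻ y" := (@nz F 'I_n Succ x y) (at level 40, no associativity).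
Local Notation X a := (fvar _ a : freeNZ F 'I_n).

(** A product of #|B| letters with prescribed derivatives is realized with
    h triple products and mdeg m operations ≺: each ≺ adds a letter and a
    derivative, each triple product adds two letters. *)
Definition has_defect h B m := mon_in B m /\ #|B| = (mdeg m + h.*2).+1.

Definition zeros B m := [seq a <- enum B | m a == 0%N].

Lemma mem_zeros B m a : (a \in zeros B m) = (a \in B) && (m a == 0%N).
Proof. by rewrite mem_filter mem_enum andbC. Qed.

Lemma zeros_uniq B m : uniq (zeros B m).
Proof. exact/filter_uniq/enum_uniq. Qed.

Lemma mon_in_notin B m a : mon_in B m -> a \notin B -> m a = 0%N.
Proof. by move=> hm aB; apply/eqP; apply: contraNT aB => /hm. Qed.

Lemma sum_mon_in B m (f : nat -> nat) : mon_in B m -> f 0%N = 0%N ->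
  (\sum_z f (m z) = \sum_(z in B) f (m z))%N.
Proof.
move=> hm f0; rewrite [RHS]big_mkcond; apply: eq_bigr => z _.
by case: ifPn => // /(mon_in_notin hm) ->.
Qed.

(** There are as many undifferentiated variables in B as factors e to be
    replaced, the one to which monmul is applied included. *)
Lemma size_zeros h B m : has_defect h B m -> size (zeros B m) = (e_degree h m).+1.
Proof.
move=> [hm cB]; apply/eqP; rewrite -(eqn_add2r (mdeg m)).
have -> : size (zeros B m) = (\sum_(z in B) (m z == 0))%N.
  rewrite size_filter -sum1_count big_enum_cond big_mkcondr /=.
  by apply: eq_bigr => z _; case: (m z == 0)%N.
have -> : ((e_degree h m).+1 + mdeg m = #|B| + \sum_z (m z).-1)%N.
  by rewrite cB /e_degree !addSn; congr _.+1; rewrite addnC addnA.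
rewrite mdegE (sum_mon_in (f := fun k => k) hm) // (sum_mon_in (f := predn) hm) //.
rewrite -big_split -sum1_card -big_split /=; apply/eqP/eq_bigr => z _.
by case: (m z).
Qed.

Lemma mdegDU m a : mdeg (m + U_(a))%MM = (mdeg m).+1.
Proof. by rewrite mdegD mdeg1 addn1. Qed.

Lemma mon_inS B C m : B \subset C -> mon_in B m -> mon_in C m.
Proof. by move=> BC hm a /hm; exact: (fintype.subsetP BC). Qed.

Lemma mon_inDU B m a : mon_in B m -> a \in B -> mon_in B (m + U_(a))%MM.
Proof.
move=> hm aB b; rewrite mnmDE mnm1E; have [<-//|_] := eqVneq a b.
by rewrite addn0; exact: hm.
Qed.

(** The product of the derivatives, prescribed by m, of the variables of B; the
    half is the defect of m on B. *)
Definition diff_mon B m : A :=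
  polar_mon F (zeros B m) ((#|B| - 1 - mdeg m)./2) m.

Lemma diff_monE h B m : has_defect h B m -> diff_mon B m = polar_mon F (zeros B m) h m.
Proof.
by move=> [_ cB]; rewrite /diff_mon cB subn1 /= addKn doubleK.
Qed.

Lemma has_defect_U h B m a : has_defect h B m -> a \notin B -> has_defect h (a |: B) (m
    + U_(a))%MM.
Proof.
move=> [hm cB] aB; split; last by rewrite cardsU1 aB cB mdegDU.
apply: mon_inDU; last exact: setU11.
exact: mon_inS (finset.subsetUr _ _) hm.
Qed.

Lemma has_defect_L h B m a c : has_defect h B m -> c \notin B -> a \in B ->
  has_defect h (c |: B) (m + U_(a))%MM.
Proof.
move=> [hm cB] nc aB; split; last by rewrite cardsU1 nc cB mdegDU.
apply: mon_inDU; last by rewrite setU1r.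
exact: mon_inS (finset.subsetUr _ _) hm.
Qed.

Lemma has_defect_T h B m a b : has_defect h B m -> a \notin b |: B -> b \notin B ->
  has_defect h.+1 (a |: (b |: B)) m.
Proof.
move=> [hm cB] na nb; split.
  by apply: mon_inS hm; rewrite finset.setUA finset.subsetUr.
by rewrite !cardsU1 na nb cB doubleS !add1n !addnS.
Qed.

Lemma diff_mon_var a : diff_mon [set a] 0%MM = X a.
Proof.
rewrite (diff_monE (h := 0)); last by split=> [b|]; rewrite ?mnm0E // cards1 mdeg0.
have -> : zeros [set a] 0%MM = [:: a].
  by rewrite /zeros enum_set1 /= mnm0E.
rewrite /polar_mon (_ : (size [:: a])`! = 1%N) // invr1 scale1r.
have -> w : monmul (enum 'I_n) 0 0%MM w = w.
  by elim: (enum _) => //= z l ->; rewrite mnm0E.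
by rewrite /= polar_e drop_e_X.
Qed.

Lemma diff_mon_precr h B m a : has_defect h B m -> a \notin B ->
  diff_mon B m ≺ X a = diff_mon (a |: B) (m + U_(a))%MM.
Proof.
move=> hm aB; rewrite (diff_monE hm) (diff_monE (has_defect_U hm aB)) polar_mon_precr;
    last first.
  by case: hm => /mon_in_notin ->.
apply: polar_mon_perm; apply: uniq_perm; try exact: zeros_uniq.
move=> b; rewrite !mem_zeros !inE mnmDE mnm1E.
have [->|ba] := eqVneq b a; first by rewrite (negPf aB) addn1 andbF.
by rewrite addn0.
Qed.

Lemma diff_mon_mu h B m a b : has_defect h B m -> a \notin b |: B -> b \notin B ->
  mu (X a) (X b) (diff_mon B m) = diff_mon (a |: (b |: B)) m.
Proof.
move=> hm na nb; rewrite (diff_monE hm) (diff_monE (has_defect_T hm na nb)).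
rewrite (polar_mon_tri charF0) ?(size_zeros hm) //.
apply: polar_mon_perm; apply: uniq_perm; try exact: zeros_uniq.
  move: na; rewrite /= zeros_uniq andbT !inE !mem_zeros !negb_or => /andP[-> na].
  by rewrite (negPf na) (negPf nb).
have [hi _] := hm; move: na; rewrite !inE negb_or => /andP[ab na].
move=> c; rewrite !inE !mem_zeros !inE.
have [->|ca] := eqVneq c a; first by rewrite (mon_in_notin hi na).
by have [->|cb] := eqVneq c b; first by rewrite (mon_in_notin hi nb).
Qed.

Lemma diff_mon_precl h B m c : has_defect h B m -> c \notin B ->
  X c ≺ diff_mon B m = \sum_(a in B) diff_mon (c |: B) (m + U_(a))%MM.
Proof.
move=> hm nc; have hi := hm.1; rewrite (diff_monE hm).
rewrite (polar_mon_precl charF0) ?zeros_uniq ?(size_zeros hm) //; last first.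
  by move=> y; rewrite mem_zeros => /andP[_ /eqP].
rewrite [RHS](bigID (fun a => 0 < m a)%N) /=; congr (_ + _).
  rewrite [LHS](eq_bigl (fun a => (a \in B) && (0 < m a)%N)); last first.
    by move=> a; case: (m a) (hi a) => [|k] /=; rewrite ?andbF ?andbT // => ->.
  apply: eq_bigr => a /andP[aB ma]; rewrite (diff_monE (has_defect_L hm nc aB)).
  apply: polar_mon_perm; apply: uniq_perm; try exact: zeros_uniq.
    by rewrite /= zeros_uniq mem_zeros (negPf nc).
  move=> b; rewrite inE !mem_zeros !inE mnmDE mnm1E.
  have [->|bc] := eqVneq b c.
    by rewrite (mon_in_notin hi nc) (_ : (a == c) = false) //; apply: contraNF nc =>
        /eqP <-.
  by rewrite addn_eq0; have [<-|] := eqVneq a b; rewrite ?andbT // -leqn0 leqNgt ma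
      !andbF.
rewrite big_filter big_enum_cond /=.
rewrite [RHS](eq_bigl (fun a => (a \in B) && (m a == 0)%N)); last first.
  by move=> a; rewrite -eqn0Ngt.
apply: eq_bigr => a /andP[aB ma]; rewrite (diff_monE (has_defect_L hm nc aB)).
apply: polar_mon_perm; apply: uniq_perm; try exact: zeros_uniq.
  rewrite /= rem_uniq ?zeros_uniq // andbT; apply: contraNN nc.
  by move=> /mem_rem; rewrite mem_zeros => /andP[].
move=> b; rewrite inE !mem_zeros mem_rem_uniq ?zeros_uniq // !inE mem_zeros.
rewrite mnmDE mnm1E addn_eq0.
have [->|bc] := eqVneq b c.
  by rewrite (mon_in_notin hi nc) (_ : (a == c) = false) //; apply: contraNF nc => /eqP
      <-.
by rewrite eq_sym; case: eqVneq; rewrite ?andbT ?andbF.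
Qed.

Lemma exists_exponent0 B m : (mdeg m < #|B|)%N -> exists2 y, y \in B & m y = 0%N.
Proof.
move=> dB; suff /exists_inP[y yB /eqP my] : [exists y in B, m y == 0%N] by exists y.
apply: contraTT dB; rewrite negb_exists => /forallP h.
rewrite -leqNgt mdegE -sum1_card big_mkcond /=; apply: leq_sum => a _.
by have := h a; rewrite negb_and; case: (a \in B) => //=; rewrite -lt0n.
Qed.

(** Differential monomials are generated by letters. If a variable z is
    differentiated once, it is split off by the operation _ ≺ X_z. If it is
    differentiated more and y is undifferentiated, the monomial occurs in
    X_y ≺ _ applied to the monomial without y and with one derivative of z less;
    the other terms of the Leibniz rule have one derivative of z less too. If
    nothing is differentiated, two letters are split off by a triple product.
    The values nu may differ from the differential monomials, so as to reach
    coefficients with the same argument. *)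
Lemma diff_mon_ind (V : zmodType) (nu : {set 'I_n} -> 'X_{1..n} -> V)
    (P : nat -> {set 'I_n} -> V -> Prop) :
  (forall h B, P h B 0) ->
  (forall h B u v, P h B u -> P h B v -> P h B (u - v)) ->
  (forall a, P 0%N [set a] (nu [set a] 0%MM)) ->
  (forall h B m a, has_defect h B m -> a \notin B -> P h B (nu B m) ->
     P h (a |: B) (nu (a |: B) (m + U_(a))%MM)) ->
  (forall h B m c, has_defect h B m -> c \notin B -> P h B (nu B m) ->
     P h (c |: B) (\sum_(a in B) nu (c |: B) (m + U_(a))%MM)) ->
  (forall h B m a b, has_defect h B m -> a \notin b |: B -> b \notin B ->
     P h B (nu B m) -> P h.+1 (a |: (b |: B)) (nu (a |: (b |: B)) m)) ->
  forall h B m, has_defect h B m -> P h B (nu B m).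
Proof.
move=> P0 PB Pvar PR PL PT.
have Psum h B (I : finType) (Q : pred I) (f : I -> V) :
    (forall i, Q i -> P h B (f i)) -> P h B (\sum_(i | Q i) f i).
  move=> hf; apply: (big_ind (P h B)) => // x y hx hy.
  by rewrite -[y]opprK -[- y]sub0r; apply/PB/PB/hy.
move=> h B; have [N] := ubnP #|B|; elim: N => // N IHN in h B *.
rewrite ltnS => BN m hm; have [hi cB] := hm.
(* Without derivatives, B is one letter or loses two of them. *)
have [m0|m0] := eqVneq m 0%MM.
  case: h => [|h] in hm cB *.
    have /cards1P[a ->] : #|B| == 1%N by rewrite cB m0 mdeg0.
    by rewrite m0.
  have /card_gt0P[a aB] : (0 < #|B|)%N by rewrite cB.
  have cBa : #|B :\ a| = (h.*2).+2.
    by have := cardsD1 a B; rewrite aB cB m0 mdeg0 add1n => -[<-].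
  have /card_gt0P[b bB] : (0 < #|B :\ a|)%N by rewrite cBa.
  have cBb : #|B :\ a :\ b| = (h.*2).+1.
    by have := cardsD1 b (B :\ a); rewrite bB cBa add1n => -[<-].
  have eB : B = a |: (b |: (B :\ a :\ b)) by rewrite !finset.setD1K.
  rewrite eB; have hm' : has_defect h (B :\ a :\ b) m.
    by split; rewrite ?cBb m0 ?mdeg0 // => c; rewrite mnm0E.
  apply: (PT _ _ _ _ _ hm') => //; rewrite ?finset.setD1K ?finset.setD11 //.
  by apply: IHN hm'; rewrite cBb; apply: leq_trans BN; rewrite cB m0 mdeg0 doubleS.
have [z mz] : exists z, m z != 0%N.
  apply/existsP; apply: contraNT m0; rewrite negb_exists => /forallP h0.
  by apply/eqP/mnmP => z; rewrite mnm0E; apply/eqP; have := h0 z; rewrite negbK.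
have [|y yB my] := @exists_exponent0 B m; first by rewrite cB ltnS leq_addr.
have zB := hi z mz; have zy : z != y by apply: contraNneq mz => ->; rewrite my.
have [s ms] : exists s, m z = s.+1 by case: (m z) mz => // s; exists s.
(* Induction on the order of derivation of z, with y undifferentiated. *)
elim: s => [|s IHs] in m hm hi cB m0 mz my ms *.
  pose m' := (m - U_(z))%MM; have em : m = (m' + U_(z))%MM by rewrite submK // lep1mP.
  have cz : #|B :\ z| = #|B|.-1 by rewrite (cardsD1 z B) zB.
  have hm' : has_defect h (B :\ z) m'.
    split; last by apply/eqP; rewrite cz cB em mdegDU.
    move=> a; rewrite !inE /m' mnmBE mnm1E.
    by have [<-|za] := eqVneq z a; [rewrite ms | rewrite subn0 => /hi ->].
  have := PR _ _ _ _ hm' (negbT (finset.setD11 _ _)); rewrite finset.setD1K // -em; apply.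
  by apply: IHN hm'; rewrite cz cB; move: BN; rewrite cB.
pose m' := (m - U_(z))%MM; have em : m = (m' + U_(z))%MM by rewrite submK // lep1mP.
have cy : #|B :\ y| = #|B|.-1 by rewrite (cardsD1 y B) yB.
have hm' : has_defect h (B :\ y) m'.
  split; last by apply/eqP; rewrite cy cB em mdegDU.
  move=> a; rewrite !inE /m' mnmBE mnm1E; have [->|ya] := eqVneq a y.
    by rewrite my.
  by move=> ma; apply: hi; case: (m a) ma.
have := PL _ _ _ _ hm' (negbT (finset.setD11 _ _)); rewrite finset.setD1K // => h1.
have {h1}/(_ (IHN _ _ _ _ hm')) h1 := h1; rewrite (bigD1 z) /= in h1; last first.
  by rewrite !inE zy.
rewrite -em in h1.
rewrite -[nu B m](addrK (\sum_(i in B :\ y | i != z) nu B (m' + U_(i))%MM)).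
apply: PB; first by apply: h1; rewrite cy cB; move: BN; rewrite cB.
apply: Psum => a /andP[aB az].
have hma : has_defect h B (m' + U_(a))%MM.
  by rewrite -(finset.setD1K yB); apply: has_defect_L => //; rewrite finset.setD11.
have [hia cBa] := hma; apply: IHs => //.
- by apply/eqP => /(congr1 (fun m : 'X_{1..n} => m a)); rewrite mnmDE mnm1E eqxx addn1
    mnm0E.
- by rewrite mnmDE mnm1E (negPf az) addn0 /m' mnmBE mnm1E eqxx ms subn1.
- rewrite mnmDE mnm1E /m' mnmBE my sub0n; move: aB; rewrite !inE => /andP[ay _].
  by rewrite (negPf ay).
- by rewrite mnmDE mnm1E (negPf az) addn0 /m' mnmBE mnm1E eqxx ms subn1.
Qed.

End DifferentialMonomials.

(** * Closure of the span of differential monomials *)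

Section Spans.
Variables (F : fieldType) (V : lmodType F).
Implicit Types (S T : set V).

Lemma lspan_ind S (P : V -> Prop) : P 0 ->
  (forall a x y, S x -> P y -> P (a *: x + y)) -> forall x, lspan S x -> P x.
Proof.
move=> P0 PD x [s [hs ->]]; rewrite big_seq.
by elim/big_rec: _ => // i y si; apply: PD; exact: hs.
Qed.

Lemma lspan0 S : lspan S 0.
Proof. by exists [::]; split=> //; rewrite big_nil. Qed.

Lemma lspan_lin S a x y : S x -> lspan S y -> lspan S (a *: x + y).
Proof.
move=> Sx [s [hs ->]]; exists ((a, x) :: s); split; last by rewrite big_cons.
by move=> av; rewrite inE => /orP[/eqP -> //|/hs].
Qed.

Lemma lspan_gen S x : S x -> lspan S x.
Proof. by move=> Sx; rewrite -[x]addr0 -[x]scale1r; apply: lspan_lin => //; exact: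
    lspan0. Qed.

Lemma lspanD S x y : lspan S x -> lspan S y -> lspan S (x + y).
Proof.
move=> hx hy; elim/lspan_ind: hx => [|a {}x z Sx IH]; first by rewrite add0r.
by rewrite -addrA; exact: lspan_lin.
Qed.

Lemma lspanZ S a x : lspan S x -> lspan S (a *: x).
Proof.
elim/lspan_ind => [|b {}x z Sx IH]; first by rewrite scaler0; exact: lspan0.
by rewrite scalerDr scalerA; exact: lspan_lin.
Qed.

Lemma lspanB S x y : lspan S x -> lspan S y -> lspan S (x - y).
Proof. by move=> hx hy; rewrite -scaleN1r; apply/lspanD/lspanZ. Qed.

Lemma lspan_sum S (I : eqType) (r : seq I) (P : pred I) (E : I -> V) :
  (forall i, i \in r -> P i -> lspan S (E i)) -> lspan S (\sum_(i <- r | P i) E i).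
Proof.
move=> h; rewrite big_seq_cond; apply: (big_ind (lspan S)).
- exact: lspan0.
- by move=> x y; exact: lspanD.
- by move=> i /andP[]; exact: h.
Qed.

Lemma lspan_sub S T : (forall x, S x -> lspan T x) ->
  forall x, lspan S x -> lspan T x.
Proof.
move=> ST; apply: lspan_ind => [|a x y Sx Ty]; first exact: lspan0.
by apply: lspanD => //; apply: lspanZ; exact: ST.
Qed.

Lemma lspan_bilinear (f : V -> V -> V) S T (U : set V) : bilinear_op f ->
  (forall x y, S x -> T y -> lspan U (f x y)) ->
  forall x y, lspan S x -> lspan T y -> lspan U (f x y).
Proof.
move=> hf h x y Sx Ty; elim/lspan_ind: Sx => [|a {}x x' Sx IH].
  by rewrite (bil0l hf); exact: lspan0.
rewrite (bilDl hf) (bilZl hf); apply: lspanD => //; apply: lspanZ.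
elim/lspan_ind: Ty {IH} => [|b {}y y' Ty IHy].
  by rewrite (bil0r hf); exact: lspan0.
rewrite (bilDr hf) (bilZr hf); apply: lspanD; last exact: IHy.
by apply: lspanZ; exact: h.
Qed.

End Spans.

Section Disjoint.
Variable T : finType.
Implicit Types A B C : {set T}.

Lemma disjUl A B C : [disjoint A :|: B & C] = [disjoint A & C] && [disjoint B & C].
Proof. by rewrite -!setI_eq0 finset.setIUl finset.setU_eq0. Qed.
Lemma disjUr A B C : [disjoint C & A :|: B] = [disjoint C & A] && [disjoint C & B].
Proof. by rewrite !(disjoint_sym C) disjUl. Qed.
Lemma disj1l a B : [disjoint [set a] & B] = (a \notin B).
Proof. by rewrite disjoints1. Qed.
Lemma disj1r a B : [disjoint B & [set a]] = (a \notin B).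
Proof. by rewrite disjoint_sym disj1l. Qed.
(** Reduces disjointness of unions of sets and letters to the atoms. *)
Definition disjE := (disjUl, disjUr, disj1l, disj1r, finset.in_setU, finset.in_set1,
    negb_or).
End Disjoint.

Ltac set_eq := apply/finset.setP => ?; rewrite !inE;
  repeat (match goal with
  | |- context [?a \in ?b] => case: (a \in b)
  | |- context [?a == ?b] => case: (a == b)
  end); by [].

Ltac disj :=
  repeat match goal with
  | H : is_true (disjoint _ _) |- _ => move: H
  | H : is_true (~~ (_ \in _)) |- _ => move: H
  end;
  rewrite ?disjE; intros;
  repeat match goal with H : is_true (_ && _) |- _ => case/andP: H; intros end;
  repeat (apply/andP; split);
  first [assumption | by rewrite disjoint_sym | by rewrite eq_sym].

Tactic Notation "fit" open_constr(H) := apply: H; first [disj | set_eq | lia].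

Section BlockSpace.
Variables (F : fieldType) (n : nat).
Hypothesis charF0 : [pchar F] =i pred0.
Implicit Types (A B C : {set 'I_n}) (m : 'X_{1..n}) (h k l : nat).
Local Notation NZ := (freeNZ F 'I_n).
Local Notation "x ≺ y" := (@nz F 'I_n Prec x y) (at level 40, no associativity).
Local Notation "x ≻ y" := (@nz F 'I_n Succ x y) (at level 40, no associativity).
Local Notation X a := (fvar _ a : freeNZ F 'I_n).
Let hA := freeNZ_is_algebra F 'I_n.
Let hP := hA.1 Prec.
Let hS := hA.1 Succ.

Definition diff_span B k : set NZ :=
  lspan (fun x => exists h m, [/\ has_defect h B m, k = mdeg m + h & x = diff_mon F B
      m]%N).

Lemma diff_span_mon h B m : has_defect h B m -> diff_span B (mdeg m + h) (diff_mon F B m).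
Proof. by move=> hm; apply: lspan_gen; exists h, m. Qed.

Lemma diff_span_cast B k B' k' x : diff_span B k x -> B = B' -> k = k' -> diff_span B'
    k' x.
Proof. by move=> + <- <-. Qed.

Lemma diff_span_precl B k c V : c \notin B -> diff_span B k V -> diff_span (c |: B)
    k.+1 (X c ≺ V).
Proof.
move=> nc; elim/lspan_ind => [|a x y [h [m [hm -> ->]]] IH].
  by rewrite (bil0r hP); exact: lspan0.
rewrite (bilDr hP) (bilZr hP); apply: lspanD => //; apply: lspanZ.
rewrite (diff_mon_precl charF0 hm nc); apply: lspan_sum => b _ bB.
by apply: diff_span_cast (diff_span_mon (has_defect_L hm nc bB)) _ _ => //; rewrite
    mdegDU.
Qed.

Lemma diff_span_precr B k c V : c \notin B -> diff_span B k V -> diff_span (c |: B)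
    k.+1 (V ≺ X c).
Proof.
move=> nc; elim/lspan_ind => [|a x y [h [m [hm -> ->]]] IH].
  by rewrite (bil0l hP); exact: lspan0.
rewrite (bilDl hP) (bilZl hP); apply: lspanD => //; apply: lspanZ.
rewrite (diff_mon_precr F hm nc).
by apply: diff_span_cast (diff_span_mon (has_defect_U hm nc)) _ _ => //; rewrite mdegDU.
Qed.

Lemma diff_span_mu_var B k a b V : a \notin b |: B -> b \notin B -> diff_span B k V ->
  diff_span (a |: (b |: B)) k.+1 (mu (X a) (X b) V).
Proof.
move=> na nb; elim/lspan_ind => [|c x y [h [m [hm -> ->]]] IH].
  by rewrite /mu (bil0r hS); exact: lspan0.
rewrite /mu (bilDr hS) (bilZr hS); apply: lspanD => //; apply: lspanZ.
rewrite -/(mu _ _ _) (diff_mon_mu charF0 hm na nb).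
by apply: diff_span_cast (diff_span_mon (has_defect_T hm na nb)) _ _ => //; rewrite addnS.
Qed.

Definition acts_mu C j U := forall B l V c, [disjoint C & B] -> c \notin C :|: B ->
  diff_span B l V -> diff_span (c |: (C :|: B)) (j + l).+1 (mu (X c) U V).

(** U acts, by ≺ on both sides and by the triple product with a letter, on the
    differential monomials in the other variables. The last condition, on the
    triple product with U and any U' that satisfies the third one, is what
    closure under general triple products needs. *)
Definition acts A k U :=
  [/\ forall B l V, [disjoint A & B] -> diff_span B l V ->
        diff_span (A :|: B) (k + l).+1 (U ≺ V),
      forall B l V, [disjoint A & B] -> diff_span B l V ->
        diff_span (A :|: B) (k + l).+1 (V ≺ U),
      acts_mu A k U
    & forall B l V C j U', [disjoint A & B] -> [disjoint C & A] -> [disjoint C & B] ->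
        acts_mu C j U' -> diff_span B l V ->
        diff_span (A :|: B :|: C) (k + l + j).+1 (mu U U' V)].

Lemma mu_tri (x y z : NZ) : mu x y z = tri (@nz F 'I_n) x y z.
Proof. by []. Qed.

Lemma acts_var a : acts [set a] 0 (X a).
Proof.
split.
- by move=> B l V; rewrite disj1l => aB /(diff_span_precl aB).
- by move=> B l V; rewrite disj1l => aB /(diff_span_precr aB).
- move=> B l V c; rewrite disj1l => aB na hV; exact: diff_span_mu_var hV.
- move=> B l V C j U' aB Ca CB hU' hV.
  by fit (diff_span_cast (hU' _ _ _ a CB ltac:(disj) hV)).
Qed.

(** As for acts_precr, all multiplications by X_c ≺ U are combinations of
    compositions of multiplications by X_c and by U. *)
Lemma acts_precl A k U c : c \notin A -> acts A k U -> acts (c |: A) k.+1 (X c ≺ U).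
Proof.
move=> cA [h1 h2 h3 h4]; split.
- move=> B l V dAB hV; rewrite (nz_precAC hA).
  by fit (diff_span_cast (h2 (c |: B) l.+1 _ ltac:(disj) (diff_span_precl (B := B) (c
      := c) ltac:(disj) hV))).
- move=> B l V dAB hV.
  have -> : V ≺ (X c ≺ U) = X c ≺ (V ≺ U) + ((V ≺ X c) ≺ U - (X c ≺ V) ≺ U).
    by rewrite addrCA addrC -(nz_left_sym hA) subrK.
  apply: lspanD; last apply: lspanB.
  + by fit (diff_span_cast (diff_span_precl (B := A :|: B) (c := c) ltac:(disj) (h2 B l
      _ ltac:(disj) hV))).
  + by fit (diff_span_cast (h2 (c |: B) _ _ ltac:(disj) (diff_span_precr (B := B) (c :=
      c) ltac:(disj) hV))).
  + by fit (diff_span_cast (h2 (c |: B) _ _ ltac:(disj) (diff_span_precl (B := B) (c :=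
      c) ltac:(disj) hV))).
- move=> B l V d dAB nd hV.
  have -> : mu (X d) (X c ≺ U) V = mu (X d) (X c) V ≺ U.
    by rewrite !mu_tri (triAC hA) -(tri_prec hA) (triAC hA (X d) V).
  by fit (diff_span_cast (h2 (d |: (c |: B)) _ _ ltac:(disj) (diff_span_mu_var (B := B)
      (a := d) (b := c) ltac:(disj) ltac:(disj) hV))).
- move=> B l V C j U' dAB dCA dCB hU' hV.
  have -> : mu (X c ≺ U) U' V = mu (X c) U' V ≺ U.
    by rewrite !mu_tri (triCA hA) -(tri_prec hA) (triCA hA V).
  by fit (diff_span_cast (h2 (c |: (C :|: B)) _ _ ltac:(disj) (hU' _ _ _ c dCB
      ltac:(disj) hV))).
Qed.

(** Left multiplication by U ≺ X_c is the left multiplication by U followed by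
    the right multiplication by X_c, and left symmetry expresses the right
    multiplication through both multiplications by U and by X_c. *)
Lemma acts_precr A k U c : c \notin A -> acts A k U -> acts (c |: A) k.+1 (U ≺ X c).
Proof.
move=> cA [h1 h2 h3 h4]; split.
- move=> B l V dAB hV; rewrite (nz_precAC hA).
  by fit (diff_span_cast (diff_span_precr (B := A :|: B) (c := c) ltac:(disj) (h1 B _ _
      ltac:(disj) hV))).
- move=> B l V dAB hV.
  have -> : V ≺ (U ≺ X c) = U ≺ (V ≺ X c) + ((V ≺ U) ≺ X c - (U ≺ V) ≺ X c).
    by rewrite addrCA addrC -(nz_left_sym hA) subrK.
  apply: lspanD; last apply: lspanB.
  + by fit (diff_span_cast (h1 (c |: B) _ _ ltac:(disj) (diff_span_precr (B := B) (c :=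
      c) ltac:(disj) hV))).
  + by fit (diff_span_cast (diff_span_precr (B := A :|: B) (c := c) ltac:(disj) (h2 B l
      _ ltac:(disj) hV))).
  + by fit (diff_span_cast (diff_span_precr (B := A :|: B) (c := c) ltac:(disj) (h1 B l
      _ ltac:(disj) hV))).
- move=> B l V d dAB nd hV.
  have -> : mu (X d) (U ≺ X c) V = mu (X d) U V ≺ X c.
    by rewrite !mu_tri (triAC hA) -(tri_prec hA) (triAC hA (X d) V).
  by fit (diff_span_cast (diff_span_precr (B := d |: (A :|: B)) (c := c) ltac:(disj)
            (h3 B l V d ltac:(disj) ltac:(disj) hV))).
- move=> B l V C j U' dAB dCA dCB hU' hV.
  have -> : mu (U ≺ X c) U' V = mu U U' V ≺ X c.
    by rewrite !mu_tri (triCA hA) -(tri_prec hA) (triCA hA V).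
  by fit (diff_span_cast (diff_span_precr (B := A :|: B :|: C) (c := c) ltac:(disj)
            (h4 B l V C j U' ltac:(disj) ltac:(disj) dCB hU' hV))).
Qed.

Lemma acts_mu_var A k U a b : a \notin b |: A -> b \notin A -> acts A k U ->
  acts (a |: (b |: A)) k.+1 (mu (X a) (X b) U).
Proof.
move=> na nb [h1 h2 h3 h4]; split.
- move=> B l V dAB hV; rewrite mu_tri (tri_prec hA) -mu_tri.
  by fit (diff_span_cast (diff_span_mu_var (B := A :|: B) (a := a) (b := b) ltac:(disj)
      ltac:(disj)
            (h1 B _ _ ltac:(disj) hV))).
- move=> B l V dAB hV; rewrite mu_tri (prec_tri hA) -!mu_tri.
  apply: lspanD; first apply: lspanD.
  + by fit (diff_span_cast (diff_span_mu_var (B := A :|: B) (a := a) (b := b)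
      ltac:(disj) ltac:(disj)
            (h2 B _ _ ltac:(disj) hV))).
  + by fit (diff_span_cast (diff_span_precr (B := a |: (A :|: B)) (c := b) ltac:(disj)
            (h3 B _ _ a ltac:(disj) ltac:(disj) hV))).
  + by fit (diff_span_cast (diff_span_precr (B := b |: (A :|: B)) (c := a) ltac:(disj)
            (h3 B _ _ b ltac:(disj) ltac:(disj) hV))).
- move=> B l V d dAB nd hV.
  have -> : mu (X d) (mu (X a) (X b) U) V = mu (X a) (X b) (mu (X d) U V).
    by rewrite !mu_tri (tri_assoc hA).
  by fit (diff_span_cast (diff_span_mu_var (B := d |: (A :|: B)) (a := a) (b := b)
      ltac:(disj) ltac:(disj)
            (h3 B _ _ d ltac:(disj) ltac:(disj) hV))).
- move=> B l V C j U' dAB dCA dCB hU' hV.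
  have -> : mu (mu (X a) (X b) U) U' V = mu (X a) (X b) (mu U U' V).
    by rewrite !mu_tri (triC _ (tri _ _ _ _)) (tri_assoc hA) (triC _ U').
  by fit (diff_span_cast (diff_span_mu_var (B := A :|: B :|: C) (a := a) (b := b)
      ltac:(disj) ltac:(disj)
            (h4 B l V C j U' ltac:(disj) ltac:(disj) dCB hU' hV))).
Qed.

Lemma acts_0 A k : acts A k 0.
Proof.
split; move=> *.
- by rewrite (bil0l hP); exact: lspan0.
- by rewrite (bil0r hP); exact: lspan0.
- by rewrite mu_tri (triAC hA) (tri0r hA); exact: lspan0.
- by rewrite mu_tri (triCA hA) (tri0r hA); exact: lspan0.
Qed.

Lemma acts_lin A k c U U' : acts A k U -> acts A k U' -> acts A k (c *: U + U').
Proof.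
move=> [h1 h2 h3 h4] [g1 g2 g3 g4]; split.
- by move=> B l V d hV; rewrite (bilDl hP) (bilZl hP);
    apply: lspanD; [apply: lspanZ; exact: h1 | exact: g1].
- by move=> B l V d hV; rewrite (bilDr hP) (bilZr hP);
    apply: lspanD; [apply: lspanZ; exact: h2 | exact: g2].
- move=> B l V a d nc hV; rewrite mu_tri (triDm hA) (triZm hA) -!mu_tri.
  by apply: lspanD; [apply: lspanZ; exact: h3 | exact: g3].
- move=> B l V C j W dAB dCA dCB hW hV.
  rewrite mu_tri (triDl hA) (triZl hA) -!mu_tri.
  by apply: lspanD; [apply: lspanZ; exact: h4 hV | exact: g4 hV].
Qed.

Lemma acts_diff_mon h B m : has_defect h B m -> acts B (mdeg m + h) (diff_mon F B m).
Proof.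
(* The equation says k = mdeg m + h without naming m. *)
move=> hm; pose P h B U := forall k, (k + h).+1 = #|B| -> acts B k U.
apply: (diff_mon_ind (P := P)) (hm) _ _; last by case: hm => _ ->; rewrite -addnn addnA.
- by move=> h' B' k _; exact: acts_0.
- move=> h' B' u v hu hv k e; rewrite addrC -scaleN1r.
  by apply: acts_lin; [exact: hv | exact: hu].
- by move=> a k; rewrite cards1 addn0 diff_mon_var => -[->]; exact: acts_var.
- move=> h' B' m' a hm' aB IH [|k]; rewrite cardsU1 aB.
    by case: hm' => _ ->; lia.
  rewrite -(diff_mon_precr F hm' aB) => e; apply: acts_precr => //; apply: IH.
  by move: e; lia.
- move=> h' B' m' a hm' aB IH [|k]; rewrite cardsU1 aB.
    by case: hm' => _ ->; lia.
  rewrite -(diff_mon_precl charF0 hm' aB) => e; apply: acts_precl => //; apply: IH.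
  by move: e; lia.
- move=> h' B' m' a b hm' na nb IH [|k]; rewrite !cardsU1 na nb.
    by case: hm' => _ ->; lia.
  rewrite -(diff_mon_mu charF0 hm' na nb) => e; apply: acts_mu_var => //; apply: IH.
  by move: e; lia.
Qed.

Lemma diff_span_acts A k U : diff_span A k U -> acts A k U.
Proof.
elim/lspan_ind => [|a x y [h [m [hm -> ->]]] IH]; first exact: acts_0.
by apply: acts_lin => //; exact: acts_diff_mon.
Qed.

(** A product of two differential monomials cannot be computed directly from
    the rules for letters, but the first factor is itself generated by letters,
    and the operators of multiplication by it are generated by those of its
    letters. *)
Lemma diff_span_prec A B k l x y : [disjoint A & B] -> diff_span A k x -> diff_span B l
    y ->
  diff_span (A :|: B) (k + l).+1 (x ≺ y).
Proof. by move=> d /diff_span_acts[h1 _ _ _]; exact: h1. Qed.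

Lemma diff_span_mu A B C k l j x y z : [disjoint A & B] -> [disjoint B & C] ->
  [disjoint A & C] -> diff_span A k x -> diff_span B l y -> diff_span C j z ->
  diff_span (A :|: B :|: C) (k + l + j).+1 (mu x y z).
Proof.
move=> AB BC AC /diff_span_acts[_ _ _ h4] /diff_span_acts[_ _ h3 _] hz.
by fit (diff_span_cast (h4 C j z B l y AC ltac:(disj) BC h3 hz)).
Qed.

End BlockSpace.

(** * Spanning by chains of blocks *)

Section Chains.
Variables (F : fieldType) (n : nat).
Hypothesis charF0 : [pchar F] =i pred0.
Implicit Types (A B C S : {set 'I_n}) (m : 'X_{1..n}) (h j k l : nat).
Local Notation NZ := (freeNZ F 'I_n).
Local Notation "x ≺ y" := (@nz F 'I_n Prec x y) (at level 40, no associativity).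
Local Notation "x ≻ y" := (@nz F 'I_n Succ x y) (at level 40, no associativity).
Local Notation X a := (fvar _ a : freeNZ F 'I_n).
Local Notation chain := (seq ({set 'I_n} * 'X_{1..n})).
Implicit Types (d e : chain).
Let hA := freeNZ_is_algebra F 'I_n.
Let hP := hA.1 Prec.
Let hS := hA.1 Succ.

Definition chain_prod d : NZ := bracket [seq diff_mon F p.1 p.2 | p <- d].

Lemma chain_prod_rcons d B m : (0 < size d)%N ->
  chain_prod (rcons d (B, m)) = chain_prod d ≻ diff_mon F B m.
Proof. by case: d => // p d _; rewrite /chain_prod map_rcons /= foldl_rcons. Qed.

(** The index nat counts the operations ≺. All blocks but the last avoid their
    largest variable, and so does the last one if b. *)
Inductive is_chain (b : bool) : {set 'I_n} -> nat -> chain -> Prop :=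
| chain1 B h m of has_defect h B m & (b -> mon_in (drop_max B) m) :
    is_chain b B (mdeg m + h) [:: (B, m)]
| chainS S k d B h m of is_chain true S k d & [disjoint S & B] & has_defect h B m &
    (b -> mon_in (drop_max B) m) :
    is_chain b (S :|: B) (k + (mdeg m + h)) (rcons d (B, m)).

Lemma chain_size b S k d : is_chain b S k d -> (0 < size d)%N.
Proof. by case=> // *; rewrite size_rcons. Qed.

Lemma chain_weak b S k d : is_chain b S k d -> is_chain false S k d.
Proof. by case=> *; [apply: chain1 | apply: chainS]. Qed.

Definition chain_span_le j S k : set NZ :=
  lspan (fun x => exists d, [/\ is_chain false S k d, (size d <= j)%N & x = chain_prod
      d]).

Lemma chain_span_le_cast j S k j' S' k' x : chain_span_le j S k x -> (j <= j')%N -> S =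
    S' -> k = k' ->
  chain_span_le j' S' k' x.
Proof.
move=> + jj <- <-; apply: lspan_sub => _ [d [od sd ->]].
by apply: lspan_gen; exists d; split=> //; exact: leq_trans jj.
Qed.

Lemma diff_span_chain_span_le j B k x : diff_span B k x -> chain_span_le j.+1 B k x.
Proof.
apply: lspan_sub => _ [h [m [hm -> ->]]]; apply: lspan_gen.
by exists [:: (B, m)]; split=> //; apply: chain1.
Qed.

Lemma snoc_closed_chain S k d B l x : is_chain true S k d -> [disjoint S & B] ->
  diff_span B l x -> chain_span_le (size d).+1 (S :|: B) (k + l) (chain_prod d ≻ x).
Proof.
move=> od dSB; elim/lspan_ind => [|a {}x y [h [m [hm -> ->]]] IH].
  by rewrite (bil0r hS); exact: lspan0.
rewrite (bilDr hS) (bilZr hS); apply: lspanD => //; apply: lspanZ.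
apply: lspan_gen; exists (rcons d (B, m)); rewrite size_rcons; split=> //.
  by apply: chainS.
by rewrite chain_prod_rcons // (chain_size od).
Qed.

(** For the realization in a differential algebra this is D(x y), so that
    applying it with ≻ multiplies by x y. *)
Definition prec_sym (x y : NZ) : NZ := x ≺ y + y ≺ x.

(** A differentiated variable a can be traded, up to a total derivative, for
    derivatives of the other variables. The total derivative is that of X_y u
    with y undifferentiated. *)
Lemma diff_mon_reduce h B m a : has_defect h B m -> m a != 0%N ->
  exists y u, [/\ y \in B, diff_span (F := F) (B :\ y) (mdeg m + h).-1 u &
    diff_mon F B m = prec_sym (X y) u -
      \sum_(b in B | b != a) diff_mon F B (m - U_(a) + U_(b))%MM].
Proof.
move=> hm ma; have [hi cB] := hm.
have [|y yB my] := @exists_exponent0 _ B m; first by rewrite cB ltnS leq_addr.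
have aB := hi a ma; have ay : a != y by apply: contraNneq ma => ->; rewrite my.
pose m' := (m - U_(a))%MM; have em : m = (m' + U_(a))%MM by rewrite submK // lep1mP.
have m'y : m' y = 0%N by rewrite /m' mnmBE my.
have cy : #|B :\ y| = #|B|.-1 by rewrite (cardsD1 y B) yB.
have hm' : has_defect h (B :\ y) m'.
  split; last by apply/eqP; rewrite cy cB em mdegDU.
  move=> c; rewrite !inE /m' mnmBE mnm1E; have [->|yc] := eqVneq c y.
    by rewrite my.
  by move=> mc; apply: hi; case: (m c) mc.
exists y, (diff_mon F (B :\ y) m'); split=> //.
  by rewrite em mdegDU; exact: diff_span_mon.
rewrite /prec_sym (diff_mon_precl charF0 hm') ?finset.setD11 // (diff_mon_precr F hm')
    ?finset.setD11 //.
rewrite finset.setD1K // [Y in Y - _]addrC -(big_setD1 y) //=.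
by rewrite (bigD1 a) //= -em addrK.
Qed.

Lemma exists_max B : (0 < #|B|)%N -> exists2 a, a \in B & drop_max B = B :\ a.
Proof.
case/card_gt0P => b0 b0B.
have [a aB amax] := @arg_maxnP _ b0 (mem B) (fun a => nat_of_ord a) b0B.
have {}amax c : c \in B -> (c <= a)%N := amax c.
exists a => //; apply/finset.setP => b; rewrite !inE.
have [bB|] := boolP (b \in B); last by rewrite andbF.
rewrite andbT /=; apply/exists_inP/idP => [[c cB bc]|ba].
  by apply: contraTneq bc => ->; rewrite -leqNgt amax.
by exists a; rewrite // ltn_neqAle amax // andbT.
Qed.

(** Iterating diff_mon_reduce on the largest variable of B leaves the monomials
    that avoid it and total derivatives. *)
Lemma avoid_max (R : NZ -> Prop) h B k : R 0 ->
  (forall x y, R x -> R y -> R (x - y)) ->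
  (forall m, has_defect h B m -> mon_in (drop_max B) m -> (mdeg m + h = k)%N ->
     R (diff_mon F B m)) ->
  (forall y u, y \in B -> diff_span (F := F) (B :\ y) k.-1 u -> (0 < k)%N -> R
      (prec_sym (X y) u)) ->
  forall m, has_defect h B m -> (mdeg m + h = k)%N -> R (diff_mon F B m).
Proof.
move=> R0 RB R1 R2 m hm.
have [|a aB ea] := @exists_max B; first by case: hm => _ ->.
have [s] := ubnP (m a); elim: s => // s IHs in m hm *; rewrite ltnS => mas km.
have [ma|ma] := eqVneq (m a) 0%N.
  apply: R1 => // c mc; rewrite ea !inE (hm.1 c mc) andbT.
  by apply: contraNneq mc => ->; rewrite ma.
have [y [u [yB hu ->]]] := diff_mon_reduce hm ma; apply: (RB).
  apply: (R2 y u) => //; first by rewrite -km.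
  by rewrite -km mdegE (bigD1 a) //= -addnA ltn_addr // lt0n.
apply: (big_ind R) => // [v w hv hw|b /andP[bB ba]].
  by rewrite -[w]opprK -[- w]sub0r; apply/RB/RB/hw.
pose m' := (m - U_(a))%MM; have em : m = (m' + U_(a))%MM by rewrite submK // lep1mP.
have e : mdeg (m' + U_(b))%MM = mdeg m by rewrite em !mdegDU.
apply: IHs; rewrite ?e //.
  split; last by rewrite e; case: hm.
  apply: mon_inDU => // c; rewrite mnmBE => mc; apply: hm.1.
  by case: (m c) mc.
rewrite mnmDE mnmBE !mnm1E eqxx (negPf ba) addn0 subn1.
by case: (m a) ma mas.
Qed.


Lemma diff_span_var a : diff_span (F := F) [set a] 0 (X a).
Proof.
have hm : has_defect 0 [set a] (0%MM : 'X_{1..n}).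
  by split=> [b|]; rewrite ?mnm0E // cards1 mdeg0.
by have := diff_span_mon F hm; rewrite mdeg0 diff_mon_var.
Qed.

Lemma prec_sym_diff_span B k y u C l x : y \in B -> diff_span (B :\ y) k u ->
  [disjoint B & C] -> diff_span C l x -> diff_span (B :|: C) (k + l).+1 (prec_sym (X y)
      u ≻ x).
Proof.
move=> yB hu dBC hx; move: dBC; rewrite -(finset.setD1K yB) => dBC.
have ny : y \notin B :\ y by rewrite !inE eqxx.
by fit (diff_span_cast (diff_span_mu charF0 (A := [set y]) (B := B :\ y) (C := C)
  ltac:(disj) ltac:(disj) ltac:(disj) (diff_span_var y) hu hx)).
Qed.

(** Multiplying by X_y u can be done on the last block. *)
Lemma prec_sym_chain S l d B k y u : y \in B -> diff_span (B :\ y) k u ->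
  [disjoint B & S] -> is_chain true S l d ->
  chain_span_le (size d) (B :|: S) (k + l).+1 (prec_sym (X y) u ≻ chain_prod d).
Proof.
move=> yB hu + od; case: od => {S l d} [C h m hm _ dBC|S l d C h m od dSC hm _ dBSC].
  by apply: diff_span_chain_span_le; apply: prec_sym_diff_span => //; exact:
      diff_span_mon.
rewrite size_rcons chain_prod_rcons ?(chain_size od) // (nz_succCA hA).
have hx : diff_span (B :|: C) (k + (mdeg m + h)).+1 (prec_sym (X y) u ≻ diff_mon F C m).
  by apply: (prec_sym_diff_span yB hu); [disj | exact: diff_span_mon].
by apply: (chain_span_le_cast (snoc_closed_chain od _ hx)); first [disj|set_eq|lia].
Qed.

(** By avoid_max the last block of the chain may be taken to be a total
    derivative D w, and then (c ≻ D w) ≻ x = c ≻ (w x) - (w c) ≻ x, integration by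
    parts, leads to chains with fewer blocks. *)
Lemma snoc_chain j S k d B l x : (size d <= j)%N -> is_chain false S k d ->
  [disjoint S & B] -> diff_span B l x -> chain_span_le j.+1 (S :|: B) (k + l)
      (chain_prod d ≻ x).
Proof.
elim: j S k d B l x => [|j IHj] S k d B l x; first by case: d => // + /chain_size.
move=> + od; case: od => {S k d} [C h m hm _ _ dCB hx|S k d C h m od dSC hm _].
  rewrite -[chain_prod _]/(diff_mon F C m).
  apply: (avoid_max (R := fun v => chain_span_le j.+2 (C :|: B) (mdeg m + h + l) (v ≻
      x)) _ _ _ _ hm) => //.
  - by rewrite (bil0l hS); exact: lspan0.
  - by move=> v w hv hw; rewrite (bilDl hS) (bilNl hS); apply: lspanB.
  - move=> m' hm' dm' <-; rewrite -[diff_mon F C m']/(chain_prod [:: (C, m')]).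
    by apply: (chain_span_le_cast (snoc_closed_chain _ dCB hx)) => //; exact: chain1.
  - move=> y u yC hu k0; apply: diff_span_chain_span_le.
    by fit (diff_span_cast (prec_sym_diff_span yC hu dCB hx)).
rewrite size_rcons ltnS => sd dSCB hx; rewrite chain_prod_rcons ?(chain_size od) //.
apply: (avoid_max (R := fun v => chain_span_le j.+2 (S :|: C :|: B)
  (k + (mdeg m + h) + l) ((chain_prod d ≻ v) ≻ x)) _ _ _ _ hm) => //.
- by rewrite (bil0r hS) (bil0l hS); exact: lspan0.
- by move=> v w hv hw; rewrite (bilDr hS) (bilNr hS) (bilDl hS) (bilNl hS); apply: lspanB.
- move=> m' hm' dm' <-; rewrite -chain_prod_rcons ?(chain_size od) //.
  apply: (chain_span_le_cast (snoc_closed_chain (chainS od dSC hm' _) dSCB hx)) => //.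
  by rewrite size_rcons.
move=> y u yC hu k0.
have -> : (chain_prod d ≻ prec_sym (X y) u) ≻ x =
    chain_prod d ≻ (prec_sym (X y) u ≻ x) - (prec_sym (X y) u ≻ chain_prod d) ≻ x.
  by case: hA.2 => hz _ _; rewrite hz addrK.
apply: lspanB.
  have hDx := prec_sym_diff_span (C := B) yC hu ltac:(disj) hx.
  by apply: (chain_span_le_cast (snoc_closed_chain od _ hDx)); first [disj|set_eq|lia].
have := prec_sym_chain (S := S) yC hu ltac:(disj) od.
elim/lspan_ind => [|a v w [e [oe se ->]] IH].
  by rewrite (bil0l hS); exact: lspan0.
rewrite (bilDl hS) (bilZl hS); apply: lspanD => //; apply: lspanZ.
have := IHj _ _ e B l x (leq_trans se sd) oe _ hx.
move=> hh; apply: (chain_span_le_cast (hh _)); first [disj|set_eq|lia].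
Qed.

Definition chain_span S k : set NZ := lspan (fun x => exists2 d, is_chain false S k d &
    x = chain_prod d).

Lemma chain_span_leW j S k x : chain_span_le j S k x -> chain_span S k x.
Proof.
by apply: lspan_sub => _ [d [od _ ->]]; apply: lspan_gen; exists d.
Qed.

Lemma chain_span_cast S k S' k' x : chain_span S k x -> S = S' -> k = k' -> chain_span
    S' k' x.
Proof. by move=> + <- <-. Qed.

Lemma chain_span_snoc S k x B l y : [disjoint S & B] -> chain_span S k x -> diff_span B
    l y ->
  chain_span (S :|: B) (k + l) (x ≻ y).
Proof.
move=> dSB hx hy; elim/lspan_ind: hx => [|a {}x z [d od ->] IH].
  by rewrite (bil0l hS); exact: lspan0.
rewrite (bilDl hS) (bilZl hS); apply: lspanD => //; apply: lspanZ.
exact: chain_span_leW (snoc_chain (leqnn _) od dSB hy).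
Qed.

(** The Zinbiel identity unfolds the last block of the second chain. *)
Lemma chain_span_succ_chain N A k d B l e : (size d + size e <= N)%N ->
  is_chain false A k d -> is_chain false B l e -> [disjoint A & B] ->
  chain_span (A :|: B) (k + l) (chain_prod d ≻ chain_prod e).
Proof.
elim: N A k d B l e => [|N IHN] A k d B l e.
  by case: d => // + /chain_size.
move=> + od oe; case: oe => {B l e} [B h m hm _ _ dAB|B l e B' h m oe dBB hm _].
  apply: chain_span_snoc dAB _ _; last exact: diff_span_mon.
  by apply: lspan_gen; exists d.
rewrite size_rcons addnS ltnS => sN dABB; rewrite chain_prod_rcons ?(chain_size oe) //.
case: hA.2 => -> _ _; apply: lspanD.
- apply: (chain_span_cast (chain_span_snoc _ (IHN A k d B l e sN od (chain_weak oe) _)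
    (diff_span_mon F hm)));
    first [disj|set_eq|lia].
- rewrite addnC in sN.
  apply: (chain_span_cast (chain_span_snoc _ (IHN B l e A k d sN (chain_weak oe) od _)
      (diff_span_mon F hm)));
    first [disj|set_eq|lia].
Qed.

Lemma chain_span_succ A k x B l y : [disjoint A & B] -> chain_span A k x -> chain_span
    B l y ->
  chain_span (A :|: B) (k + l) (x ≻ y).
Proof.
move=> dAB; apply: (lspan_bilinear hS) => _ _ [d od ->] [e oe ->].
exact: chain_span_succ_chain (leqnn _) od oe dAB.
Qed.

Lemma diff_span_chain_span B k x : diff_span B k x -> chain_span B k x.
Proof. by move=> /(diff_span_chain_span_le 0)/chain_span_leW. Qed.

(** Both operations move to the last blocks: (c ≻ b) ≺ y = c ≻ (b ≺ y), and
    b ≺ (c ≻ b') is the triple product of b, c, b' plus c ≻ (b ≺ b'). *)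
Lemma chain_span_prec A k x B l y : [disjoint A & B] -> chain_span A k x -> chain_span
    B l y ->
  chain_span (A :|: B) (k + l).+1 (x ≺ y).
Proof.
move=> dAB; apply: (lspan_bilinear hP) => _ _ [d od ->] [e oe ->].
have base A' p h : has_defect h A' p -> [disjoint A' & B] ->
    chain_span (A' :|: B) (mdeg p + h + l).+1 (diff_mon F A' p ≺ chain_prod e).
  move=> hp; have wp := diff_span_mon F hp.
  case: oe => {B l e dAB} [B h' m hm _ dAB|B l e B' h' m oe dBB hm _ dABB].
    exact: diff_span_chain_span (diff_span_prec charF0 dAB wp (diff_span_mon F hm)).
  rewrite chain_prod_rcons ?(chain_size oe) // (nz_prec_succ hA) -mu_tri.
  have wm := diff_span_mon F hm; apply: lspanD.
    case: oe dBB dABB => {B l e} [B i q hq _|B l e C i q oe dBC hq _] dBB dABB.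
      apply: diff_span_chain_span.
      by fit (diff_span_cast (diff_span_mu charF0 (A := A') (B := B) (C := B')
          ltac:(disj) ltac:(disj)
        ltac:(disj) wp (diff_span_mon F hq) wm)).
    rewrite chain_prod_rcons ?(chain_size oe) //.
    have -> : mu (diff_mon F A' p) (chain_prod e ≻ diff_mon F C q) (diff_mon F B' m) =
       chain_prod e ≻ mu (diff_mon F A' p) (diff_mon F C q) (diff_mon F B' m).
      by rewrite !mu_tri (triAC hA) (tri_succ hA) (triAC hA).
    have wq := diff_span_mon F hq.
    have hh := diff_span_mu charF0 (A := A') (B := C) (C := B') ltac:(disj) ltac:(disj)
        ltac:(disj) wp wq wm.
    have ge : chain_span B l (chain_prod e) by apply: lspan_gen; exists e => //; exact:
        chain_weak oe.
    by apply: (chain_span_cast (chain_span_snoc _ ge hh)); first [disj|set_eq|lia].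
  have hh := diff_span_prec charF0 (A := A') (B := B') ltac:(disj) wp wm.
  have ge : chain_span B l (chain_prod e) by apply: lspan_gen; exists e => //; exact:
      chain_weak oe.
  by apply: (chain_span_cast (chain_span_snoc _ ge hh)); first [disj|set_eq|lia].
case: od dAB => {A k d} [A' h p hp _|S k d A' h p od dSA hp _] dAB.
  exact: base.
rewrite chain_prod_rcons ?(chain_size od) // (nz_succ_prec hA).
have ge : chain_span S k (chain_prod d) by apply: lspan_gen; exists d => //; exact:
    chain_weak od.
have hb := base A' p h hp ltac:(disj).
by apply: (chain_span_cast (chain_span_succ _ ge hb)); first [disj|set_eq|lia].
Qed.

Lemma monNZ_chain_span (T : monomial nzop 'I_n) : uniq (leaves T) ->
  chain_span [set a in leaves T] (nprec T) (monNZ F T).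
Proof.
elim: T => [a _|o U IHU V IHV].
  apply: (chain_span_cast (diff_span_chain_span (diff_span_var a))) => //.
  by apply/finset.setP => b; rewrite !inE.
rewrite [leaves _]/= cat_uniq => /and3P[uU /hasPn dUV uV].
have dis : [disjoint [set a in leaves U] & [set a in leaves V]].
  rewrite disjoint_sym disjoint_subset; apply/fintype.subsetP => a; rewrite !inE.
  exact: dUV.
have -> : [set a in leaves U ++ leaves V] =
    [set a in leaves U] :|: [set a in leaves V].
  by apply/finset.setP => a; rewrite !inE mem_cat.
case: o; first exact: chain_span_prec dis (IHU uU) (IHV uV).
exact: chain_span_succ dis (IHU uU) (IHV uV).
Qed.

End Chains.

(** * Coefficients *)

Section Coefficients.
Variables (F : fieldType) (n : nat).
Hypothesis charF0 : [pchar F] =i pred0.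
Implicit Types (A B C S : {set 'I_n}) (m : 'X_{1..n}) (h j k l : nat).
Local Notation NZ := (freeNZ F 'I_n).
Local Notation K := (ratfun F n).
Local Notation "x ≺ y" := (@nz F 'I_n Prec x y) (at level 40, no associativity).
Local Notation "x ≻ y" := (@nz F 'I_n Succ x y) (at level 40, no associativity).
Local Notation X a := (fvar _ a : freeNZ F 'I_n).
Local Notation fX m := (Defs.frac ('X_[m] : {mpoly F[n]})).
Let hA := freeNZ_is_algebra F 'I_n.
Let hP := hA.1 Prec.
Let hS := hA.1 Succ.

Lemma rscale_mull a (c d : K) : (a *: c) * d = a *: (c * d).
Proof. by rewrite /GRing.scale /= /rscale mulrA. Qed.
Lemma rscale_mulr a (c d : K) : c * (a *: d) = a *: (c * d).
Proof. by rewrite /GRing.scale /= /rscale mulrCA. Qed.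

Lemma psumU A B : [disjoint A & B] -> psum F (A :|: B) = psum F A + psum F B.
Proof. move=> dAB; rewrite /psum -rmorphD; congr Defs.frac.
by rewrite -bigU //; apply: eq_bigl => a; rewrite !inE. Qed.

Lemma sumX_neq0 A : A != finset.set0 -> (\sum_(i in A) 'X_i : {mpoly F[n]}) != 0.
Proof.
case/finset.set0Pn => a aA; apply/eqP => /(congr1 (mcoeff U_(a))).
rewrite mcoeff0 raddf_sum /= (bigD1 a) //= mcoeffXU eqxx big1 ?addr0.
  by move/eqP; rewrite oner_eq0.
by move=> b /andP[_ ba]; rewrite mcoeffXU (negPf ba).
Qed.

Lemma psum_neq0 A : A != finset.set0 -> psum F A != 0.
Proof. by move=> A0; rewrite /psum /Defs.frac tofrac_eq0 sumX_neq0. Qed.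

Definition NZmultilinear B k : set NZ := lspan (fun x => exists T,
  [/\ multilinear_on B T, nprec T = k & x = monNZ F T]).

(** The membership is recorded with the value since coefmap is determined only
    on the multilinear component. *)
Definition has_coef B k (x : NZ) (c : K) := NZmultilinear B k x /\ coefmap F B x = c.

Lemma has_coef_cast B k x c B' k' c' : has_coef B k x c -> B = B' -> k = k' -> c = c' ->
  has_coef B' k' x c'.
Proof. by move=> + <- <- <-. Qed.

Lemma has_coef0 B k : has_coef B k 0 0.
Proof. by split; [exact: lspan0 | exact: linear0]. Qed.

Lemma has_coefD B k x y c d : has_coef B k x c -> has_coef B k y d ->
  has_coef B k (x + y) (c + d).
Proof. by move=> [hx <-] [hy <-]; split; [exact: lspanD | rewrite linearD]. Qed.

Lemma has_coefB B k x y c d : has_coef B k x c -> has_coef B k y d ->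
  has_coef B k (x - y) (c - d).
Proof. by move=> [hx <-] [hy <-]; split; [exact: lspanB | rewrite linearB]. Qed.

Lemma has_coef_mon B T : multilinear_on B T -> has_coef B (nprec T) (monNZ F T) (coef F
    T).
Proof. by move=> hT; split; [apply: lspan_gen; exists T | exact: coefmapE]. Qed.

Lemma has_coef_var a : has_coef [set a] 0 (X a) 1.
Proof.
by apply: (has_coef_mon (T := MVar nzop a)); rewrite /multilinear_on enum_set1.
Qed.

Lemma multilinear_set B (T : monomial nzop 'I_n) : multilinear_on B T ->
  [set a in leaves T] = B.
Proof. by move=> hT; apply/finset.setP => a; rewrite inE (perm_mem hT) mem_enum. Qed.

Lemma multilinear_op (O : Type) A B (o : O) (U V : monomial O 'I_n) : [disjoint A & B] ->
  multilinear_on A U -> multilinear_on B V -> multilinear_on (A :|: B) (MOp o U V).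
Proof.
move=> dAB hU hV; apply: uniq_perm; last by
  move=> a; rewrite mem_enum inE mem_cat (perm_mem hU) (perm_mem hV) !mem_enum.
  rewrite cat_uniq (perm_uniq hU) (perm_uniq hV) !enum_uniq andbT /=.
  apply/hasPn => a; rewrite (perm_mem hU) (perm_mem hV) !mem_enum.
  by move=> aB; apply/negP => aA; rewrite (disjointFl dAB aB) in aA.
exact: enum_uniq.
Qed.

Lemma has_coef_bilinear o A B k l k' (phi : K -> K -> K) :
  (forall T U, multilinear_on A T -> nprec T = k ->
     multilinear_on B U -> nprec U = l ->
     has_coef (A :|: B) k' (monNZ F (MOp o T U)) (phi (coef F T) (coef F U))) ->
  bilinear_op phi ->
  forall x y c d, has_coef A k x c -> has_coef B l y d ->
  has_coef (A :|: B) k' (nz o x y) (phi c d).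
Proof.
move=> hop hphi x y c d [hx <-] [hy <-]; have ho := hA.1 o.
split.
  apply: (lspan_bilinear ho) hx hy => _ _ [T [hT kT ->]] [U [hU lU ->]].
  by case: (hop T U hT kT hU lU).
elim/lspan_ind: hx => [|a {}x x' [T [hT kT ->]] IH].
  by rewrite (bil0l ho) !linear0 (bil0l hphi).
rewrite (bilDl ho) (bilZl ho) !linearD !linearZ /= IH (bilDl hphi) (bilZl hphi).
congr (_ *: _ + _); rewrite coefmapE // {IH}.
elim/lspan_ind: hy => [|b {}y y' [U [hU lU ->]] IH].
  by rewrite (bil0r ho) !linear0 (bil0r hphi).
rewrite (bilDr ho) (bilZr ho) !linearD !linearZ /= IH (bilDr hphi) (bilZr hphi).
by congr (_ *: _ + _); rewrite coefmapE //; case: (hop T U hT kT hU lU).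
Qed.

Lemma has_coef_prec A B k l x y c d : [disjoint A & B] ->
  has_coef A k x c -> has_coef B l y d ->
  has_coef (A :|: B) (k + l).+1 (x ≺ y) (psum F B * c * d).
Proof.
move=> dAB; apply: (has_coef_bilinear (phi := fun c d => psum F B * c * d)).
  move=> T U hT <- hU <-; have := has_coef_mon (multilinear_op Prec dAB hT hU).
  by rewrite /= (multilinear_set hU).
split=> z a u v; first by rewrite mulrDr rscale_mulr.
by rewrite mulrDr rscale_mulr mulrDl rscale_mull.
Qed.

Lemma has_coef_succ A B k l x y c d : [disjoint A & B] ->
  has_coef A k x c -> has_coef B l y d ->
  has_coef (A :|: B) (k + l) (x ≻ y) (c * d / psum F A).
Proof.
move=> dAB; apply: (has_coef_bilinear (phi := fun c d => c * d / psum F A)).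
  move=> T U hT <- hU <-; have := has_coef_mon (multilinear_op Succ dAB hT hU).
  by rewrite /= (multilinear_set hT).
split=> z a u v; first by rewrite mulrDr rscale_mulr mulrDl rscale_mull.
by rewrite mulrDl rscale_mull mulrDl rscale_mull.
Qed.

(** The factors p_A + p_B of the two products ≺ cancel the denominator of ≻. *)
Lemma has_coef_mu A B C k l j x y z c d f : A != finset.set0 ->
  [disjoint A & B] -> [disjoint A & C] -> [disjoint B & C] ->
  has_coef A k x c -> has_coef B l y d -> has_coef C j z f ->
  has_coef (A :|: B :|: C) (k + l + j).+1 (mu x y z) (c * d * f).
Proof.
move=> A0 dAB dAC dBC hx hy hz; rewrite /mu.
have hxy : has_coef (A :|: B) (k + l).+1 (x ≺ y + y ≺ x) (psum F (A :|: B) * c * d).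
  rewrite (psumU dAB) [psum F A + _]addrC !mulrDl; apply: has_coefD.
    exact: has_coef_prec.
  have dBA : [disjoint B & A] by disj.
  apply: has_coef_cast (has_coef_prec dBA hy hx) _ _ _.
  - by rewrite finset.setUC.
  - by rewrite addnC.
  - by rewrite -!mulrA [c * d]mulrC.
have dABC : [disjoint A :|: B & C] by disj.
apply: has_coef_cast (has_coef_succ dABC hxy hz) _ _ _ => //.
rewrite -!mulrA mulrC !mulrA mulfVK ?psum_neq0 //.
by apply: contraNneq A0 => /eqP; rewrite finset.setU_eq0 => /andP[].
Qed.

Lemma fracXU m a : fX (m + U_(a))%MM = Defs.frac ('X_a : {mpoly F[n]}) * fX m :> K.
Proof. by rewrite mpolyXD -rmorphM mulrC. Qed.

Lemma psum1 a : psum F [set a] = Defs.frac ('X_a : {mpoly F[n]}).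
Proof. by rewrite /psum big_set1. Qed.

Lemma has_coef_diff_mon h B m : has_defect h B m -> has_coef B (mdeg m + h) (diff_mon F
    B m) (fX m).
Proof.
move=> hm; pose nu B m : (NZ * K)%type := (diff_mon F B m, fX m).
(* The equation says k = mdeg m + h without naming m. *)
pose P h B (v : NZ * K) := forall k, (k + h).+1 = #|B| -> has_coef B k v.1 v.2.
have sum1 (Q : {set 'I_n}) (f : 'I_n -> NZ * K) :
    ((\sum_(a in Q) f a).1 = \sum_(a in Q) (f a).1) *
    ((\sum_(a in Q) f a).2 = \sum_(a in Q) (f a).2).
  by split; [apply: (big_morph fst) | apply: (big_morph snd)].
apply: (diff_mon_ind (nu := nu) (P := P)) (hm) _ _; last by case: hm => _ ->; rewrite
    -addnn addnA.
- by move=> h' B' k _; exact: has_coef0.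
- by move=> h' B' u v hu hv k e; apply: has_coefB; [exact: hu | exact: hv].
- move=> a k; rewrite cards1 addn0 /nu /= diff_mon_var mpolyX0 rmorph1 => -[->].
  exact: has_coef_var.
- move=> h' B' m' a hm' aB IH [|k]; rewrite cardsU1 aB add1n.
    by case: hm' => _ ->; lia.
  rewrite /nu /= -(diff_mon_precr F hm' aB) => e; have hb : has_coef B' k (diff_mon F
      B' m') (fX m') by apply: IH; move: e; rewrite !(addSn, addnS) => -[].
  have dBa : [disjoint B' & [set a]] by disj.
  apply: has_coef_cast (has_coef_prec dBa hb (has_coef_var a)) _ _ _.
  + by rewrite finset.setUC.
  + by rewrite addn0.
  + by rewrite mulr1 psum1 fracXU.
- move=> h' B' m' a hm' aB IH [|k]; rewrite cardsU1 aB add1n.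
    by case: hm' => _ ->; lia.
  move=> e; have hb : has_coef B' k (diff_mon F B' m') (fX m') by apply: IH; move: e;
      rewrite !(addSn, addnS) => -[].
  rewrite !sum1 /nu /= -(diff_mon_precl charF0 hm' aB).
  have dBa : [disjoint [set a] & B'] by disj.
  apply: has_coef_cast (has_coef_prec dBa (has_coef_var a) hb) _ _ _ => //.
  rewrite mulr1 /psum raddf_sum mulr_suml; apply: eq_bigr => b _.
  by rewrite fracXU.
- move=> h' B' m' a b hm' na nb IH [|k]; rewrite !cardsU1 na nb !add1n.
    by case: hm' => _ ->; lia.
  rewrite /nu /= -(diff_mon_mu charF0 hm' na nb) => e; have hb : has_coef B' k
      (diff_mon F B' m') (fX m') by apply: IH; move: e; rewrite !(addSn, addnS) => -[].
  apply: has_coef_cast (has_coef_mu (A := [set a]) (B := [set b]) (C := B') _ _ _ _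
      (has_coef_var a) (has_coef_var b) hb) _ _ _;
    try by [disj|set_eq|lia|rewrite !mul1r].
  by apply/finset.set0Pn; exists a; rewrite inE.
Qed.

End Coefficients.

(** * Coefficients of the chosen elements *)

Section ChosenBlocks.
Variables (F : fieldType) (n : nat).
Hypothesis charF0 : [pchar F] =i pred0.
Implicit Types (A B C S : {set 'I_n}) (m : 'X_{1..n}) (h j k l : nat).
Local Notation NZ := (freeNZ F 'I_n).
Local Notation K := (ratfun F n).
Local Notation "x ≺ y" := (@nz F 'I_n Prec x y) (at level 40, no associativity).
Local Notation "x ≻ y" := (@nz F 'I_n Succ x y) (at level 40, no associativity).
Local Notation X a := (fvar _ a : freeNZ F 'I_n).
Local Notation fX m := (Defs.frac ('X_[m] : {mpoly F[n]})).

Fixpoint prec_monomial (T : monomial unit 'I_n) : monomial nzop 'I_n :=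
  match T with
  | MVar a => MVar nzop a
  | MOp _ U V => MOp Prec (prec_monomial U) (prec_monomial V)
  end.

Lemma leaves_prec T : leaves (prec_monomial T) = leaves T.
Proof. by elim: T => //= _ U -> V ->. Qed.

Lemma size_leaves_gt0 (O : Type) (T : monomial O 'I_n) : (0 < size (leaves T))%N.
Proof. by elim: T => //= _ U IHU V _; rewrite size_cat addn_gt0 IHU. Qed.

Lemma nprec_prec T : (nprec (prec_monomial T)).+1 = size (leaves T).
Proof. by elim: T => //= _ U IHU V IHV; rewrite size_cat -IHU -IHV addSn addnS. Qed.

Lemma nov_to_nz_mon T : nov_to_nz (monNov F T) = monNZ F (prec_monomial T).
Proof.
elim: T => [a|[] U IHU V IHV] /=; first exact: nov_to_nz_var.
rewrite -[RHS]/(nz Prec (monNZ F (prec_monomial U)) (monNZ F (prec_monomial V))).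
by rewrite -IHU -IHV; exact: nov_to_nz_op.
Qed.

Lemma nov_to_nz0 : nov_to_nz (0 : freeNov F 'I_n) = 0.
Proof.
by have := @nov_to_nz_linear F 'I_n (-1) 0 0; rewrite scaler0 addr0 scaleN1r addNr.
Qed.

Lemma nov_to_nz_multilinear C P : NovMultilinear C P ->
  NZmultilinear C #|C|.-1 (nov_to_nz (F := F) P).
Proof.
elim/lspan_ind => [|a x y [T hT ->] IH].
  by rewrite nov_to_nz0; exact: lspan0.
rewrite nov_to_nz_linear; apply: lspanD => //; apply: lspanZ; apply: lspan_gen.
exists (prec_monomial T); split.
- by rewrite /multilinear_on leaves_prec.
- by apply: succn_inj; rewrite nprec_prec (perm_size hT) -cardE prednK // cardE
    -(perm_size hT) size_leaves_gt0.
- exact: nov_to_nz_mon.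
Qed.

(** The induction that generates differential monomials by letters, run on
    coefficients: letters change a coefficient in the same way as they change the
    monomial. Without defect no triple product occurs. *)
Lemma novikov_coef_surj C m : mon_in C m -> #|C| = (mdeg m).+1 ->
  exists P, NovMultilinear C P /\ coefmap F C (nov_to_nz P) = fX m.
Proof.
move=> mC cC; have hm : has_defect 0 C m by split; rewrite ?addn0.
(* nv B v: v is the coefficient of a multilinear Novikov element on B. *)
pose nv B (v : K) := exists P, NovMultilinear B P /\ has_coef B #|B|.-1 (nov_to_nz P) v.
pose P h B v := h = 0%N -> nv B v.
have hN := (freeNov_is_algebra F 'I_n).1 tt.
have nv_lin B a u v : nv B u -> nv B v -> nv B (a *: u + v).
  move=> [p [hp [_ <-]]] [q [hq [_ <-]]]; exists (a *: p + q); split.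
    by apply: lspanD => //; exact: lspanZ.
  split; last by rewrite nov_to_nz_linear linearD linearZ.
  by apply: nov_to_nz_multilinear; apply: lspanD => //; exact: lspanZ.
have nv_prec A B u v : [disjoint A & B] -> nv A u -> nv B v ->
    nv (A :|: B) (psum F B * u * v).
  move=> dAB [p [hp hpu]] [q [hq hqv]]; exists (nov tt p q).
  have hpq : NovMultilinear (A :|: B) (nov tt p q).
    apply: (lspan_bilinear hN) hp hq => _ _ [T hT ->] [U hU ->]; apply: lspan_gen.
    by exists (MOp tt T U) => //; exact: multilinear_op.
  split=> //; split; first exact: nov_to_nz_multilinear.
  rewrite nov_to_nz_op; have [_ <-] := has_coef_prec charF0 dAB hpu hqv.
  by [].
have nv_var a : nv [set a] 1.
  exists (fvar _ a); split; last by rewrite cards1 nov_to_nz_var; exact: has_coef_var.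
  by apply: lspan_gen; exists (MVar unit a) => //; rewrite /multilinear_on enum_set1.
have nv0 B : nv B 0.
  exists 0; split; first exact: lspan0.
  rewrite (_ : nov_to_nz 0 = 0); first exact: has_coef0.
  exact: nov_to_nz0.
have [p [hp [_ ep]]] : nv C (fX m); last by exists p.
apply: (diff_mon_ind (nu := fun B m => fX m) (P := P)) hm _ => //.
- by move=> h B _; exact: nv0.
- move=> h B u v hu hv h0; rewrite addrC -scaleN1r.
  by apply: nv_lin; [exact: hv | exact: hu].
- by move=> a _; rewrite mpolyX0 rmorph1; exact: nv_var.
- move=> h B m' a hm' aB IH h0; rewrite fracXU finset.setUC -psum1 -[fX m']mulr1 mulrA.
  by apply: nv_prec; [disj | exact: IH | exact: nv_var].
- move=> h B m' a hm' aB IH h0.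
  have -> : \sum_(b in B) fX (m' + U_(b))%MM = psum F B * 1 * fX m'.
    rewrite mulr1 /psum raddf_sum mulr_suml; apply: eq_bigr => b _.
    by rewrite fracXU.
  by apply: nv_prec; [disj | exact: nv_var | exact: IH].
Qed.

Lemma has_coef_PC C m : mon_in C m -> #|C| = (mdeg m).+1 ->
  has_coef C (mdeg m) (PC F C m) (fX m).
Proof.
move=> mC cC; rewrite /PC; set Q := (fun _ => _ /\ _).
have [hp ep] : Q (xget 0 Q) by apply: xgetPex; exact: novikov_coef_surj.
by split=> //; have := nov_to_nz_multilinear hp; rewrite cC.
Qed.

Lemma has_coef_Pi C k x (c : K) h (s : seq 'I_n) : C != finset.set0 -> uniq s ->
  (forall a, a \in s -> a \notin C) -> size s = h.*2 -> has_coef C k x c ->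
  has_coef (C :|: [set a in s]) (k + h) (Pi x [seq X a | a <- s]) c.
Proof.
elim: h C k x s => [|h IHh] C k x s C0.
  case: s => // _ _ _ hx; rewrite addn0 /=; apply: has_coef_cast hx _ _ _ => //.
  by apply/finset.setP => a; rewrite !inE orbF.
rewrite doubleS; case: s => [|a [|b s]] us nC => // -[ss] hx.
move: us => /= /and3P[]; rewrite inE negb_or => /andP[ab nas] nbs us.
have aC : a \notin C by apply: nC; rewrite inE eqxx.
have bC : b \notin C by apply: nC; rewrite !inE eqxx orbT.
have d1 : [disjoint C & [set a]] by disj.
have d2 : [disjoint C & [set b]] by disj.
have d3 : [disjoint [set a] & [set b]] by rewrite !disjE.
have hmu := has_coef_mu charF0 C0 d1 d2 d3 hx (has_coef_var charF0 a) (has_coef_var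
    charF0 b).
rewrite !mulr1 in hmu; apply: has_coef_cast (IHh _ _ _ s _ us _ ss hmu) _ _ _ => //.
- by apply: contraNneq C0 => /eqP; rewrite !finset.setU_eq0 -andbA => /andP[].
- move=> d ds; rewrite !inE !negb_or nC ?inE ?ds ?orbT //=.
  by apply/andP; split; [apply: contraNneq nas => <- | apply: contraNneq nbs => <-].
- by apply/finset.setP => d; rewrite !inE; do ?case: (_ == _); rewrite ?orbT ?orbF //=;
    case: (_ \in C).
- by lia.
Qed.

Lemma has_coef_beta (ch : block_choice n) h B m : admissible ch -> has_defect h B m ->
  has_coef B (mdeg m + h) (beta F ch B m) (fX m).
Proof.
move=> adm hm; have [hi cB] := hm.
have B0 : B != finset.set0 by rewrite -card_gt0 cB.
have bm : block_mon B m.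
  by split=> //; rewrite cB subn1 /= ?leq_addr // oddD odd_double addbF.
have [CB cC mC ps] := adm B m B0 bm; rewrite /beta.
set C := (ch B m).1 in CB cC mC ps *; set s := (ch B m).2 in ps *.
have ss : size s = h.*2.
  by rewrite (perm_size ps) -cardE cardsDS // cB cC subSS addKn.
have C0 : C != finset.set0 by rewrite -card_gt0 cC.
have := has_coef_Pi C0 _ _ ss (has_coef_PC mC cC).
rewrite (perm_uniq ps) enum_uniq => /(_ isT).
have -> : C :|: [set a in s] = B.
  apply/finset.setP => a; rewrite !inE (perm_mem ps) mem_enum !inE.
  by case: (boolP (a \in C)) => //= /(fintype.subsetP CB) ->.
by apply=> a; rewrite (perm_mem ps) mem_enum inE => /andP[].
Qed.

(** The last union, which is the whole set, is left out. *)
Fixpoint prefixes A (d : seq ({set 'I_n} * 'X_{1..n})) : seq {set 'I_n} :=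
  if d is p :: d' then
    if d' is [::] then [::] else (A :|: p.1) :: prefixes (A :|: p.1) d'
  else [::].

Definition blocks_fun d : K :=
  (\prod_(p <- d) fX p.2) / \prod_(I <- prefixes finset.set0 d) psum F I.

Lemma prefixes_rcons A d p : (0 < size d)%N ->
  prefixes A (rcons d p) = rcons (prefixes A d) (A :|: \bigcup_(q <- d) q.1).
Proof.
elim: d A => // q [|q' d] IHd A _; first by rewrite /= big_seq1.
have -> : prefixes A (rcons [:: q, q' & d] p) =
  (A :|: q.1) :: prefixes (A :|: q.1) (rcons (q' :: d) p) by [].
by rewrite IHd // [in RHS]big_cons finset.setUA.
Qed.

Lemma chain_cover b S k d : is_chain b S k d -> \bigcup_(q <- d) q.1 = S.
Proof.
elim=> {b S k d} [b B h m _ _|b S k d B h m _ IH _ _ _]; first by rewrite big_seq1.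
by rewrite -cats1 big_cat /= big_seq1 IH.
Qed.

Lemma has_coef_bracket (f : {set 'I_n} -> 'X_{1..n} -> NZ) b S k d :
  (forall h B m, has_defect h B m -> has_coef B (mdeg m + h) (f B m) (fX m)) ->
  is_chain b S k d -> has_coef S k (bracket [seq f p.1 p.2 | p <- d]) (blocks_fun d).
Proof.
move=> hf; elim=> {b S k d} [b B h m hm _|b S k d B h m od IH dSB hm _].
  by rewrite /blocks_fun /= big_seq1 big_nil invr1 mulr1; exact: hf.
have sd := chain_size od.
have -> : bracket [seq f p.1 p.2 | p <- rcons d (B, m)] =
    bracket [seq f p.1 p.2 | p <- d] ≻ f B m.
  by case: d sd {od IH} => // p d _; rewrite map_rcons /= foldl_rcons.
apply: has_coef_cast (has_coef_succ charF0 dSB IH (hf _ _ _ hm)) _ _ _ => //.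
rewrite /blocks_fun prefixes_rcons // finset.set0U (chain_cover od) -!cats1 !big_cat /=.
by rewrite !big_seq1 invfM mulrACA mulrA.
Qed.

End ChosenBlocks.

(** * Independence of the rational functions *)

Section Independence.
Variables (F : fieldType) (n : nat).
Implicit Types (A B C I J S : {set 'I_n}) (m k : 'X_{1..n}).
Local Notation R := {mpoly F[n]}.
Local Notation chain := (seq ({set 'I_n} * 'X_{1..n})).

(** No variable of S occurs in f. *)
Definition free_of S (f : R) := forall k i, i \in S -> k i != 0%N -> f@_k = 0.

Lemma free_ofS S S' f : S' \subset S -> free_of S f -> free_of S' f.
Proof. by move=> /fintype.subsetP SS hf k i /SS; exact: hf. Qed.

Lemma free_of_sum S (T : eqType) (s : seq T) (P : pred T) (f : T -> R) :
  (forall d, d \in s -> P d -> free_of S (f d)) -> free_of S (\sum_(d <- s | P d) f d).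
Proof.
move=> h k i iS ki; rewrite raddf_sum big_seq_cond big1 // => d /andP[ds Pd].
exact: h ds Pd k i iS ki.
Qed.

Lemma free_of_mul S f g : free_of S f -> free_of S g -> free_of S (f * g).
Proof.
move=> hf hg k i iS ki; rewrite mcoeffM big1 // => k2 /eqP ek.
have ei := congr1 (fun m : 'X_{1..n} => m i) ek.
move: ki; rewrite /= in ei; rewrite ei mnmDE addn_eq0 negb_and => /orP[h|h].
  by rewrite (hf _ _ iS h) mul0r.
by rewrite (hg _ _ iS h) mulr0.
Qed.

Lemma free_ofX S m : (forall i, i \in S -> m i = 0%N) -> free_of S 'X_[m].
Proof.
move=> hm k i iS ki; rewrite mcoeffX; case: eqP => // e.
by move: ki; rewrite -e hm.
Qed.

(** The terms do not interfere: the part of an exponent that lies in S tells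
    which one of the monomials it comes from. *)
Lemma monomials_indep S (T : eqType) (s : seq T) (mu : T -> 'X_{1..n}) (a : T -> R) :
  uniq s -> {in s &, injective mu} -> (forall d, d \in s -> mon_in S (mu d)) ->
  (forall d, d \in s -> free_of S (a d)) ->
  \sum_(d <- s) a d * 'X_[mu d] = 0 -> forall d, d \in s -> a d = 0.
Proof.
move=> us imu hmu ha e0 d0 d0s; apply/mpolyP => k; rewrite mcoeff0.
have [/existsP[i /andP[iS ki]]|/existsPn hk] := boolP [exists i, (i \in S) && (k i !=
    0%N)].
  exact: ha iS ki.
have {hk} hk i : i \in S -> k i = 0%N.
  by move=> iS; have := hk i; rewrite iS /= negbK => /eqP.
(* The coefficient of this exponent in the relation is that of k in a d0. *)
have := congr1 (mcoeff (mu d0 + k)%MM) e0; rewrite mcoeff0 (big_rem d0) //=.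
rewrite mcoeffD mcoeffMX raddf_sum big1_seq ?addr0 // => d /andP[_ dd].
have ds : d \in s := mem_rem dd.
have nd : d != d0 by move: dd; rewrite mem_rem_uniq // inE => /andP[].
rewrite /= mcoeffM big1 // => k2 /eqP ek; rewrite mcoeffX.
case: eqP => [e|_]; last by rewrite mulr0.
have [/existsP[i /andP[iS ki]]|/existsPn h2] := boolP [exists i, (i \in S) && ((val
    k2.1 : 'X_{1..n}) i != 0%N)].
  by rewrite (ha d ds _ i iS ki) mul0r.
have {}h2 i : i \in S -> (val k2.1 : 'X_{1..n}) i = 0%N.
  by move=> iS; have := h2 i; rewrite iS /= negbK => /eqP.
case/eqP: nd; apply: imu => //; apply/mnmP => i.
have [iS|iS] := boolP (i \in S).
  have := congr1 (fun m : 'X_{1..n} => m i) ek.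
  by rewrite !mnmDE hk // h2 // addn0 add0n e.
by rewrite (mon_in_notin (hmu d ds) iS) (mon_in_notin (hmu d0 d0s) iS).
Qed.

Implicit Types (d : chain).

Lemma disjD A B : [disjoint A :\: B & B].
Proof. by rewrite disjoint_subset; apply/fintype.subsetP => b; rewrite !inE => /andP[].
    Qed.

Definition var_sum A : R := \sum_(i in A) 'X_i.

Lemma mcoeff_var_sum A i : (var_sum A)@_U_(i) = (i \in A)%:R.
Proof.
rewrite /var_sum raddf_sum /=; have [iA|iA] := boolP (i \in A).
  rewrite (bigD1 i) //= mcoeffXU eqxx big1 ?addr0 // => j /andP[_ ji].
  by rewrite mcoeffXU (negPf ji).
rewrite big1 // => j jA; rewrite mcoeffXU; case: eqP => // e.
by move: iA; rewrite -e jA.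
Qed.

Lemma var_sum_inj A B : var_sum A = var_sum B -> A = B.
Proof.
move=> e; apply/finset.setP => i; have := congr1 (mcoeff U_(i)) e.
rewrite !mcoeff_var_sum; case: (i \in A); case: (i \in B) => // /eqP.
  by rewrite oner_eq0.
by rewrite eq_sym oner_eq0.
Qed.

Lemma var_sum0 : var_sum finset.set0 = 0. Proof. by rewrite /var_sum big_set0. Qed.

Lemma var_sumU A B : [disjoint A & B] -> var_sum (A :|: B) = var_sum A + var_sum B.
Proof.
by move=> dAB; rewrite /var_sum -bigU //; apply: eq_bigl => a; rewrite !inE.
Qed.

Section Residue.
Variables (I : {set 'I_n}) (a : 'I_n).
Hypothesis aI : a \in I.

(** Restriction to the hyperplane where the variables of I sum to zero; a is
    the variable that is eliminated. *)
Definition residue (f : R) : R :=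
  f \mPo [tuple if i == a then - var_sum (I :\ a) else 'X_i | i < n].

HB.instance Definition _ := GRing.RMorphism.copy residue
  (comp_mpoly [tuple if i == a then - var_sum (I :\ a) else 'X_i | i < n]).

Lemma residueM f g : residue (f * g) = residue f * residue g.
Proof. exact: (rmorphM (residue : {rmorphism R -> R})). Qed.

Lemma residue0 : residue 0 = 0.
Proof. exact: (rmorph0 (residue : {rmorphism R -> R})). Qed.

Lemma residue_prod (T : finType) (P : pred T) (f : T -> R) :
  residue (\prod_(i | P i) f i) = \prod_(i | P i) residue (f i).
Proof. exact: (rmorph_prod (residue : {rmorphism R -> R})). Qed.

Lemma residue_sum (T : eqType) (r : seq T) (P : pred T) (f : T -> R) :
  residue (\sum_(i <- r | P i) f i) = \sum_(i <- r | P i) residue (f i).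
Proof. exact: (rmorph_sum (residue : {rmorphism R -> R})). Qed.

Lemma residueX i : residue 'X_i = if i == a then - var_sum (I :\ a) else 'X_i.
Proof. by rewrite /residue comp_mpolyXU -tnth_nth tnth_mktuple. Qed.

Lemma residue_id f : free_of [set a] f -> residue f = f.
Proof.
move=> hf; rewrite /residue comp_mpolyE [RHS]mpolyE; apply: eq_big_seq => m ms.
congr (_ *: _); rewrite mpolyXE_id; apply: eq_bigr => i _.
rewrite tnth_mktuple; case: eqP => // ->.
suff -> : m a = 0%N by rewrite !expr0.
apply/eqP; apply: contraTT ms => ma; rewrite -mcoeff_eq0; apply/eqP.
by apply: hf ma; rewrite inE.
Qed.

Lemma residue_var_sum J : residue (var_sum J) = if a \in J then var_sum J - var_sum I
    else var_sum J.
Proof.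
rewrite {1}/var_sum rmorph_sum /=.
have h (Q : {set 'I_n}) : a \notin Q -> \sum_(i in Q) residue 'X_i = var_sum Q.
  move=> aQ; apply: eq_bigr => i iQ; rewrite residueX ifN //.
  by apply: contraNneq aQ => <-.
case: ifPn => aJ; last exact: h.
rewrite (big_setD1 a aJ) /= residueX eqxx h ?finset.setD11 //.
by rewrite /var_sum (big_setD1 a aJ) /= (big_setD1 a aI) /= opprD addrACA subrr add0r
    addrC.
Qed.

Lemma residue_var_sum_eq0 : residue (var_sum I) = 0.
Proof. by rewrite residue_var_sum aI subrr. Qed.

Lemma residue_var_sum_neq0 J : J != finset.set0 -> J != I -> residue (var_sum J) != 0.
Proof.
move=> J0 JI; rewrite residue_var_sum; case: ifP => _.
  by rewrite subr_eq0; apply: contra_neq JI => /var_sum_inj.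
by rewrite -var_sum0; apply: contra_neq J0 => /var_sum_inj.
Qed.

Lemma residue_var_sumU J : [disjoint I & J] -> residue (var_sum (I :|: J)) = var_sum J.
Proof. by move=> dIJ; rewrite residue_var_sum inE aI /= (var_sumU dIJ) addrC addKr. Qed.
End Residue.

(** The blocks of a chain, peeled off from the left, in
    the order in which their poles are examined. *)
Fixpoint lchain S d : Prop :=
  if d is p :: d' then
    if d' is [::] then p.1 = S /\ mon_in S p.2 else
    [/\ p.1 \proper S, p.1 != finset.set0, mon_in (drop_max p.1) p.2
      & lchain (S :\: p.1) d']
  else False.

(** The function of the chain times the sums over all nonempty proper subsets
    of S. *)
Definition cleared S d : R :=
  (\prod_(p <- d) 'X_[p.2]) *
  \prod_(J : {set 'I_n} | [&& J \subset S, J != finset.set0, J != S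
                             & J \notin prefixes finset.set0 d]) var_sum J.

Lemma prefixesU A C d : prefixes (A :|: C) d = [seq A :|: J | J <- prefixes C d].
Proof.
elim: d C => // p [|q d] IHd C //.
rewrite [LHS]/= [prefixes C _]/= map_cons -finset.setUA; congr cons.
exact: IHd.
Qed.

Lemma lchain_prefixes S d J : lchain S d -> J \in prefixes finset.set0 d ->
  (head (finset.set0, 0%MM) d).1 \subset J /\ J \proper S.
Proof.
elim: d S J => // p [|q d] IHd S J //.
have -> : prefixes finset.set0 (p :: q :: d) =
    p.1 :: [seq p.1 :|: J | J <- prefixes finset.set0 (q :: d)].
  by rewrite -prefixesU finset.setU0 /= finset.set0U.
move=> [pS p0 _ od]; rewrite inE => /orP[/eqP ->|]; first by split.
case/mapP => J' hJ' ->; have [_ J'S] := IHd _ _ od hJ'.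
split; first exact: finset.subsetUl.
rewrite finset.properEneq finset.subUset (proper_sub pS).
rewrite (fintype.subset_trans (proper_sub J'S)) ?finset.subsetDl // !andbT.
apply: contraTneq J'S => e; rewrite -e properE negb_and; apply/orP; right.
by rewrite negbK finset.setDUl finset.setDv finset.set0U finset.subsetDl.
Qed.

Lemma prefixes_cons I m d : d != [::] ->
  prefixes finset.set0 ((I, m) :: d) = I :: [seq I :|: J | J <- prefixes finset.set0 d].
Proof. by case: d => // q d _; rewrite -prefixesU finset.setU0 /= finset.set0U. Qed.

Lemma lchain_cons S I m d : d != [::] -> lchain S ((I, m) :: d) ->
  [/\ I \proper S, I != finset.set0, mon_in (drop_max I) m & lchain (S :\: I) d].
Proof. by case: d. Qed.

Lemma lchain_mon S d p : lchain S d -> p \in d -> mon_in S p.2.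
Proof.
elim: d S p => [//|[I m] d IHd] S p.
have [->|d0] := eqVneq d [::].
  by move=> /= [_ hm]; rewrite inE => /eqP ->.
move=> /(lchain_cons d0)[IS _ hm od]; rewrite inE => /orP[/eqP ->|pd] a /=.
  by move/hm; rewrite inE => /andP[aI _]; exact: (fintype.subsetP (proper_sub IS)).
by move/(IHd _ _ od pd); rewrite inE => /andP[].
Qed.

(** On the hyperplane where the sum over I vanishes, the sum over I :|: J is the
    sum over J, so what remains is the function of the rest of the chain, up to a
    factor that depends on I only. *)
Lemma residue_cleared_cons S I m d a : d != [::] -> lchain S ((I, m) :: d) -> a \in I
    -> m a = 0%N ->
  residue I a (cleared S ((I, m) :: d)) =
    'X_[m] * cleared (S :\: I) d *
    \prod_(J : {set 'I_n} | [&& J \subset S, J != finset.set0, J != S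
                               & ~~ (I \subset J)]) residue I a (var_sum J).
Proof.
move=> d0 od aI ma; have [IS I0 _ od'] := lchain_cons d0 od.
have disIJ J : J \subset S :\: I -> [disjoint I & J].
  by rewrite finset.subsetD disjoint_sym => /andP[].
rewrite /cleared residueM residue_prod big_cons residueM -!mulrA; congr (_ * _).
  by rewrite residue_id //; apply: free_ofX => i; rewrite inE => /eqP ->.
congr (_ * _).
  rewrite residue_id // big_seq; apply: (big_ind (free_of [set a])).
  - by rewrite -mpolyX0; apply: free_ofX => i; rewrite mnm0E.
  - exact: free_of_mul.
  - move=> p pd; apply: free_ofX => i; rewrite inE => /eqP ->.
    by apply: mon_in_notin (lchain_mon od' pd) _; rewrite inE aI.
rewrite (bigID (fun J : {set 'I_n} => I \subset J)); congr (_ * _); last first.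
  apply: eq_bigl => J; rewrite -!andbA; do 3!congr andb.
  case IJ: (I \subset J); rewrite ?andbF ?andbT //=.
  by apply/negP => /(lchain_prefixes od)[]; rewrite /= IJ.
rewrite prefixes_cons // (reindex_onto (fun J => I :|: J) (fun J => J :\: I)) /=; last
    first.
  move=> J /andP[_ /fintype.subsetP IJ]; apply/finset.setP => b; rewrite !inE.
  by case: (boolP (b \in I)) => //= /IJ ->.
apply: eq_big => [J|J].
  have UJ : I :|: J == finset.set0 = false by rewrite finset.setU_eq0 (negPf I0).
  rewrite inE finset.subsetUl andbT UJ finset.subUset (proper_sub IS) /=.
  rewrite finset.subsetD; have [dJI|nJI] := boolP [disjoint J & I]; last first.
    rewrite andbF /=; apply: contraNF nJI => /andP[_ /eqP <-].
    exact: disjD.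
  have UK (Q : {set _}) : [disjoint Q & I] -> (I :|: Q) :\: I = Q.
    by move=> dQI; rewrite finset.setDUl finset.setDv finset.set0U; apply/finset.setDidPl.
  rewrite UK // eqxx !andbT; congr andb; rewrite negb_or andbCA; congr [&& _, _ & _].
  - have [->|J0] := eqVneq J finset.set0; first by rewrite finset.setU0 eqxx.
    by apply: contraNneq J0 => e; rewrite -(UK J dJI) e finset.setDv.
  - congr negb; apply/eqP/eqP => [<-|->]; first by rewrite UK.
    apply/finset.setP => b; rewrite !inE; case: (boolP (b \in I)) => //= bI.
    by rewrite (fintype.subsetP (proper_sub IS)).
  - congr negb; apply/mapP/idP => [[J' hJ' e]|hJ]; last by exists J.
    have [_ /proper_sub] := lchain_prefixes od' hJ'; rewrite finset.subsetD => /andP[_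
        dJ'].
    by rewrite -(UK J dJI) e UK.
by move=> /andP[/andP[/and4P[_ _ _ _] _] /eqP e]; rewrite residue_var_sumU // -e
    disjoint_sym disjD.
Qed.

Let first_set d := (head (finset.set0, 0%MM) d).1.
Let first_mon d := (head (finset.set0, 0%MM) d).2 : 'X_{1..n}.

Lemma lchain_head S d : lchain S d ->
  first_set d = S /\ d = [:: (S, first_mon d)] /\ mon_in S (first_mon d) \/
  [/\ d = (first_set d, first_mon d) :: behead d, behead d != [::], first_set d \proper S,
     first_set d != finset.set0 & mon_in (drop_max (first_set d)) (first_mon d) /\
         lchain (S :\: first_set d) (behead d)].
Proof.
case: d => // -[I m] [|q d]; first by move=> [/= -> hm]; left.
by move=> /(lchain_cons (isT : q :: d != [::]))[IS I0 hm od]; right.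
Qed.

Lemma prod_var_sum_neq0 (P : pred {set 'I_n}) :
  (forall J, P J -> J != finset.set0) -> \prod_(J | P J) var_sum J != 0.
Proof.
move=> hP; apply/prodf_neq0 => J /hP; rewrite -var_sum0.
by apply: contra_neq => /var_sum_inj.
Qed.

(** The sum over I is still a factor, as it is no denominator of the chain. *)
Lemma residue_cleared0 S I a d : a \in I -> I \subset S -> I != S ->
  I \notin prefixes finset.set0 d -> residue I a (cleared S d) = 0.
Proof.
move=> aI IS nIS nd; have I0 : I != finset.set0 by apply/finset.set0Pn; exists a.
rewrite /cleared residueM residue_prod (bigD1 I) ?IS ?I0 ?nIS //= residue_var_sum_eq0 //.
by rewrite mul0r mulr0.
Qed.

(** Let I be the smallest of the first sets of the chains with nonzero
    coefficient. A chain that has I among its sets starts inside I, hence with I: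
    only these chains have a pole along the hyperplane of I. Restricting to it
    leaves a relation between the rests of these chains, on the complement of I,
    whose coefficients are polynomials in the variables of I; to those
    monomials_indep applies, since the first block avoids the variable that is
    eliminated. Coefficients free of S, rather than constants, make the induction
    work. *)
Lemma cleared_indep N S (s : seq chain) (a : chain -> R) : (#|S| < N)%N -> uniq s ->
  (forall d, d \in s -> lchain S d) -> (forall d, d \in s -> free_of S (a d)) ->
  \sum_(d <- s) a d * cleared S d = 0 -> forall d, d \in s -> a d = 0.
Proof.
elim: N S s a => // N IHN S s a cS us oks nva e0.
suff claim t d : d \in s -> (#|first_set d| < t)%N -> a d = 0 by move=> d ds; exact:
    claim ds _.
elim: t d => // t IHt d0 d0s; rewrite ltnS leq_eqVlt => /orP[/eqP ct|]; last exact: IHt.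
(* First case: the smallest first set is S itself, so no poles are left. *)
case: (lchain_head (oks d0 d0s)) => [[hS _]|[e1 e2 IS I0 [hm0 _]]].
  pose s1 := [seq d <- s | first_set d == S].
  have d01 : d0 \in s1 by rewrite mem_filter hS eqxx.
  have hs1 d : d \in s1 -> d = [:: (S, first_mon d)] /\ mon_in S (first_mon d).
    rewrite mem_filter => /andP[/eqP hd1 /oks/lchain_head[[_ h]|[_ _ + _ _]]] //.
    by rewrite hd1 fintype.properxx.
  apply: (monomials_indep (S := S) (mu := first_mon) (filter_uniq _ us) _ _ _ _ d01).
  - by move=> d d' /hs1[ed _] /hs1[ed' _] em; rewrite ed ed' em.
  - by move=> d /hs1[].
  - by move=> d; rewrite mem_filter => /andP[_]; exact: nva.
  set Pi := \prod_(J : {set 'I_n} | [&& J \subset S, J != finset.set0 & J != S])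
      var_sum J.
  have Pi0 : Pi != 0 by apply: prod_var_sum_neq0 => J /and3P[].
  (* The chains that start with a smaller set have coefficient 0. *)
  apply: (mulIf Pi0); rewrite mul0r -[RHS]e0 mulr_suml.
  rewrite big_filter big_mkcond; apply: eq_big_seq => d ds; case: eqP => [hdS|/eqP hdS].
    have ds1 : d \in s1 by rewrite mem_filter hdS eqxx.
    have [ed _] := hs1 d ds1; rewrite -mulrA; congr (_ * _).
    rewrite [in RHS]ed /cleared big_seq1; congr (_ * _).
    by apply: eq_bigl => J; rewrite andbT.
  rewrite IHt ?mul0r // -ct hS proper_card //.
  by case: (lchain_head (oks d ds)) => [[hh _]|[]] //; rewrite hh eqxx in hdS.
set I := first_set d0 in ct e1 IS I0 hm0.
have [b bI eb] : exists2 b, b \in I & drop_max I = I :\ b.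
  by apply: exists_max; rewrite card_gt0.
have IsS := proper_sub IS; have IneS := proper_neq IS.
pose s1 := [seq d <- s | first_set d == I].
have d01 : d0 \in s1 by rewrite mem_filter eqxx.
have hs1 d : d \in s1 -> [/\ d \in s, d = (I, first_mon d) :: behead d, behead d != [::],
    mon_in (drop_max I) (first_mon d) & lchain (S :\: I) (behead d)].
  rewrite mem_filter => /andP[/eqP hdI ds].
  case: (lchain_head (oks d ds)) => [[hS _]|]; last by rewrite hdI => -[? ? ? ? []].
  by rewrite -hdI hS fintype.properxx in IS.
have hs1I d : d \in s1 -> mon_in I (first_mon d).
  by case/hs1 => _ _ _ + _; apply: mon_inS; rewrite eb finset.subsetDl.
pose C := \prod_(J : {set 'I_n} | [&& J \subset S, J != finset.set0, J != S
                               & ~~ (I \subset J)]) residue I b (var_sum J).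
have C0 : C != 0.
  apply/prodf_neq0 => J /and4P[_ J0 _ IJ]; apply: residue_var_sum_neq0 => //.
  by apply: contraNneq IJ => ->.
have e3 : \sum_(d <- s1) a d * 'X_[first_mon d] * cleared (S :\: I) (behead d) = 0.
  apply: (mulIf C0); rewrite mul0r mulr_suml.
  have := congr1 (residue I b) e0; rewrite residue_sum.
  rewrite residue0.
  move=> er; rewrite -[RHS]er big_filter big_mkcond; apply: eq_big_seq => d ds.
  rewrite residueM; case: eqP => [hdI|/eqP hdI].
    have ds1 : d \in s1 by rewrite mem_filter hdI eqxx.
    have [_ ed dn hm od] := hs1 d ds1.
    rewrite residue_id; last by apply: free_ofS (nva d ds); rewrite finset.sub1set
        (fintype.subsetP IsS).
    rewrite -2!(mulrA (a d)); congr (_ * _); rewrite [in RHS]ed residue_cleared_cons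
        -?ed //.
      exact: oks.
    by apply: mon_in_notin hm _; rewrite eb !inE eqxx.
  have [hdt|hdt] := ltnP #|first_set d| t.
    by rewrite IHt // residue0 mul0r.
  (* A first set inside I that is not smaller than I would be I. *)
  rewrite residue_cleared0 ?mulr0 //; apply/negP => /(lchain_prefixes (oks d ds))[hI _].
  case/negP: hdI; rewrite eqEcard hI /=.
  by rewrite ct.
(* The chains are grouped by their tails. *)
pose s2 := undup [seq behead d | d <- s1].
pose a2 t := \sum_(d <- s1 | behead d == t) a d * 'X_[first_mon d].
have a20 : forall t', t' \in s2 -> a2 t' = 0.
  apply: (IHN (S :\: I)).
  - have I1 : (0 < #|I|)%N by rewrite card_gt0.
    have IS1 := subset_leq_card IsS; rewrite cardsDS //.
    by move: cS I1 IS1; case: #|I| #|S| => [|i] [|j] //; rewrite subSS ltnS => h _ _;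
        exact: leq_ltn_trans (leq_subr _ _) h.
  - exact: undup_uniq.
  - by move=> t'; rewrite mem_undup => /mapP[d /hs1[_ _ _ _ od] ->].
  - move=> t' _; apply: free_of_sum => d ds1 _; have [ds _ _ _ _] := hs1 d ds1.
    apply: free_of_mul; first by apply: free_ofS (nva d ds); exact: finset.subsetDl.
    apply: free_ofX => i; rewrite inE => /andP[iI _]; exact: mon_in_notin (hs1I d ds1) iI.
  rewrite -[RHS]e3; under eq_bigr => t' _ do rewrite /a2 mulr_suml.
  rewrite (exchange_big_dep xpredT) //=; apply: eq_big_seq => d ds1.
  have hb : behead d \in s2 by rewrite mem_undup map_f.
  rewrite big_mkcond (bigD1_seq (behead d)) ?undup_uniq //= eqxx big1 ?addr0 //.
  by move=> t' /negPf; rewrite eq_sym => ->.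
have := a20 (behead d0); rewrite mem_undup map_f // => /(_ isT).
rewrite /a2 -big_filter => e4.
apply: (monomials_indep (S := I) (mu := first_mon) _ _ _ _ e4).
- by rewrite !filter_uniq.
- move=> d d'; rewrite mem_filter => /andP[/eqP bd ds].
  rewrite mem_filter => /andP[/eqP bd' ds'] emu.
  have [_ -> _ _ _] := hs1 d ds; have [_ -> _ _ _] := hs1 d' ds'.
  by rewrite emu bd bd'.
- by move=> d; rewrite mem_filter => /andP[_]; exact: hs1I.
- move=> d; rewrite mem_filter => /andP[_ ds]; have [ds' _ _ _ _] := hs1 d ds.
  exact: free_ofS IsS (nva d ds').
- by rewrite mem_filter eqxx.
Qed.

End Independence.

(** * Chain data as lists of blocks *)

Section ChainData.
Variables (F : fieldType) (n : nat).
Implicit Types (A B C J S : {set 'I_n}) (m : 'X_{1..n}) (h k : nat).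
Local Notation chain := (seq ({set 'I_n} * 'X_{1..n})).
Local Notation p0 := (finset.set0 : {set 'I_n}, 0%MM : 'X_{1..n}).
Implicit Types (d : chain) (Is : seq {set 'I_n}) (Ms : seq 'X_{1..n}).

Lemma has_defect_block_mon h B m : has_defect h B m -> block_mon B m.
Proof.
by move=> [hi cB]; split=> //; rewrite cB subn1 /= ?leq_addr // oddD odd_double addbF.
Qed.

Lemma block_mon_has_defect B m : B != finset.set0 -> block_mon B m -> exists h,
    has_defect h B m.
Proof.
rewrite -card_gt0 => B0 [hi dB pB]; exists (#|B| - 1 - mdeg m)./2; split=> //.
have oX : odd (#|B| - 1 - mdeg m) = false by rewrite oddB // pB addbb.
have := odd_double_half (#|B| - 1 - mdeg m); rewrite oX add0n => ->.
by rewrite subnKC // subn1 prednK.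
Qed.

Lemma chain_last b S k d : is_chain b S k d -> b -> mon_in (drop_max (last p0 d).1)
    (last p0 d).2.
Proof. by case=> [B h m _|{}S {}k {}d B h m _ _ _] //; rewrite last_rcons. Qed.

Lemma chain_neq0 b S k d p : is_chain b S k d -> p \in d -> p.1 != finset.set0.
Proof.
elim=> {b S k d} [b B h m [_ cB] _|b S k d B h m _ IH _ [_ cB] _].
  by rewrite inE => /eqP ->; rewrite -card_gt0 cB.
by rewrite mem_rcons inE => /orP[/eqP ->|/IH //]; rewrite -card_gt0 cB.
Qed.

Lemma lchain_rcons S d B m : lchain S d -> (forall p, p \in d -> p.1 != finset.set0) ->
  mon_in (drop_max (last p0 d).1) (last p0 d).2 ->
  [disjoint S & B] -> B != finset.set0 -> mon_in B m -> lchain (S :|: B) (rcons d (B, m)).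
Proof.
move=> + + + + B0 hm; elim: d S => // p [|q d] IHd S.
  move=> [pS _] /(_ p (mem_head _ _)) p1 hp dSB /=; rewrite pS in p1 hp *.
  have eB : (S :|: B) :\: S = B.
    apply/finset.setP => a; rewrite !inE.
    by have [aS|] := boolP (a \in S); rewrite ?(disjointFr dSB aS).
  rewrite eB; split=> //.
  rewrite finset.properUl //; apply: contraNN B0 => BS.
  by rewrite -finset.subset0 -(disjoint_setI0 dSB) finset.subsetI BS fintype.subxx.
move=> [pS p1 hp od] hne hl dSB; rewrite rcons_cons /=.
have [r [s ers]] : exists r s, rcons (q :: d) (B, m) = r :: s by exists q, (rcons d (B,
    m)).
have dsub : [disjoint S :\: p.1 & B].
  by apply: fintype.disjointWl dSB; exact: finset.subsetDl.
have := IHd _ od (fun r rd => hne r (mem_behead (s := p :: q :: d) rd)) hl dsub.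
have -> : (S :\: p.1) :|: B = (S :|: B) :\: p.1.
  rewrite finset.setDUl; congr (_ :|: _); apply/esym/finset.setDidPl.
  rewrite disjoint_sym; apply: fintype.disjointWl dSB; exact: proper_sub.
by move=> o; split=> //; apply: proper_sub_trans pS (finset.subsetUl _ _).
Qed.

Lemma chain_lchain b S k d : is_chain b S k d -> lchain S d.
Proof.
elim=> {b S k d} [b B h m [hi _] _|b S k d B h m od IH dSB [hi cB] _]; first by split.
apply: lchain_rcons => //; last by rewrite -card_gt0 cB.
  by move=> p; exact: chain_neq0 od.
exact: chain_last od isT.
Qed.

Definition sblocks S Is := pairmap (fun A A' => A' :\: A) finset.set0 (rcons Is S).

Lemma pairmap_rcons (T U : Type) (f : T -> T -> U) x s y :
  pairmap f x (rcons s y) = rcons (pairmap f x s) (f (last x s) y).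
Proof. by elim: s x => //= z s IHs x; rewrite IHs. Qed.

Lemma sblocks_rcons S J Is : sblocks S (rcons Is J) = rcons (sblocks J Is) (S :\: J).
Proof. by rewrite /sblocks pairmap_rcons last_rcons. Qed.

Lemma size_sblocks S Is : size (sblocks S Is) = (size Is).+1.
Proof. by rewrite size_pairmap size_rcons. Qed.

Definition chain_path S Is :=
  path (fun A A' : {set 'I_n} => A \proper A') finset.set0 (rcons Is S).

Definition chain_blocks b S Is Ms := forall s, (s <= size Is)%N ->
  block_mon (nth finset.set0 (sblocks S Is) s) (nth 0%MM Ms s) /\
  (b || (s < size Is)%N ->
     mon_in (drop_max (nth finset.set0 (sblocks S Is) s)) (nth 0%MM Ms s)).

(** Induction on the last set: it splits off the last block, as in the
    definition of chains. *)
Lemma chain_of_data b S Is Ms : chain_path S Is -> size Ms = (size Is).+1 ->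
  chain_blocks b S Is Ms ->
  exists k, [/\ is_chain b S k (zip (sblocks S Is) Ms),
    prefixes finset.set0 (zip (sblocks S Is) Ms) = Is
    & (\sum_(m <- Ms) mdeg m + #|S| = 2 * k + size Is + 1)%N].
Proof.
elim/last_ind: Is b S Ms => [|Is J IHI] b S.
  case=> [|m [|? ?]] // /andP[S0 _] _ /(_ 0%N isT).
  rewrite /= finset.setD0 orbF => -[bm hb].
  have [|h hm] := block_mon_has_defect _ bm.
    by apply: contraTneq S0 => ->; rewrite properE fintype.subxx.
  exists (mdeg m + h)%N; split; [exact: chain1 | by [] |].
  by rewrite big_seq1; case: hm => _ ->; lia.
elim/last_ind => // Ms m _; rewrite /chain_path rcons_path last_rcons => /andP[pJ JS].
rewrite !size_rcons => -[sM] hbl.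
have [|k [oJ pu e]] := IHI true J Ms pJ sM.
  move=> s sI; have [|] := hbl s; first by rewrite size_rcons leqW.
  rewrite size_rcons sblocks_rcons !nth_rcons size_sblocks sM ltnS sI.
  by move=> b1 b2; split=> // _; apply: b2; rewrite orbT.
have [] := hbl (size Is).+1; first by rewrite size_rcons.
rewrite size_rcons ltnn orbF sblocks_rcons !nth_rcons size_sblocks sM ltnn eqxx.
move=> bm hb; have JS1 := proper_sub JS.
have [|h hm] := block_mon_has_defect _ bm.
  by move: JS; rewrite properE finset.setD_eq0 => /andP[].
have eS : J :|: (S :\: J) = S.
  by apply/finset.setP => a; rewrite !inE; case: (boolP (a \in J)) => //=
      /(fintype.subsetP JS1) ->.
have dJ : [disjoint J & S :\: J] by rewrite disjoint_sym disjD.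
have ez : zip (rcons (sblocks J Is) (S :\: J)) (rcons Ms m) =
    rcons (zip (sblocks J Is) Ms) (S :\: J, m).
  by rewrite zip_rcons // size_sblocks sM.
exists (k + (mdeg m + h))%N; rewrite ez; split.
- by have := chainS oJ dJ hm hb; rewrite eS.
- by rewrite prefixes_rcons ?(chain_size oJ) // finset.set0U (chain_cover oJ) pu.
- have := cardsU J (S :\: J); rewrite eS (disjoint_setI0 dJ) cards0 subn0 => ->.
  by rewrite -cats1 big_cat big_seq1 /= ?size_rcons; case: hm => _ ->; rewrite addnACA
      e; lia.
Qed.

Lemma chain_data_of_chain b S k d : is_chain b S k d -> let Is := prefixes finset.set0
    d in
  [/\ chain_path S Is, size d = (size Is).+1, zip (sblocks S Is) (unzip2 d) = d,
      chain_blocks b S Is (unzip2 d)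
    & (\sum_(m <- unzip2 d) mdeg m + #|S| = 2 * k + size Is + 1)%N].
Proof.
elim=> {b S k d} [b B h m hm hb|b S k d B h m od IH dSB hm hb] /=.
  have B0 : B != finset.set0 by rewrite -card_gt0; case: hm => _ ->.
  split=> //.
  - by rewrite /chain_path /= andbT properE finset.sub0set finset.subset0.
  - by rewrite /sblocks /= finset.setD0.
  - case=> // _; rewrite /sblocks /= finset.setD0 orbF; split=> //.
    exact: has_defect_block_mon hm.
  - by rewrite big_seq1; case: hm => _ ->; lia.
move: IH => /= [pI sI zI bI eI]; have sd := chain_size od.
have B0 : B != finset.set0 by rewrite -card_gt0; case: hm => _ ->.
have eB : (S :|: B) :\: S = B.
  apply/finset.setP => a; rewrite !inE.
  by have [aS|] := boolP (a \in S); rewrite ?(disjointFr dSB aS).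
rewrite prefixes_rcons // finset.set0U (chain_cover od).
have e2 : unzip2 (rcons d (B, m)) = rcons (unzip2 d) m by rewrite /unzip2 map_rcons.
split.
- rewrite /chain_path rcons_path last_rcons; apply/andP; split=> //.
  rewrite finset.properUl //; apply: contraNN B0 => BS.
  by rewrite -finset.subset0 -(disjoint_setI0 dSB) finset.subsetI BS fintype.subxx.
- by rewrite !size_rcons sI.
- by rewrite sblocks_rcons e2 zip_rcons ?zI ?eB // size_sblocks -sI size_map.
- move=> s; rewrite e2 size_rcons sblocks_rcons !nth_rcons size_sblocks size_map sI
    leq_eqVlt.
  case/orP => [/eqP ->|]; last first.
    move=> sl; rewrite sl; rewrite ltnS in sl; have [b1 b2] := bI s sl.
    by split=> // _; apply: b2.
  by rewrite ltnn eqxx eB orbF; split=> //; exact: has_defect_block_mon hm.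
- rewrite e2 -cats1 big_cat big_seq1 size_rcons.
  rewrite cardsU (disjoint_setI0 dSB) cards0 subn0.
  by case: hm => _ ->; rewrite addnACA /= eI; lia.
Qed.

Lemma is_chain_data_chain k (c : chain_data n) : is_chain_data k c ->
  is_chain false [set: 'I_n] k (zip (blocks c.1) c.2) /\
  blocks_fun F (zip (blocks c.1) c.2) = chain_fun F c.
Proof.
case: c => Is Ms [pI sM bI e].
have [|k' [ok pu e']] := chain_of_data (b := false) (S := [set: 'I_n]) pI sM.
  by move=> s /bI.
have -> : k = k' by move: e e'; rewrite cardsT card_ord; lia.
split=> //; rewrite /blocks_fun /chain_fun /= pu; congr (_ / _).
rewrite -(big_map snd predT (fun m => Defs.frac ('X_[m] : {mpoly F[n]}))).
by rewrite -/(unzip2 _) unzip2_zip // size_sblocks sM.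
Qed.

Lemma chain_is_chain_data k d : is_chain false [set: 'I_n] k d ->
  is_chain_data k (prefixes finset.set0 d, unzip2 d) /\
  chain_fun F (prefixes finset.set0 d, unzip2 d) = blocks_fun F d.
Proof.
move=> od; have /= [pI sI zI bI e] := chain_data_of_chain od; split.
  by split=> //; [rewrite size_map | move: e; rewrite cardsT card_ord].
by rewrite /blocks_fun /chain_fun /= big_map.
Qed.

Lemma blocks_fun_indep k (s : seq chain) (a : chain -> F) : uniq s ->
  (forall d, d \in s -> is_chain false [set: 'I_n] k d) ->
  \sum_(d <- s) a d *: blocks_fun F d = 0 -> forall d, d \in s -> a d = 0.
Proof.
move=> us oks e0 d ds; apply/eqP; rewrite -(mpolyC_eq0 n); apply/eqP.
pose P (J : {set 'I_n}) := [&& J \subset [set: 'I_n], J != finset.set0 & J != [set: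
    'I_n]].
pose Pi := \prod_(J | P J) var_sum F J.
have clearE e : e \in s -> blocks_fun F e * Defs.frac Pi = Defs.frac (cleared F [set:
    'I_n] e).
  move=> /oks oe; have /= [pI _ _ _ _] := chain_data_of_chain oe.
  have tr : transitive (fun A A' : {set 'I_n} => A \proper A').
    by move=> A B C; exact: fintype.proper_trans.
  have hP J : J \in prefixes finset.set0 e -> P J.
    move=> hJ; have [_ JT] := lchain_prefixes (chain_lchain oe) hJ.
    rewrite /P (proper_sub JT) (proper_neq JT) andbT /=.
    have /allP/(_ J) := order_path_min tr pI; rewrite mem_rcons inE hJ orbT.
    by move=> /(_ isT); rewrite properE finset.sub0set finset.subset0.
  have uI : uniq (prefixes finset.set0 e).
    have := sorted_uniq tr (fun A => fintype.properxx A) (path_sorted pI).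
    by rewrite rcons_uniq => /andP[].
  rewrite /cleared /Pi (bigID (mem (prefixes finset.set0 e))) /= !rmorphM /blocks_fun.
  have -> : \prod_(J | P J && (J \in prefixes finset.set0 e)) var_sum F J =
      \prod_(J <- prefixes finset.set0 e) var_sum F J.
    rewrite big_uniq //=; apply: eq_bigl => J.
    by rewrite andbC; case: (boolP (_ \in _)) => //= /hP ->.
  rewrite !rmorph_prod /= -[X in _ / X]/(\prod_(I <- prefixes finset.set0 e) Defs.frac
      (var_sum F I)).
  set D := \prod_(I <- _) _; have D0 : D != 0.
    rewrite /D prodf_seq_neq0; apply/allP => J /hP /and3P[_ J0 _].
    by rewrite /= tofrac_eq0 sumX_neq0.
  rewrite mulrA mulfVK //; congr (_ * _).
  by apply: eq_bigl => J; rewrite /P -!andbA.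
apply: (cleared_indep (S := [set: 'I_n]) (a := fun d => (a d)%:MP) (ltnSn _) us) ds.
- by move=> e /oks; exact: chain_lchain.
- move=> e _ m i _ mi; rewrite mcoeffC; case: eqP => [m0|_]; last by rewrite mulr0.
  by move: mi; rewrite m0 mnm0E.
apply/eqP; rewrite -(tofrac_eq0 (\sum_(d <- s) _)); apply/eqP.
rewrite -[tofrac _]/(Defs.frac _) rmorph_sum /=.
transitivity ((\sum_(d <- s) a d *: blocks_fun F d) * Defs.frac Pi); last by rewrite e0
    mul0r.
rewrite mulr_suml; apply: eq_big_seq => e es.
by rewrite rmorphM rscale_mull clearE.
Qed.

End ChainData.

(** * The coefficient map is an isomorphism *)

Section MainLemmas.
Variables (F : fieldType) (n k : nat).
Hypothesis charF0 : [pchar F] =i pred0.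
Local Notation NZ := (freeNZ F 'I_n).
Local Notation K := (ratfun F n).
Local Notation chain := (seq ({set 'I_n} * 'X_{1..n})).
Implicit Types (d : chain).
Local Notation phi := (coefmap F [set: 'I_n]).

Lemma lspan_uniq (V : lmodType F) (T : eqType) (D : T -> Prop) (v : T -> V) x :
  lspan (fun y => exists2 t, D t & y = v t) x ->
  exists (s : seq T) (a : T -> F),
    [/\ uniq s, forall t, t \in s -> D t & x = \sum_(t <- s) a t *: v t].
Proof.
elim/lspan_ind => [|c _ y [t Dt ->] [s [a [us Ds ->]]]].
  by exists [::], (fun _ => 0); split=> //; rewrite big_nil.
have [ts|ts] := boolP (t \in s).
  exists s, (fun u => if u == t then c + a t else a u); split=> //.
  rewrite (bigD1_seq t) //= [RHS](bigD1_seq t) //= eqxx scalerDl addrA.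
  by congr (_ + _); apply: eq_bigr => u /negPf ->.
exists (t :: s), (fun u => if u == t then c else a u); split=> /=.
- by rewrite ts.
- by move=> u; rewrite inE => /orP[/eqP -> //|/Ds].
rewrite big_cons eqxx; congr (_ + _); apply: eq_big_seq => u us'.
by case: eqP us' ts => // -> ->.
Qed.

Lemma chain_prod_coef d : is_chain false [set: 'I_n] k d ->
  has_coef [set: 'I_n] k (chain_prod F d) (blocks_fun F d).
Proof. by move=> od; apply: has_coef_bracket od => // *; exact: has_coef_diff_mon. Qed.

Lemma NZcomp_chain_span x : NZcomp F n k x ->
  lspan (fun y => exists2 d, is_chain false [set: 'I_n] k d & y = chain_prod F d) x.
Proof.
apply: lspan_sub => _ [T [hT <- ->]].
have uT : uniq (leaves T) by rewrite (perm_uniq hT) enum_uniq.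
by have := monNZ_chain_span charF0 uT; rewrite (multilinear_set hT).
Qed.

(** An element with coefficient zero is a combination of chains of differential
    monomials; the functions of these are independent. *)
Lemma coefmap_inj0 x : NZcomp F n k x -> phi x = 0 -> x = 0.
Proof.
move=> /NZcomp_chain_span/lspan_uniq[s [a [us oks ->]]] e0.
have a0 : forall d, d \in s -> a d = 0.
  apply: (blocks_fun_indep us oks); rewrite -[RHS]e0 linear_sum /=.
  by apply: eq_big_seq => d /oks/chain_prod_coef[_ <-]; rewrite linearZ.
by rewrite big1_seq // => d /andP[_ /a0 ->]; rewrite scale0r.
Qed.

Lemma coefmap_inj x y : NZcomp F n k x -> NZcomp F n k y -> phi x = phi y -> x = y.
Proof.
move=> hx hy exy; apply/eqP; rewrite -subr_eq0; apply/eqP; apply: coefmap_inj0.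
  exact: lspanB.
by rewrite linearB /= exy subrr.
Qed.

Lemma coefmap_Rcomp x : NZcomp F n k x -> Rcomp F n k (phi x).
Proof.
elim/lspan_ind => [|a _ y [T [hT kT ->]] IH]; first by rewrite linear0; exact: lspan0.
rewrite linearP coefmapE //; apply: lspan_lin IH.
by exists T.
Qed.

Lemma coefmap_surj r : Rcomp F n k r -> exists2 x, NZcomp F n k x & phi x = r.
Proof.
elim/lspan_ind => [|a _ r' [T [hT kT ->]] [x hx <-]].
  by exists 0; [exact: lspan0 | exact: linear0].
exists (a *: monNZ F T + x); last by rewrite linearP coefmapE.
by apply: lspan_lin hx; exists T.
Qed.

Lemma coefmap_bij : set_bij (NZcomp F n k) (Rcomp F n k) phi.
Proof.
split.
- by move=> x; exact: coefmap_Rcomp.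
- by move=> x y; rewrite !inE; exact: coefmap_inj.
- by move=> r /coefmap_surj[x hx <-]; exists x.
Qed.

Variable ch : block_choice n.
Hypothesis adm : admissible ch.

Lemma chain_elt_coef (c : chain_data n) : is_chain_data k c ->
  NZcomp F n k (chain_elt F ch c) /\ phi (chain_elt F ch c) = chain_fun F c.
Proof.
move=> hc; have [oc <-] := is_chain_data_chain F hc.
apply: (has_coef_bracket charF0 (f := beta F ch)) oc => h B m.
exact: has_coef_beta.
Qed.

Lemma tilde_coef b : Bset F n k b ->
  NZcomp F n k (tilde ch k b) /\ phi (tilde ch k b) = b.
Proof.
move=> [c hc eb]; rewrite /tilde.
set Q := (fun _ => _ /\ _); have [hc' eb'] : Q (xget ([::], [::]) Q).
  by apply: xgetPex; exists c.
by rewrite [in RHS]eb'; exact: chain_elt_coef.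
Qed.

(** Injectivity of the coefficient map identifies the elements attached to
    chain data with the chains of differential monomials, as they have the same
    coefficients. *)
Lemma tilde_basis : is_basis (Bset F n k) (tilde ch k) (NZcomp F n k).
Proof.
split=> [b /tilde_coef[]//|s a us Bs e0|x /NZcomp_chain_span].
  have /choice[c hc] : forall b, exists c, Bset F n k b -> is_chain_data k c /\ b =
      chain_fun F c.
    by move=> b; have [[c h1 h2]|nb] := pselect (Bset F n k b); [exists c | exists
        ([::], [::])].
  pose d b := zip (blocks (c b).1) (c b).2.
  have hd b : b \in s -> is_chain false [set: 'I_n] k (d b) /\ blocks_fun F (d b) = b.
    move=> /Bs /hc[hb eb]; have [od ed] := is_chain_data_chain F hb.
    by split=> //; rewrite ed.
  have e1 : \sum_(e <- map d s) a (blocks_fun F e) *: blocks_fun F e = 0.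
    transitivity (phi (\sum_(b <- s) a b *: tilde ch k b)); last by rewrite e0 linear0.
    rewrite big_map linear_sum /=; apply: eq_big_seq => b bs.
    by have [_ ->] := hd b bs; rewrite linearZ /= (proj2 (tilde_coef (Bs b bs))).
  move=> b bs; have := blocks_fun_indep (k := k) (a := fun e => a (blocks_fun F e)) _ _
      e1 (map_f d bs).
  have [_ ->] := hd b bs; apply.
    rewrite map_inj_in_uniq // => b1 b2 b1s b2s /(congr1 (fun e => blocks_fun F e)) /=.
    by have [_ ->] := hd b1 b1s; have [_ ->] := hd b2 b2s.
  by move=> e /mapP[b' bs' ->]; have [] := hd b' bs'.
apply: lspan_sub => _ [d od ->]; apply: lspan_gen.
have [hc ec] := chain_is_chain_data F od; have [h1 h2] := chain_prod_coef od.
have Bb : Bset F n k (blocks_fun F d) by exists (prefixes finset.set0 d, unzip2 d).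
exists (blocks_fun F d) => //; have [h3 h4] := tilde_coef Bb.
by apply: coefmap_inj; rewrite // h2 h4.
Qed.

End MainLemmas.

Theorem theorem3 (F : fieldType) (charF0 : [pchar F] =i pred0)
    (n k : nat) (n_ge1 : (1 <= n)%N) (k_le : (k <= n - 1)%N)
    (ch : block_choice n) (ch_adm : admissible ch) :
  [/\ set_bij (NZcomp F n k) (Rcomp F n k) (coefmap F [set: 'I_n]),
      forall b d, is_chain_data k d -> b = chain_fun F d ->
        tilde ch k b = chain_elt F ch d /\ NZcomp F n k (tilde ch k b)
    & is_basis (Bset F n k) (tilde ch k) (NZcomp F n k)].
Proof.
split; [exact: coefmap_bij | | exact: tilde_basis].
move=> b d hd eb; have Bb : Bset F n k b by exists d.
have [h1 h2] := tilde_coef charF0 ch_adm Bb.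
have [h3 h4] := chain_elt_coef charF0 ch_adm hd.
by split=> //; apply: (coefmap_inj charF0 h1 h3); rewrite h2 h4.
Qed.
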